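(* Let $n$ be a nonzero integer. If $|n|\le 400$, then $M_n\le 32$. If $|n|\ge 400$, then $M_n<267.81\,\log|n|\,(\log\log|n|)^2$.
   Context: Let $n$ be a nonzero integer. A set of positive integers $S$ has the property $D(n)$ if $xy+n$ is a perfect square for all distinct $x,y\in S$. Define $M_n=\sup\{|S| : S \text{ has the property } D(n)\}$, where $|S|$ is the number of elements of $S$. Here $\log$ is the natural logarithm. *)

(* Defs.v *)
From Stdlib Require Import Reals ZArith List.
Open Scope Z_scope.

Definition has_property_D (n : Z) (S : Z -> Prop) : Prop :=
  (forall x, S x -> 0 < x) /\
  (forall x y, S x -> S y -> x <> y -> exists k : Z, x * y + n = k * k).

Definition enumerates (S : Z -> Prop) (l : list Z) : Prop :=
  NoDup l /\ (forall x, S x <-> In x l).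

(* Main.v *)
(* Elements [a < b < c] above [n^2] satisfy [c = a + b + 2 sqrt (a b + n)] or [c >= 4 a b / n^2], and
   the first case does not persist, so the logarithms of the large elements grow like Fibonacci
   numbers. On the other hand, [a d + n], [b d + n] and [c d + n] being squares [x^2], [y^2], [z^2],
   the quotients of [x] and [y] by [z] approximate rational multiples of the numbers
   [sqrt (1 + n / (a c))] and [sqrt (1 + n / (b c))] simultaneously. Divided differences of
   [(1 + z)^(k + 1/2)] at three nodes are Hermite-Pade approximants which limit the quality of such
   approximations, so [d] is at most a power of [c]. This leaves at most 19 large elements.

   The small elements are counted by Gallagher's larger sieve: modulo a prime [p] the residues of the
   set form a clique in the graph with edges [u v + n] = square. For [|n| <= 400] the clique numbers
   for [p <= 173] are bounded by a greedy colouring search. In general, counting points on conics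
   shows that they are at most [2 sqrt p + O(1)], and Chebyshev's estimate for the primes then
   bounds the number of small elements by [320 log |n| + 9], which is less than the claimed
   bound since [267.81 (log log 400)^2 > 320]. *)
Require Import Defs.
From Stdlib Require Import Reals ZArith Znumtheory List Lia Lra Psatz Bool Classical Permutation
  Sorted FMapPositive FunctionalExtensionality.
From mathcomp Require all_boot all_algebra ring zify.
From Coquelicot Require Import Coquelicot.
Import ListNotations.

(** * Gap principle *)

Open Scope Z_scope.

(** The cut between small and large elements is [max (n^2) 1024] for [|n| <= 400] and [|n|^3]
    otherwise. The gap principle only needs elements above [n^2], but the Fibonacci growth is that
    of [ln (4 x / n^2)], and it helps only if this starts as a fixed fraction of [ln x]. Beyond
    [|n|^3] it is at least a third; for [|n| <= 400] the factor 4 and [|n| <= 2^9] still give a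
    ninth, with a lower cut that keeps the sieve strong. The floor 1024 lets the logarithms of
    numerical constants be absorbed. The two bounds are the sums [13 + 19 = 32] and
    [(320 log |n| + 9) + 19].

    The delicate point of the approximation part is that the integer linear form must not vanish at
    the given integer point. For each [k] three neighbouring approximants are available; if all
    three forms vanished, a contiguity relation for the half-integral exponent would carry the
    vanishing down to a form that is visibly nonzero. Residues are treated algebraically, as
    coefficients of quotients of power series, so that no contour integral occurs. *)

Lemma abs_le_square (n : Z) : Z.abs n <= n * n.
Proof.
  rewrite <- Z.abs_square. destruct (Z.eq_dec n 0) as [->|H]; [easy|].
  rewrite <- (Z.mul_1_r (Z.abs n)) at 1. apply Z.mul_le_mono_nonneg_l; lia.
Qed.

(** [e] is the defect of regularity: [e = 0] forces [c = a + b + 2 r] up to the sign of the root.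
    The last identity is the formula for [c] in terms of [e], multiplied by [n^2] to stay in the
    integers. *)
Lemma triple_identities (n a b c r s t : Z) :
  a * b + n = r * r -> a * c + n = s * s -> b * c + n = t * t ->
  let e := n * (a + b + c) + 2 * (a * b * c) - 2 * (r * s * t) in
  a * e + n * n = (a * t - r * s) * (a * t - r * s) /\
  b * e + n * n = (b * s - r * t) * (b * s - r * t) /\
  c * e + n * n = (c * r - s * t) * (c * r - s * t) /\
  c * (n * n) = (a + b) * (n * n) + n * e
                + 2 * (a * b * e + r * ((a * t - r * s) * (b * s - r * t))).
Proof.
  intros Hr Hs Ht e; unfold e.
  assert (Hrs : r * r * (s * s) = (a * b + n) * (a * c + n)) by (rewrite Hr, Hs; ring).
  assert (Hrt : r * r * (t * t) = (a * b + n) * (b * c + n)) by (rewrite Hr, Ht; ring).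
  assert (Hst : s * s * (t * t) = (a * c + n) * (b * c + n)) by (rewrite Hs, Ht; ring).
  repeat split.
  - replace ((a * t - r * s) * (a * t - r * s))
      with (a * a * (t * t) - 2 * a * (r * s * t) + r * r * (s * s)) by ring.
    rewrite Hrs, <- Ht; ring.
  - replace ((b * s - r * t) * (b * s - r * t))
      with (b * b * (s * s) - 2 * b * (r * s * t) + r * r * (t * t)) by ring.
    rewrite Hrt, <- Hs; ring.
  - replace ((c * r - s * t) * (c * r - s * t))
      with (c * c * (r * r) - 2 * c * (r * s * t) + s * s * (t * t)) by ring.
    rewrite Hst, <- Hr; ring.
  - replace (r * ((a * t - r * s) * (b * s - r * t)))
      with ((r * s * t) * (a * b + r * r) - a * (r * r) * (t * t) - b * (r * r) * (s * s)) by ring.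
    rewrite <- Hs, <- Ht, <- Hr; ring.
Qed.

(** Since [c e + n^2] is a square and [c > n^2], the integer [e] is not negative. Either it is 0,
    the regular case, or it is at least 1, and then the terms [a b e] and [r x y] in the formula for
    [c] are each about [a b] or larger. *)
Lemma triple_dichotomy (n a b c r s t : Z) :
  n <> 0 -> n * n < a -> a < b -> b < c ->
  0 <= r -> 0 <= s -> 0 <= t ->
  a * b + n = r * r -> a * c + n = s * s -> b * c + n = t * t ->
  c = a + b + 2 * r \/ 4 * (a * b) <= c * (n * n).
Proof.
  intros Hn Ha Hab Hbc Hr0 Hs0 Ht0 Hr Hs Ht.
  destruct (triple_identities n a b c r s t Hr Hs Ht) as (E1 & E2 & E3 & E4).
  set (e := n * (a + b + c) + 2 * (a * b * c) - 2 * (r * s * t)) in *.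
  set (x := a * t - r * s) in *. set (y := b * s - r * t) in *.
  set (z := c * r - s * t) in *.
  assert (Hn1 := abs_le_square n).
  assert (He : 0 <= e).
  { clearbody e x y z. destruct (Z_lt_ge_dec e 0) as [L|G]; [exfalso|lia].
    assert (0 <= z * z) by apply Z.square_nonneg.
    assert (c * e <= c * -1) by (apply Z.mul_le_mono_nonneg_l; lia). lia. }
  assert (Habs : Z.abs n < a) by lia.
  assert (Hx : (a * t) * (a * t) - (r * s) * (r * s) = - n * (a * b + a * c + n - a * a)).
  { replace ((a * t) * (a * t)) with (a * a * (t * t)) by ring.
    replace ((r * s) * (r * s)) with ((r * r) * (s * s)) by ring.
    rewrite <- Hr, <- Hs, <- Ht; ring. }
  assert (Hy : (b * s) * (b * s) - (r * t) * (r * t) = - n * (a * b + b * c + n - b * b)).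
  { replace ((b * s) * (b * s)) with (b * b * (s * s)) by ring.
    replace ((r * t) * (r * t)) with ((r * r) * (t * t)) by ring.
    rewrite <- Hr, <- Hs, <- Ht; ring. }
  assert (Kx : 0 < a * b + a * c + n - a * a).
  { assert (a * a <= a * b) by (apply Z.mul_le_mono_nonneg_l; lia).
    assert (a * 1 <= a * c) by (apply Z.mul_le_mono_nonneg_l; lia). lia. }
  assert (Ky : 0 < a * b + b * c + n - b * b).
  { assert (b * b <= b * c) by (apply Z.mul_le_mono_nonneg_l; lia).
    assert (a * 1 <= a * b) by (apply Z.mul_le_mono_nonneg_l; lia). lia. }
  assert (P1 : 0 <= a * t) by (apply Z.mul_nonneg_nonneg; lia).
  assert (P2 : 0 <= r * s) by (apply Z.mul_nonneg_nonneg; lia).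
  assert (P3 : 0 <= b * s) by (apply Z.mul_nonneg_nonneg; lia).
  assert (P4 : 0 <= r * t) by (apply Z.mul_nonneg_nonneg; lia).
  (* [x] and [y] have the same sign, opposite to that of [n]: the differences of squares in [Hx] and
     [Hy] are [-n] times positive numbers. *)
  assert (Hxy : 0 <= x * y).
  { destruct (Z_lt_ge_dec 0 n).
    - assert (0 <= n * (a * b + a * c + n - a * a)) by (apply Z.mul_nonneg_nonneg; lia).
      assert (0 <= n * (a * b + b * c + n - b * b)) by (apply Z.mul_nonneg_nonneg; lia).
      assert (a * t <= r * s) by (apply Z.square_le_simpl_nonneg; lia).
      assert (b * s <= r * t) by (apply Z.square_le_simpl_nonneg; lia).
      apply Z.mul_nonpos_nonpos; unfold x, y; lia.
    - assert (0 <= - n * (a * b + a * c + n - a * a)) by (apply Z.mul_nonneg_nonneg; lia).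
      assert (0 <= - n * (a * b + b * c + n - b * b)) by (apply Z.mul_nonneg_nonneg; lia).
      assert (r * s <= a * t) by (apply Z.square_le_simpl_nonneg; lia).
      assert (r * t <= b * s) by (apply Z.square_le_simpl_nonneg; lia).
      apply Z.mul_nonneg_nonneg; unfold x, y; lia. }
  clearbody x y z e. clear P1 P2 P3 P4 Hx Hy Kx Ky.
  assert (Hn0 : 0 < n * n) by lia.
  destruct (Z.eq_dec e 0) as [E0 | E0].
  - left. subst e.
    assert (Hxy2 : (x * y) * (x * y) = (n * n) * (n * n)).
    { replace ((x * y) * (x * y)) with ((x * x) * (y * y)) by ring.
      rewrite <- E1, <- E2. ring. }
    assert (Hp : x * y = n * n).
    { apply Z.le_antisymm; apply Z.square_le_simpl_nonneg; lia. }
    rewrite Hp in E4. apply (Z.mul_reg_r _ _ (n * n)); lia.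
  - right. assert (He1 : 1 <= e) by lia.
    assert (Hpos : 0 < a * b) by (apply Z.mul_pos_pos; lia).
    assert (Hm : Z.abs n < a * b).
    { assert (a * 1 <= a * b) by (apply Z.mul_le_mono_nonneg_l; lia). lia. }
    assert (Hq : (a * b) * (e * e) <= (x * y) * (x * y)).
    { replace ((x * y) * (x * y)) with ((x * x) * (y * y)) by ring.
      rewrite <- E1, <- E2.
      assert (0 <= e * (a + b) * (n * n)) 
        by (apply Z.mul_nonneg_nonneg; [apply Z.mul_nonneg_nonneg|]; lia).
      assert (0 <= (n * n) * (n * n)) by (apply Z.mul_nonneg_nonneg; lia). lia. }
    (* Here [r^2 = a b + n] and [(x y)^2 >= a b e^2], and both [a b + n] and [a b] are at least
       [a b - |n|]. *)
    assert (Hr2 : e * (a * b - Z.abs n) <= r * (x * y)).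
    { apply Z.square_le_simpl_nonneg; [apply Z.mul_nonneg_nonneg; lia|].
      replace (r * (x * y) * (r * (x * y))) with ((r * r) * ((x * y) * (x * y))) by ring.
      rewrite <- Hr.
      apply Z.le_trans with ((a * b + n) * (a * b * (e * e))).
      2:{ apply Z.mul_le_mono_nonneg_l; lia. }
      replace (e * (a * b - Z.abs n) * (e * (a * b - Z.abs n)))
        with ((a * b - Z.abs n) * (a * b - Z.abs n) * (e * e)) by ring.
      replace ((a * b + n) * (a * b * (e * e))) with ((a * b + n) * (a * b) * (e * e)) by ring.
      apply Z.mul_le_mono_nonneg_r; [apply Z.square_nonneg|].
      apply Z.mul_le_mono_nonneg; lia. }
    (* Reduces [e >= 1] to [e = 1]; the loss [n - 2 |n|] is made up by [(a + b) n^2 >= 5 n^2]. *)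
    assert (Hz : 0 <= (e - 1) * (4 * (a * b) + n - 2 * Z.abs n)) by (apply Z.mul_nonneg_nonneg; lia).
    assert (5 * (n * n) <= (a + b) * (n * n)) by (apply Z.mul_le_mono_nonneg_r; lia).
    lia.
Qed.

Lemma square_nonneg_root (m k : Z) : m = k * k -> exists r, 0 <= r /\ m = r * r.
Proof. intros ->. exists (Z.abs k). split; [lia | now rewrite Z.abs_square]. Qed.

Lemma has_property_D_root (n : Z) (S : Z -> Prop) (x y : Z) :
  has_property_D n S -> S x -> S y -> x < y -> exists r, 0 <= r /\ x * y + n = r * r.
Proof.
  intros [_ H] Hx Hy Hxy. destruct (H x y Hx Hy ltac:(lia)) as [k Hk].
  exact (square_nonneg_root _ _ Hk).
Qed.

(** In the regular case [r >= a], because [a b + n >= a^2 + a - |n|]; otherwise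
    [c >= 4 a b / n^2 > 4 b]. This serves for the third smallest large element, where
    [fourth_element_gap] does not apply yet. *)
Lemma third_element_gap (n : Z) (S : Z -> Prop) (a b c : Z) :
  has_property_D n S -> n <> 0 -> S a -> S b -> S c ->
  n * n < a -> a < b -> b < c -> 3 * a + b <= c.
Proof.
  intros HS Hn Sa Sb Sc Ha Hab Hbc.
  destruct (has_property_D_root n S a b HS Sa Sb Hab) as (r & Hr0 & Hr).
  destruct (has_property_D_root n S a c HS Sa Sc ltac:(lia)) as (s & Hs0 & Hs).
  destruct (has_property_D_root n S b c HS Sb Sc Hbc) as (t & Ht0 & Ht).
  destruct (triple_dichotomy n a b c r s t) as [E|E]; try assumption.
  - assert (Hn1 : Z.abs n <= n * n).
    { rewrite <- Z.abs_square.
      assert (Z.abs n * 1 <= Z.abs n * Z.abs n) by (apply Z.mul_le_mono_nonneg_l; lia). lia. }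
    assert (a * (a + 1) <= a * b) by (apply Z.mul_le_mono_nonneg_l; lia).
    assert (a <= r) by (apply Z.square_le_simpl_nonneg; lia). lia.
  - assert (Hn0 : 0 < n * n) by lia.
    assert (n * n * b <= a * b) by (apply Z.mul_le_mono_nonneg_r; lia).
    assert (4 * b <= c) by (apply (Z.mul_le_mono_pos_r _ _ (n * n)); lia). lia.
Qed.

(* The regular extension [a + b + 2r] of [{a, b}] is below [4b], hence it cannot be an irregular
   extension of [{w, b}], and it differs from the regular extension of [{w, b}]. *)
Lemma fourth_element_gap (n : Z) (S : Z -> Prop) (w a b c : Z) :
  has_property_D n S -> n <> 0 -> S w -> S a -> S b -> S c ->
  n * n < w -> w < a -> a < b -> b < c -> 4 * (a * b) <= c * (n * n).
Proof.
  intros HS Hn Sw Sa Sb Sc Hw Hwa Hab Hbc.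
  destruct (has_property_D_root n S a b HS Sa Sb Hab) as (r & Hr0 & Hr).
  destruct (has_property_D_root n S a c HS Sa Sc ltac:(lia)) as (s & Hs0 & Hs).
  destruct (has_property_D_root n S b c HS Sb Sc Hbc) as (t & Ht0 & Ht).
  destruct (has_property_D_root n S w b HS Sw Sb ltac:(lia)) as (r' & Hr0' & Hr').
  destruct (has_property_D_root n S w c HS Sw Sc ltac:(lia)) as (s' & Hs0' & Hs').
  destruct (triple_dichotomy n a b c r s t) as [E|E]; try assumption; try lia.
  assert (Hn1 := abs_le_square n).
  assert (Hn0 : 0 < n * n) by lia.
  exfalso.
  destruct (triple_dichotomy n w b c r' s' t) as [E'|E']; try assumption; try lia.
  - assert (r < r') by lia.
    assert (r * r < r' * r') by (apply Z.square_lt_mono_nonneg; lia).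
    assert (w * b <= a * b) by (apply Z.mul_le_mono_nonneg_r; lia). lia.
  - assert (a * b <= (b - 1) * b) by (apply Z.mul_le_mono_nonneg_r; lia).
    assert (r < b) by (apply Z.square_lt_simpl_nonneg; lia).
    assert (n * n * b <= w * b) by (apply Z.mul_le_mono_nonneg_r; lia).
    assert (4 * b <= c) by (apply (Z.mul_le_mono_pos_r _ _ (n * n)); lia). lia.
Qed.

(** * Divided differences of [(1 + z)^(k + 1/2)] *)

Open Scope R_scope.

(** * Generalised binomial coefficients and the series of [(1 + y)^(j - 1/2)] *)

Fixpoint gbin (t : R) (h : nat) : R :=
  match h with
  | O => 1
  | S h' => gbin t h' * (t - INR h') / INR (S h')
  end.

Lemma gbin_S (t : R) (h : nat) : gbin t (S h) = gbin t h * (t - INR h) / INR (S h).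
Proof. reflexivity. Qed.

Lemma INR_S_neq0 (h : nat) : INR (S h) <> 0.
Proof. apply not_0_INR; lia. Qed.

Lemma gbin_pascal (t : R) (h : nat) : gbin (t + 1) (S h) = gbin t (S h) + gbin t h.
Proof.
  induction h as [|h IH]; [simpl; field|].
  rewrite gbin_S, IH, (gbin_S t (S h)), (gbin_S t h).
  assert (H1 := INR_S_neq0 h). assert (H2 := INR_S_neq0 (S h)).
  rewrite (S_INR (S h)), (S_INR h) in *. field. split; assumption.
Qed.

(** The binomial coefficient [r + i] over [i], which is the coefficient of [z^i] in
    [(1 - z)^(- r - 1)]; in this role it appears in the expansion at a repeated node. *)
Definition multichoose (r i : nat) : R := INR (fact (r + i)) / (INR (fact r) * INR (fact i)).

Lemma multichoose_0r (r : nat) : multichoose r 0 = 1.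
Proof.
  unfold multichoose. rewrite Nat.add_0_r. simpl fact. simpl INR.
  field. apply INR_fact_neq_0.
Qed.

Lemma multichoose_0l (i : nat) : multichoose 0 i = 1.
Proof. unfold multichoose. simpl. field. apply INR_fact_neq_0. Qed.

Lemma multichoose_pascal (r i : nat) :
  multichoose (S r) (S i) = multichoose r (S i) + multichoose (S r) i.
Proof.
  unfold multichoose.
  replace (S r + S i)%nat with (S (S (r + i))) by lia.
  replace (r + S i)%nat with (S (r + i)) by lia.
  replace (S r + i)%nat with (S (r + i)) by lia.
  rewrite (fact_simpl (S (r + i))), (fact_simpl r), (fact_simpl i), !mult_INR.
  assert (H1 := INR_fact_neq_0 r). assert (H2 := INR_fact_neq_0 i).
  assert (H3 := INR_S_neq0 r). assert (H4 := INR_S_neq0 i).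
  rewrite (S_INR (S (r + i))), (S_INR (r + i)), plus_INR in *.
  rewrite !S_INR in *. field. repeat split; assumption.
Qed.

Lemma multichoose_S (r i : nat) :
  multichoose r (S i) * INR (S i) = multichoose r i * INR (S (r + i)).
Proof.
  unfold multichoose. replace (r + S i)%nat with (S (r + i)) by lia.
  rewrite (fact_simpl (r + i)), (fact_simpl i), !mult_INR.
  field. repeat split; try apply INR_fact_neq_0. apply INR_S_neq0.
Qed.

Lemma multichoose_int (r i : nat) : exists z : Z, multichoose r i = IZR z.
Proof.
  revert i; induction r as [|r IHr]; intros i.
  - exists 1%Z. apply multichoose_0l.
  - induction i as [|i [z IHi]].
    + exists 1%Z. apply multichoose_0r.
    + destruct (IHr (S i)) as [z' Hz']. exists (z' + z)%Z.
      rewrite multichoose_pascal, Hz', IHi, plus_IZR. reflexivity.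
Qed.

(** Trinomial revision. It turns the series of a divided difference at an [r + 1]-fold node into a
    binomial series with exponent [t - r]. *)
Lemma gbin_split (t : R) (r i : nat) :
  gbin t (r + i) * multichoose r i = gbin t r * gbin (t - INR r) i.
Proof.
  induction i as [|i IH].
  - rewrite Nat.add_0_r, multichoose_0r. simpl. ring.
  - replace (r + S i)%nat with (S (r + i)) by lia.
    apply (Rmult_eq_reg_r (INR (S i))); [|apply INR_S_neq0].
    rewrite Rmult_assoc, multichoose_S, !gbin_S.
    replace (gbin t (r + i) * (t - INR (r + i)) / INR (S (r + i)) * (multichoose r i * INR (S (r + i))))
      with (gbin t (r + i) * multichoose r i * (t - INR (r + i))) by (field; apply INR_S_neq0).
    rewrite IH, plus_INR. field. apply INR_S_neq0.
Qed.

Lemma gbin_mhalf (h : nat) : gbin (- / 2) h = (- / 4) ^ h * multichoose h h.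
Proof.
  induction h as [|h IH].
  - rewrite multichoose_0r. simpl; ring.
  - rewrite gbin_S, IH. unfold multichoose.
    replace (S h + S h)%nat with (S (S (h + h))) by lia.
    rewrite (fact_simpl (S (h + h))), (fact_simpl (h + h)), (fact_simpl h), !mult_INR.
    assert (H1 := INR_fact_neq_0 h). assert (H3 := INR_S_neq0 h).
    rewrite !S_INR, plus_INR in *. simpl pow. field. split; assumption.
Qed.

(** For [j = 0] this is a central binomial coefficient up to sign, and Pascal's rule raises [j].
    Apart from the denominator of the node, powers of 4 are thus all that has to be cleared from the
    Taylor coefficients of [(1 + z)^(k + 1/2)]. *)
Lemma gbin_half_int (j h : nat) : exists z : Z, 4 ^ h * gbin (INR j - / 2) h = IZR z.
Proof.
  revert h; induction j as [|j IH]; intros h.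
  - destruct (multichoose_int h h) as [z Hz]. exists ((-1) ^ Z.of_nat h * z)%Z.
    replace (INR 0 - / 2) with (- / 2) by (simpl; ring).
    rewrite gbin_mhalf, Hz, mult_IZR, <- pow_IZR, <- Rmult_assoc, <- Rpow_mult_distr.
    do 2 f_equal. field.
  - destruct h as [|h]; [exists 1%Z; simpl; ring|].
    destruct (IH (S h)) as [z Hz]. destruct (IH h) as [z' Hz'].
    exists (z + 4 * z')%Z.
    replace (INR (S j) - / 2) with (INR j - / 2 + 1) by (rewrite S_INR; ring).
    rewrite gbin_pascal, plus_IZR, mult_IZR, <- Hz, <- Hz'. simpl pow. ring.
Qed.

Lemma gbin_mhalf_bound (h : nat) : Rabs (gbin (- / 2) h) <= 1.
Proof.
  induction h as [|h IH]; [simpl; rewrite Rabs_R1; lra|].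
  rewrite gbin_S. unfold Rdiv. rewrite Rmult_assoc, Rabs_mult.
  rewrite <- (Rmult_1_r 1). apply Rmult_le_compat; try apply Rabs_pos; try assumption.
  assert (0 <= INR h) by apply pos_INR.
  rewrite S_INR. change (Rabs ((- / 2 - INR h) / (INR h + 1)) <= 1).
  rewrite Rabs_div by lra. rewrite (Rabs_left (- / 2 - INR h)) by lra.
  rewrite (Rabs_right (INR h + 1)) by lra.
  apply (Rmult_le_reg_r (INR h + 1)); [lra|]. field_simplify; lra.
Qed.

Lemma gbin_half_bound (j h : nat) : Rabs (gbin (INR j - / 2) h) <= 2 ^ j.
Proof.
  revert h; induction j as [|j IH]; intros h.
  - replace (INR 0 - / 2) with (- / 2) by (simpl; ring). apply gbin_mhalf_bound.
  - destruct h as [|h].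
    + simpl gbin. rewrite Rabs_R1. apply pow_R1_Rle; lra.
    + replace (INR (S j) - / 2) with (INR j - / 2 + 1) by (rewrite S_INR; ring).
      rewrite gbin_pascal. eapply Rle_trans; [apply Rabs_triang|].
      simpl pow. assert (A := IH (S h)). assert (B := IH h). lra.
Qed.

Lemma geom_bound_ex_series (a : nat -> R) (K : R) (y : R) :
  (forall h, Rabs (a h) <= K) -> Rabs y < 1 -> ex_series (fun h => Rabs (a h * y ^ h)).
Proof.
  intros Ha Hy.
  apply (@ex_series_le R_AbsRing R_CompleteNormedModule _ (fun h => K * Rabs y ^ h)).
  - intros h. change (Rabs (Rabs (a h * y ^ h)) <= K * Rabs y ^ h).
    rewrite Rabs_Rabsolu, Rabs_mult, <- RPow_abs.
    apply Rmult_le_compat_r; [apply pow_le, Rabs_pos | apply Ha].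
  - apply (@ex_series_scal R_AbsRing). apply ex_series_geom. rewrite Rabs_Rabsolu; exact Hy.
Qed.

Lemma CV_radius_bounded_ge1 (a : nat -> R) (K : R) :
  (forall h, Rabs (a h) <= K) -> Rbar_le 1 (CV_radius a).
Proof.
  intros Ha. apply (proj1 (CV_radius_bounded a)).
  exists K. intros h. rewrite pow1, Rmult_1_r. apply Ha.
Qed.

(** The series [f] solves [(1 + x) f' = - f / 2], so [f sqrt (1 + x)] has derivative 0 and keeps its
    value at 0. *)
Lemma PSeries_gbin_mhalf (y : R) : Rabs y < 1 -> PSeries (gbin (- / 2)) y = / sqrt (1 + y).
Proof.
  intros Hy.
  set (a := gbin (- / 2)).
  assert (Hcv : forall x, Rabs x < 1 -> Rbar_lt (Rabs x) (CV_radius a)).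
  { intros x Hx. apply Rbar_lt_le_trans with 1; [exact Hx|].
    apply (CV_radius_bounded_ge1 a 1), gbin_mhalf_bound. }
  assert (Hode : forall x, Rabs x < 1 -> (1 + x) * PSeries (PS_derive a) x = - / 2 * PSeries a x).
  { intros x Hx.
    assert (E1 : ex_pseries (PS_derive a) x).
    { apply CV_radius_inside. rewrite CV_radius_derive. now apply Hcv. }
    rewrite Rmult_plus_distr_r, Rmult_1_l, <- PSeries_incr_1, <- PSeries_plus, <- PSeries_scal;
      [|assumption|now apply ex_pseries_incr_1].
    apply PSeries_ext. intros [|h]; unfold PS_plus, PS_incr_1, PS_derive, PS_scal, a;
      change plus with Rplus; change scal with Rmult; rewrite !gbin_S.
    - simpl. unfold zero; simpl. field.
    - rewrite !S_INR. assert (0 <= INR h) by apply pos_INR. field. lra. }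
  assert (Hd : forall x, Rabs x < 1 -> is_derive (fun x => PSeries a x * sqrt (1 + x)) x 0).
  { intros x Hx.
    assert (Hx1 : 0 < 1 + x) by (apply Rabs_def2 in Hx; lra).
    assert (Hs := sqrt_lt_R0 _ Hx1).
    evar_last.
    - apply (is_derive_mult (PSeries a) (fun x => sqrt (1 + x)));
        [apply is_derive_PSeries; now apply Hcv | auto_derive; [exact Hx1 | reflexivity] | intros; apply Rmult_comm].
    - change plus with Rplus; change mult with Rmult. simpl.
      apply (Rmult_eq_reg_r (sqrt (1 + x))); [|lra].
      replace ((PSeries (PS_derive a) x * sqrt (1 + x) + PSeries a x * (1 * / (2 * sqrt (1 + x)))) * sqrt (1 + x))
        with (PSeries (PS_derive a) x * (sqrt (1 + x) * sqrt (1 + x)) + PSeries a x / 2) by (field; lra).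
      rewrite sqrt_sqrt by lra.
      specialize (Hode x Hx). lra. }
  assert (H0 : PSeries a y * sqrt (1 + y) = PSeries a 0 * sqrt (1 + 0)).
  { apply Rabs_def2 in Hy.
    destruct (Rtotal_order y 0) as [L | [-> | G]]; [|reflexivity|].
    - apply (eq_is_derive (fun x => PSeries a x * sqrt (1 + x))); [|exact L].
      intros t Ht. apply Hd, Rabs_def1; lra.
    - symmetry. apply (eq_is_derive (fun x => PSeries a x * sqrt (1 + x))); [|exact G].
      intros t Ht. apply Hd, Rabs_def1; lra. }
  rewrite PSeries_0 in H0. rewrite Rplus_0_r, sqrt_1 in H0.
  change (a 0%nat) with 1 in H0.
  assert (Hx1 : 0 < 1 + y) by (apply Rabs_def2 in Hy; lra).
  assert (Hs := sqrt_lt_R0 _ Hx1).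
  apply (Rmult_eq_reg_r (sqrt (1 + y))); [|lra]. rewrite H0. field. lra.
Qed.

(** Raising [j] by one multiplies the sum by [1 + y], which on coefficients is Pascal's rule. *)
Lemma is_series_gbin_half (j : nat) (y : R) :
  Rabs y < 1 -> is_series (fun h => gbin (INR j - / 2) h * y ^ h) ((1 + y) ^ j / sqrt (1 + y)).
Proof.
  intros Hy.
  assert (Hx1 : 0 < 1 + y) by (apply Rabs_def2 in Hy; lra).
  assert (Hs := sqrt_lt_R0 _ Hx1).
  induction j as [|j IH].
  - replace (INR 0 - / 2) with (- / 2) by (simpl; ring).
    replace ((1 + y) ^ 0 / sqrt (1 + y)) with (Series (fun h => gbin (- / 2) h * y ^ h)).
    + apply Series_correct, ex_series_Rabs.
      apply (geom_bound_ex_series _ 1); [apply gbin_mhalf_bound | exact Hy].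
    + change (PSeries (gbin (- / 2)) y = (1 + y) ^ 0 / sqrt (1 + y)).
      rewrite (PSeries_gbin_mhalf y Hy). simpl. field. lra.
  - replace (INR (S j) - / 2) with (INR j - / 2 + 1) by (rewrite S_INR; ring).
    set (t := INR j - / 2) in *. set (L := (1 + y) ^ j / sqrt (1 + y)) in *.
    replace ((1 + y) ^ S j / sqrt (1 + y)) with (L + y * L)
      by (unfold L; simpl; field; lra).
    apply (is_series_decr_1 (fun h => gbin (t + 1) h * y ^ h)).
    apply (is_series_ext (fun h => plus (gbin t (S h) * y ^ S h) (scal y (gbin t h * y ^ h)))).
    { intros h. rewrite gbin_pascal. change plus with Rplus; change scal with Rmult. simpl. ring. }
    match goal with |- is_series _ ?l => replace l with (plus (L - 1) (scal y L)) end.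
    2:{ change (L - 1 + y * L = L + y * L + - (1 * 1)). ring. }
    apply (@is_series_plus R_AbsRing R_NormedModule (fun h => gbin t (S h) * y ^ S h)
      (fun h => scal y (gbin t h * y ^ h)) (L - 1) (scal y L)).
    + apply (is_series_incr_1 (fun h => gbin t h * y ^ h)).
      match goal with |- is_series _ ?l => replace l with L end; [exact IH|].
      change (L = L - 1 + 1 * 1). ring.
    + apply (@is_series_scal R_AbsRing R_NormedModule y _ _ IH).
Qed.

(** The power series [g(z) / (a + b z)], given by its coefficients. *)
Fixpoint divlin (a b : R) (g : nat -> R) (i : nat) : R :=
  match i with
  | O => g O / a
  | S i' => (g (S i') - b * divlin a b g i') / a
  end.

Lemma divlin_S (a b : R) (g : nat -> R) (i : nat) :
  a <> 0 -> a * divlin a b g (S i) + b * divlin a b g i = g (S i).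
Proof. intros Ha; simpl; field; exact Ha. Qed.

Lemma divlin_0 (a b : R) (g : nat -> R) : a <> 0 -> a * divlin a b g 0 = g O.
Proof. intros Ha; simpl; field; exact Ha. Qed.

Lemma divlin_unique (a b : R) (u v : nat -> R) : a <> 0 ->
  u O = v O / a -> (forall i, a * u (S i) + b * u i = v (S i)) -> u = divlin a b v.
Proof.
  intros Ha H0 HS. apply functional_extensionality. intros i.
  induction i as [|i IH]; [exact H0|].
  simpl. rewrite <- IH, <- HS. field; exact Ha.
Qed.

Lemma divlin_comm (a b c d : R) (g : nat -> R) : a <> 0 -> c <> 0 ->
  divlin a b (divlin c d g) = divlin c d (divlin a b g).
Proof.
  intros Ha Hc. symmetry.
  set (Q := divlin c d (divlin a b g)).
  assert (Q0 : c * Q O = divlin a b g O) by (apply divlin_0; exact Hc).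
  assert (QS : forall i, c * Q (S i) + d * Q i = divlin a b g (S i))
    by (intros i; apply divlin_S; exact Hc).
  clearbody Q.
  (* [w] is the product [(a + b z) Q], which satisfies the recursion of [g / (c + d z)]. *)
  set (w := fun i => match i with O => a * Q O | S i' => a * Q (S i') + b * Q i' end).
  assert (Hw : w = divlin c d g).
  { apply divlin_unique; [exact Hc| |].
    - unfold w. apply (Rmult_eq_reg_l c); [|exact Hc].
      replace (c * (a * Q O)) with (a * (c * Q O)) by ring.
      rewrite Q0, divlin_0 by exact Ha. field; exact Hc.
    - intros [|i]; unfold w.
      + replace (c * (a * Q 1%nat + b * Q O) + d * (a * Q O))
          with (a * (c * Q 1%nat + d * Q O) + b * (c * Q O)) by ring.
        rewrite QS, Q0. apply divlin_S; exact Ha.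
      + replace (c * (a * Q (S (S i)) + b * Q (S i)) + d * (a * Q (S i) + b * Q i))
          with (a * (c * Q (S (S i)) + d * Q (S i)) + b * (c * Q (S i) + d * Q i)) by ring.
        rewrite !QS. apply divlin_S; exact Ha. }
  apply divlin_unique; [exact Ha| |].
  - rewrite <- Hw. unfold w. field; exact Ha.
  - intros i. rewrite <- Hw. reflexivity.
Qed.

Lemma iter_comm (A : Type) (m : nat) (f g : A -> A) (x : A) :
  (forall y, f (g y) = g (f y)) -> Nat.iter m f (g x) = g (Nat.iter m f x).
Proof. intros H; induction m as [|m IH]; simpl; [reflexivity | rewrite IH; apply H]. Qed.

Lemma iter_iter_comm (A : Type) (m m' : nat) (f g : A -> A) (x : A) :
  (forall y, f (g y) = g (f y)) ->
  Nat.iter m f (Nat.iter m' g x) = Nat.iter m' g (Nat.iter m f x).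
Proof.
  intros H; induction m' as [|m' IH]; simpl; [reflexivity|].
  rewrite <- IH. apply iter_comm; exact H.
Qed.

Definition divlin_pow (m : nat) (a b : R) (g : nat -> R) : nat -> R := Nat.iter m (divlin a b) g.

Lemma divlin_pow_S (m : nat) (a b : R) (g : nat -> R) :
  divlin_pow (S m) a b g = divlin a b (divlin_pow m a b g).
Proof. reflexivity. Qed.

Lemma divlin_pow_comm (m m' : nat) (a b c d : R) (g : nat -> R) : a <> 0 -> c <> 0 ->
  divlin_pow m a b (divlin_pow m' c d g) = divlin_pow m' c d (divlin_pow m a b g).
Proof. intros Ha Hc. apply iter_iter_comm. intros. apply divlin_comm; assumption. Qed.

Lemma divlin_pow_comm1 (m : nat) (a b c d : R) (g : nat -> R) : a <> 0 -> c <> 0 ->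
  divlin_pow m a b (divlin c d g) = divlin c d (divlin_pow m a b g).
Proof. intros Ha Hc. apply (divlin_pow_comm m 1 a b c d g Ha Hc). Qed.

(** Induction on the sum of the entries. Only indices with a single nonzero entry are base cases,
    since the divided difference recursion reaches every other index from two indices of smaller
    sum. *)
Lemma multi_index_ind (P : nat -> nat -> nat -> Prop) :
  (forall r, P (S r) O O) -> (forall r, P O (S r) O) -> (forall r, P O O (S r)) ->
  (forall a b c, P (S a) b c -> P a (S b) c -> P (S a) (S b) c) ->
  (forall a b c, P (S a) b c -> P a b (S c) -> P (S a) b (S c)) ->
  (forall a b c, P a (S b) c -> P a b (S c) -> P a (S b) (S c)) ->
  forall a b c, (0 < a + b + c)%nat -> P a b c.
Proof.
  intros H0 H1 H2 H01 H02 H12.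
  assert (G : forall N a b c, (a + b + c = S N)%nat -> P a b c).
  { induction N as [|N IH]; intros a b c HN.
    - destruct a as [|a]; [destruct b as [|b]; [destruct c as [|c]; [lia|]|]|].
      + apply H2.
      + destruct b, c; try lia. apply H1.
      + destruct a, b, c; try lia. apply H0.
    - destruct a as [|a].
      + destruct b as [|b].
        * destruct c as [|c]; [lia|]. apply H2.
        * destruct c as [|c]; [apply H1|]. apply H12; apply IH; lia.
      + destruct b as [|b].
        * destruct c as [|c]; [apply H0|]. apply H02; apply IH; lia.
        * apply H01; apply IH; lia. }
  intros a b c Habc. apply (G (Nat.pred (a + b + c))). lia.
Qed.

(* The recursion satisfied by divided differences with nodes [y0, y1, y2] of multiplicities
   [a, b, c]. *)
Definition divdiff (y0 y1 y2 : R) (F : nat -> nat -> nat -> R) : Prop :=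
  (forall a b c, (y0 - y1) * F (S a) (S b) c = F (S a) b c - F a (S b) c) /\
  (forall a b c, (y0 - y2) * F (S a) b (S c) = F (S a) b c - F a b (S c)) /\
  (forall a b c, (y1 - y2) * F a (S b) (S c) = F a (S b) c - F a b (S c)).

Lemma divdiff_lincomb (y0 y1 y2 x0 x1 x2 : R) (F G H : nat -> nat -> nat -> R) :
  divdiff y0 y1 y2 F -> divdiff y0 y1 y2 G -> divdiff y0 y1 y2 H ->
  divdiff y0 y1 y2 (fun a b c => x0 * F a b c + x1 * G a b c + x2 * H a b c).
Proof.
  intros (F1 & F2 & F3) (G1 & G2 & G3) (H1 & H2 & H3).
  repeat split; intros a b c.
  - specialize (F1 a b c); specialize (G1 a b c); specialize (H1 a b c).
    replace ((y0 - y1) * (x0 * F (S a) (S b) c + x1 * G (S a) (S b) c + x2 * H (S a) (S b) c))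
      with (x0 * ((y0 - y1) * F (S a) (S b) c) + x1 * ((y0 - y1) * G (S a) (S b) c)
            + x2 * ((y0 - y1) * H (S a) (S b) c)) by ring.
    rewrite F1, G1, H1. ring.
  - specialize (F2 a b c); specialize (G2 a b c); specialize (H2 a b c).
    replace ((y0 - y2) * (x0 * F (S a) b (S c) + x1 * G (S a) b (S c) + x2 * H (S a) b (S c)))
      with (x0 * ((y0 - y2) * F (S a) b (S c)) + x1 * ((y0 - y2) * G (S a) b (S c))
            + x2 * ((y0 - y2) * H (S a) b (S c))) by ring.
    rewrite F2, G2, H2. ring.
  - specialize (F3 a b c); specialize (G3 a b c); specialize (H3 a b c).
    replace ((y1 - y2) * (x0 * F a (S b) (S c) + x1 * G a (S b) (S c) + x2 * H a (S b) (S c)))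
      with (x0 * ((y1 - y2) * F a (S b) (S c)) + x1 * ((y1 - y2) * G a (S b) (S c))
            + x2 * ((y1 - y2) * H a (S b) (S c))) by ring.
    rewrite F3, G3, H3. ring.
Qed.

(** The derivative of [(1 + z)^(s + 1) / ((z - y0)^a (z - y1)^b (z - y2)^c)] has no residues;
    splitting [1 + z] as [(1 + yj) + (z - yj)] in the terms of this derivative gives the
    relation. *)
Definition contiguous (s y0 y1 y2 : R) (F : nat -> nat -> nat -> R) (a b c : nat) : Prop :=
  (s + 1 - (INR a + INR b + INR c)) * F a b c =
  INR a * ((1 + y0) * F (S a) b c) + INR b * ((1 + y1) * F a (S b) c)
  + INR c * ((1 + y2) * F a b (S c)).

(* The defect of the contiguity relation satisfies the same recursion as [F], so the relation
   propagates from single nodes to all multiplicities. *)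
Lemma divdiff_contiguous (s y0 y1 y2 : R) (F : nat -> nat -> nat -> R) :
  y0 <> y1 -> y0 <> y2 -> y1 <> y2 ->
  divdiff y0 y1 y2 F ->
  (forall r, contiguous s y0 y1 y2 F (S r) O O) ->
  (forall r, contiguous s y0 y1 y2 F O (S r) O) ->
  (forall r, contiguous s y0 y1 y2 F O O (S r)) ->
  forall a b c, (0 < a + b + c)%nat -> contiguous s y0 y1 y2 F a b c.
Proof.
  intros N01 N02 N12 (D01 & D02 & D12) B0 B1 B2.
  apply multi_index_ind; try assumption; unfold contiguous; intros a b c HA HB.
  - apply (Rmult_eq_reg_l (y0 - y1)); [|lra].
    assert (E1 := D01 (S a) b c). assert (E2 := D01 a (S b) c). assert (E3 := D01 a b (S c)).
    assert (E := D01 a b c).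
    rewrite !S_INR in *.
    replace ((y0 - y1) * ((s + 1 - (INR a + 1 + (INR b + 1) + INR c)) * F (S a) (S b) c))
      with ((s + 1 - (INR a + 1 + (INR b + 1) + INR c)) * ((y0 - y1) * F (S a) (S b) c)) by ring.
    match goal with |- _ = ?r => replace r with
      ((INR a + 1) * (1 + y0) * ((y0 - y1) * F (S (S a)) (S b) c)
       + (INR b + 1) * (1 + y1) * ((y0 - y1) * F (S a) (S (S b)) c)
       + INR c * (1 + y2) * ((y0 - y1) * F (S a) (S b) (S c))) by ring end.
    rewrite E1, E2, E3, E. lra.
  - apply (Rmult_eq_reg_l (y0 - y2)); [|lra].
    assert (E1 := D02 (S a) b c). assert (E2 := D02 a (S b) c). assert (E3 := D02 a b (S c)).
    assert (E := D02 a b c).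
    rewrite !S_INR in *.
    replace ((y0 - y2) * ((s + 1 - (INR a + 1 + INR b + (INR c + 1))) * F (S a) b (S c)))
      with ((s + 1 - (INR a + 1 + INR b + (INR c + 1))) * ((y0 - y2) * F (S a) b (S c))) by ring.
    match goal with |- _ = ?r => replace r with
      ((INR a + 1) * (1 + y0) * ((y0 - y2) * F (S (S a)) b (S c))
       + INR b * (1 + y1) * ((y0 - y2) * F (S a) (S b) (S c))
       + (INR c + 1) * (1 + y2) * ((y0 - y2) * F (S a) b (S (S c)))) by ring end.
    rewrite E1, E2, E3, E. lra.
  - apply (Rmult_eq_reg_l (y1 - y2)); [|lra].
    assert (E1 := D12 (S a) b c). assert (E2 := D12 a (S b) c). assert (E3 := D12 a b (S c)).
    assert (E := D12 a b c).
    rewrite !S_INR in *.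
    replace ((y1 - y2) * ((s + 1 - (INR a + (INR b + 1) + (INR c + 1))) * F a (S b) (S c)))
      with ((s + 1 - (INR a + (INR b + 1) + (INR c + 1))) * ((y1 - y2) * F a (S b) (S c))) by ring.
    match goal with |- _ = ?r => replace r with
      (INR a * (1 + y0) * ((y1 - y2) * F (S a) (S b) (S c))
       + (INR b + 1) * (1 + y1) * ((y1 - y2) * F a (S (S b)) (S c))
       + (INR c + 1) * (1 + y2) * ((y1 - y2) * F a (S b) (S (S c)))) by ring end.
    rewrite E1, E2, E3, E. lra.
Qed.

(* A functional satisfying both relations that vanishes on the three neighbours of [(a, b, c)]
   also vanishes on the three neighbours of a smaller multi-index. *)
Lemma divdiff_kernel_descent (s y0 y1 y2 : R) (F : nat -> nat -> nat -> R) :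
  divdiff y0 y1 y2 F ->
  (forall a b c, (0 < a + b + c)%nat -> contiguous s y0 y1 y2 F a b c) ->
  (forall m : nat, s <> INR m) ->
  forall a b c, F (S a) b c = 0 -> F a (S b) c = 0 -> F a b (S c) = 0 ->
  F 1%nat O O = 0 /\ F O 1%nat O = 0 /\ F O O 1%nat = 0.
Proof.
  intros (D01 & D02 & D12) HC Hs.
  (* The factor [s + 1 - (a + b + c)] is [s - m] with [m] natural, hence can be cancelled. This is
     where the exponent must not be a natural number. *)
  assert (Hk : forall x t, (forall m : nat, s <> INR m) -> (exists m : nat, x = s - INR m) ->
    x * t = 0 -> t = 0).
  { intros x t Hs' [m ->] H. destruct (Rmult_integral _ _ H) as [H'|]; [|assumption].
    exfalso; apply (Hs' m); lra. }
  induction a as [|a IHa].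
  - induction b as [|b IHb].
    + induction c as [|c IHc]; [auto|].
      intros H0 H1 H2. apply IHc.
      * specialize (D02 O O c). rewrite H0 in D02.
        assert (F O O (S c) = 0); [|lra].
        apply (Hk (s + 1 - (INR 0 + INR 0 + INR (S c)))); [exact Hs| |].
        -- exists c. rewrite S_INR. simpl. ring.
        -- rewrite (HC O O (S c)) by lia. rewrite H0, H1, H2. ring.
      * specialize (D12 O O c). rewrite H1 in D12.
        assert (F O O (S c) = 0); [|lra].
        apply (Hk (s + 1 - (INR 0 + INR 0 + INR (S c)))); [exact Hs| |].
        -- exists c. rewrite S_INR. simpl. ring.
        -- rewrite (HC O O (S c)) by lia. rewrite H0, H1, H2. ring.
      * apply (Hk (s + 1 - (INR 0 + INR 0 + INR (S c)))); [exact Hs| |].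
        -- exists c. rewrite S_INR. simpl. ring.
        -- rewrite (HC O O (S c)) by lia. rewrite H0, H1, H2. ring.
    + intros c H0 H1 H2.
      assert (HF : F O (S b) c = 0).
      { apply (Hk (s + 1 - (INR 0 + INR (S b) + INR c))); [exact Hs| |].
        - exists (b + c)%nat. rewrite plus_INR, S_INR. simpl. ring.
        - rewrite (HC O (S b) c) by lia. rewrite H0, H1, H2. ring. }
      apply (IHb c); [| exact HF |].
      * specialize (D01 O b c). rewrite H0, HF in D01. lra.
      * specialize (D12 O b c). rewrite H2, HF in D12. lra.
  - intros b c H0 H1 H2.
    assert (HF : F (S a) b c = 0).
    { apply (Hk (s + 1 - (INR (S a) + INR b + INR c))); [exact Hs| |].
      - exists (a + b + c)%nat. rewrite !plus_INR, S_INR. ring.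
      - rewrite (HC (S a) b c) by lia. rewrite H0, H1, H2. ring. }
    apply (IHa b c); [exact HF | |].
    * specialize (D01 a b c). rewrite H1, HF in D01. lra.
    * specialize (D02 a b c). rewrite H2, HF in D02. lra.
Qed.

(** * Divided differences of monomials *)

Definition delta0 (i : nat) : R := match i with O => 1 | S _ => 0 end.

(** Coefficients of [1 / ((1 - y0 z)^a (1 - y1 z)^b (1 - y2 z)^c)]. Entry [i] is the complete
    homogeneous symmetric polynomial of degree [i] in the nodes with multiplicity, that is, the
    divided difference of [z^(a + b + c - 1 + i)]. *)
Definition hsym (y0 y1 y2 : R) (a b c : nat) : nat -> R :=
  divlin_pow a 1 (- y0) (divlin_pow b 1 (- y1) (divlin_pow c 1 (- y2) delta0)).

Lemma divlin_pair_sub (y z : R) (g : nat -> R) (i : nat) :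
  divlin 1 (- y) g (S i) - divlin 1 (- z) g (S i)
  = (y - z) * divlin 1 (- y) (divlin 1 (- z) g) i.
Proof.
  assert (E1 := divlin_S 1 (- y) (divlin 1 (- z) g) i R1_neq_R0).
  assert (E2 := divlin_S 1 (- z) (divlin 1 (- y) g) i R1_neq_R0).
  rewrite <- (divlin_comm 1 (- y) 1 (- z)) in E2 by apply R1_neq_R0.
  lra.
Qed.

Lemma hsym_0 (y0 y1 y2 : R) (a b c : nat) : hsym y0 y1 y2 a b c 0 = 1.
Proof.
  assert (H : forall m y g, g O = 1 -> divlin_pow m 1 (- y) g O = 1).
  { intros m y g Hg; induction m as [|m IH]; [exact Hg|].
    rewrite divlin_pow_S. simpl. rewrite IH. field. }
  unfold hsym. now do 3 apply H.
Qed.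

Lemma hsym_step0 y0 y1 y2 a b c :
  hsym y0 y1 y2 (S a) b c = divlin 1 (- y0) (hsym y0 y1 y2 a b c).
Proof. reflexivity. Qed.

Lemma hsym_step1 y0 y1 y2 a b c :
  hsym y0 y1 y2 a (S b) c = divlin 1 (- y1) (hsym y0 y1 y2 a b c).
Proof. unfold hsym. rewrite divlin_pow_S. apply divlin_pow_comm1; apply R1_neq_R0. Qed.

Lemma hsym_step2 y0 y1 y2 a b c :
  hsym y0 y1 y2 a b (S c) = divlin 1 (- y2) (hsym y0 y1 y2 a b c).
Proof.
  unfold hsym. rewrite divlin_pow_S, !divlin_pow_comm1 by apply R1_neq_R0. reflexivity.
Qed.

Lemma hsym_divdiff (y0 y1 y2 : R) (i : nat) :
  (forall a b c, (y0 - y1) * hsym y0 y1 y2 (S a) (S b) c i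
     = hsym y0 y1 y2 (S a) b c (S i) - hsym y0 y1 y2 a (S b) c (S i)) /\
  (forall a b c, (y0 - y2) * hsym y0 y1 y2 (S a) b (S c) i
     = hsym y0 y1 y2 (S a) b c (S i) - hsym y0 y1 y2 a b (S c) (S i)) /\
  (forall a b c, (y1 - y2) * hsym y0 y1 y2 a (S b) (S c) i
     = hsym y0 y1 y2 a (S b) c (S i) - hsym y0 y1 y2 a b (S c) (S i)).
Proof.
  repeat split; intros a b c.
  - rewrite !hsym_step0, !hsym_step1. symmetry; apply divlin_pair_sub.
  - rewrite !hsym_step0, !hsym_step2. symmetry; apply divlin_pair_sub.
  - rewrite !hsym_step1, !hsym_step2. symmetry; apply divlin_pair_sub.
Qed.

(** A node of size at most 1/4 is half of the ratio 1/2 of the majorant, so the geometric series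
    that arises sums to at most 2. *)
Lemma divlin_bound (y K : R) (g : nat -> R) : Rabs y <= / 4 ->
  (forall i, Rabs (g i) <= K * (/ 2) ^ i) -> forall i, Rabs (divlin 1 (- y) g i) <= 2 * K * (/ 2) ^ i.
Proof.
  intros Hy Hg i.
  assert (HK : 0 <= K).
  { specialize (Hg O). simpl in Hg. assert (A := Rabs_pos (g O)). lra. }
  induction i as [|i IH].
  - simpl. replace (g O / 1) with (g O) by field. specialize (Hg O). simpl in Hg. lra.
  - simpl. replace ((g (S i) - - y * divlin 1 (- y) g i) / 1) with (g (S i) + y * divlin 1 (- y) g i) by field.
    eapply Rle_trans; [apply Rabs_triang|]. rewrite Rabs_mult.
    specialize (Hg (S i)). simpl in Hg.
    assert (Rabs y * Rabs (divlin 1 (- y) g i) <= / 4 * (2 * K * (/ 2) ^ i)).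
    { apply Rmult_le_compat; try apply Rabs_pos; assumption. }
    lra.
Qed.

Lemma hsym_bound (y0 y1 y2 : R) (a b c i : nat) :
  Rabs y0 <= / 4 -> Rabs y1 <= / 4 -> Rabs y2 <= / 4 ->
  Rabs (hsym y0 y1 y2 a b c i) <= 2 ^ (a + b + c) * (/ 2) ^ i.
Proof.
  intros H0 H1 H2.
  assert (H : forall m y g K, Rabs y <= / 4 -> (forall i, Rabs (g i) <= K * (/ 2) ^ i) ->
     forall i, Rabs (divlin_pow m 1 (- y) g i) <= 2 ^ m * K * (/ 2) ^ i).
  { intros m y g K Hy Hg; induction m as [|m IH]; intros j.
    - simpl. rewrite Rmult_1_l. apply Hg.
    - rewrite divlin_pow_S. replace (2 ^ S m * K) with (2 * (2 ^ m * K)) by (simpl; ring).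
      apply divlin_bound; assumption. }
  unfold hsym. replace (2 ^ (a + b + c)) with (2 ^ a * (2 ^ b * (2 ^ c * 1))) by (rewrite !pow_add; ring).
  revert i. apply H; [exact H0|]. apply H; [exact H1|]. apply H; [exact H2|].
  intros [|i]; simpl.
  - rewrite Rabs_R1; lra.
  - rewrite Rabs_R0. assert (0 < (/ 2) ^ i) by (apply pow_lt; lra). lra.
Qed.

Lemma hsym_single (y : R) (r i : nat) :
  divlin_pow (S r) 1 (- y) delta0 i = multichoose r i * y ^ i.
Proof.
  revert i; induction r as [|r IHr]; intros i.
  - rewrite multichoose_0l. induction i as [|i IH]; [simpl; field|].
    change (divlin_pow 1 1 (- y) delta0 (S i))
      with ((delta0 (S i) - - y * divlin_pow 1 1 (- y) delta0 i) / 1).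
    rewrite IH. simpl. field.
  - induction i as [|i IH].
    + change (divlin_pow (S r) 1 (- y) delta0 O / 1 = multichoose (S r) 0 * y ^ 0).
      rewrite IHr, !multichoose_0r. simpl. field.
    + change ((divlin_pow (S r) 1 (- y) delta0 (S i)
               - - y * divlin_pow (S (S r)) 1 (- y) delta0 i) / 1 = multichoose (S r) (S i) * y ^ S i).
      rewrite IH, IHr, multichoose_pascal. simpl. field.
Qed.

(** The Taylor coefficient of order [h] of [(1 + z)^(k + 1/2)] at [y] without its factor
    [sqrt (1 + y)], hence rational for rational [y]. The power is written as a quotient because [h]
    may exceed [k]. *)
Definition taylor_half (k : nat) (y : R) (h : nat) : R :=
  gbin (INR (S k) - / 2) h * ((1 + y) ^ k / (1 + y) ^ h).

(* [sqrt (1 + yj) * residue_coef k mj ml ml' yj yl yl'] is the residue at [z = yj] of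
   [(1 + z)^(k + 1/2) / ((z - yj)^mj (z - yl)^ml (z - yl')^ml')]. *)
Definition residue_coef (k mj ml ml' : nat) (yj yl yl' : R) : R :=
  match mj with
  | O => 0
  | S r => divlin_pow ml (yj - yl) 1 (divlin_pow ml' (yj - yl') 1 (taylor_half k yj)) r
  end.

Lemma residue_coef_swap k mj ml ml' yj yl yl' : yj <> yl -> yj <> yl' ->
  residue_coef k mj ml ml' yj yl yl' = residue_coef k mj ml' ml yj yl' yl.
Proof.
  intros H1 H2. destruct mj as [|r]; [reflexivity|]. unfold residue_coef.
  rewrite divlin_pow_comm by lra. reflexivity.
Qed.

(** Partial fractions: [(yj - yl) / ((z - yj) (z - yl)) = 1 / (z - yj) - 1 / (z - yl)]. For [mj = 0]
    the last term has no pole at [yj], which is why [residue_coef] is 0 there. *)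
Lemma residue_coef_near k mj ml ml' yj yl yl' : yj <> yl -> yj <> yl' ->
  (yj - yl) * residue_coef k (S mj) (S ml) ml' yj yl yl'
  = residue_coef k (S mj) ml ml' yj yl yl' - residue_coef k mj (S ml) ml' yj yl yl'.
Proof.
  intros H1 H2. unfold residue_coef. rewrite divlin_pow_S.
  set (X := divlin_pow ml (yj - yl) 1 (divlin_pow ml' (yj - yl') 1 (taylor_half k yj))).
  destruct mj as [|r].
  - rewrite divlin_0 by lra. ring.
  - rewrite <- (divlin_S (yj - yl) 1 X r) by lra. ring.
Qed.

Lemma residue_coef_far k mj ml ml' yj yl yl' : yj <> yl -> yj <> yl' ->
  (yl - yl') * residue_coef k mj (S ml) (S ml') yj yl yl'
  = residue_coef k mj (S ml) ml' yj yl yl' - residue_coef k mj ml (S ml') yj yl yl'.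
Proof.
  intros H1 H2. destruct mj as [|r]; [simpl; ring|]. unfold residue_coef.
  rewrite !divlin_pow_S, !divlin_pow_comm1 by lra.
  set (Y := divlin_pow ml (yj - yl) 1 (divlin_pow ml' (yj - yl') 1 (taylor_half k yj))).
  set (A := divlin (yj - yl) 1 Y).
  assert (E : divlin (yj - yl) 1 (divlin (yj - yl') 1 Y) = divlin (yj - yl') 1 A)
    by (apply divlin_comm; lra).
  destruct r as [|r].
  - assert (F1 := divlin_0 (yj - yl') 1 A ltac:(lra)).
    assert (F2 := divlin_0 (yj - yl) 1 (divlin (yj - yl') 1 Y) ltac:(lra)).
    rewrite E in *. lra.
  - assert (F1 := divlin_S (yj - yl') 1 A r ltac:(lra)).
    assert (F2 := divlin_S (yj - yl) 1 (divlin (yj - yl') 1 Y) r ltac:(lra)).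
    rewrite E in *. lra.
Qed.

Definition coef0 k y0 y1 y2 a b c := residue_coef k a b c y0 y1 y2.
Definition coef1 k y0 y1 y2 a b c := residue_coef k b a c y1 y0 y2.
Definition coef2 k y0 y1 y2 a b c := residue_coef k c a b y2 y0 y1.

Lemma coef_divdiff k y0 y1 y2 : y0 <> y1 -> y0 <> y2 -> y1 <> y2 ->
  divdiff y0 y1 y2 (coef0 k y0 y1 y2) /\ divdiff y0 y1 y2 (coef1 k y0 y1 y2) /\
  divdiff y0 y1 y2 (coef2 k y0 y1 y2).
Proof.
  intros N01 N02 N12. unfold divdiff, coef0, coef1, coef2.
  repeat split; intros a b c.
  - apply residue_coef_near; auto.
  - rewrite !(residue_coef_swap k _ b _ y0 y1 y2) by auto. apply residue_coef_near; auto.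
  - apply residue_coef_far; auto.
  - assert (E := residue_coef_near k b a c y1 y0 y2 ltac:(auto) ltac:(auto)). lra.
  - apply residue_coef_far; auto.
  - rewrite !(residue_coef_swap k _ a _ y1 y0 y2) by auto. apply residue_coef_near; auto.
  - apply residue_coef_far; auto.
  - assert (E := residue_coef_near k c a b y2 y0 y1 ltac:(auto) ltac:(auto)). lra.
  - rewrite !(residue_coef_swap k _ a _ y2 y0 y1) by auto.
    assert (E := residue_coef_near k c b a y2 y1 y0 ltac:(auto) ltac:(auto)). lra.
Qed.

Lemma taylor_half_S (k r : nat) (y : R) : 1 + y <> 0 ->
  (INR (S k) - / 2 + 1 - INR (S r)) * taylor_half k y r
  = INR (S r) * ((1 + y) * taylor_half k y (S r)).
Proof.
  intros Hy. unfold taylor_half. rewrite gbin_S.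
  assert (H := INR_S_neq0 r). assert (H2 := pow_nonzero _ r Hy).
  set (s := INR (S k) - / 2). simpl pow. rewrite S_INR in *. field. auto.
Qed.

(** The square roots in the sum of residues are replaced by free variables: the form is small at the
    true roots and must be shown nonzero at an integer point. *)
Definition coef_form k y0 y1 y2 x0 x1 x2 a b c : R :=
  x0 * coef0 k y0 y1 y2 a b c + x1 * coef1 k y0 y1 y2 a b c + x2 * coef2 k y0 y1 y2 a b c.

Lemma coef_form_contiguous k y0 y1 y2 x0 x1 x2 : y0 <> y1 -> y0 <> y2 -> y1 <> y2 ->
  1 + y0 <> 0 -> 1 + y1 <> 0 -> 1 + y2 <> 0 ->
  forall a b c, (0 < a + b + c)%nat ->
  contiguous (INR (S k) - / 2) y0 y1 y2 (coef_form k y0 y1 y2 x0 x1 x2) a b c.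
Proof.
  intros N01 N02 N12 P0 P1 P2.
  destruct (coef_divdiff k y0 y1 y2 N01 N02 N12) as (D0 & D1 & D2).
  apply divdiff_contiguous; try assumption.
  - apply divdiff_lincomb; assumption.
  - intros r. assert (E := taylor_half_S k r y0 P0). unfold contiguous, coef_form, coef0, coef1, coef2.
    change (residue_coef k (S r) 0 0 y0 y1 y2) with (taylor_half k y0 r).
    change (residue_coef k (S (S r)) 0 0 y0 y1 y2) with (taylor_half k y0 (S r)).
    simpl residue_coef. change (INR 0) with 0. set (s := INR (S k) - / 2) in *. clearbody s.
    apply (f_equal (fun t => x0 * t)) in E. lra.
  - intros r. assert (E := taylor_half_S k r y1 P1). unfold contiguous, coef_form, coef0, coef1, coef2.
    change (residue_coef k (S r) 0 0 y1 y0 y2) with (taylor_half k y1 r).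
    change (residue_coef k (S (S r)) 0 0 y1 y0 y2) with (taylor_half k y1 (S r)).
    simpl residue_coef. change (INR 0) with 0. set (s := INR (S k) - / 2) in *. clearbody s.
    apply (f_equal (fun t => x1 * t)) in E. lra.
  - intros r. assert (E := taylor_half_S k r y2 P2). unfold contiguous, coef_form, coef0, coef1, coef2.
    change (residue_coef k (S r) 0 0 y2 y0 y1) with (taylor_half k y2 r).
    change (residue_coef k (S (S r)) 0 0 y2 y0 y1) with (taylor_half k y2 (S r)).
    simpl residue_coef. change (INR 0) with 0. set (s := INR (S k) - / 2) in *. clearbody s.
    apply (f_equal (fun t => x2 * t)) in E. lra.
Qed.

(** If all three values vanished, the vanishing would descend to the index [(1, 0, 0)], where the
    form is [x0 (1 + y0)^k]. *)
Lemma coef_form_nonzero k y0 y1 y2 x0 x1 x2 : y0 <> y1 -> y0 <> y2 -> y1 <> y2 ->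
  1 + y0 <> 0 -> 1 + y1 <> 0 -> 1 + y2 <> 0 -> x0 <> 0 ->
  forall a b c,
  coef_form k y0 y1 y2 x0 x1 x2 (S a) b c <> 0 \/ coef_form k y0 y1 y2 x0 x1 x2 a (S b) c <> 0 \/
  coef_form k y0 y1 y2 x0 x1 x2 a b (S c) <> 0.
Proof.
  intros N01 N02 N12 P0 P1 P2 Hx a b c.
  destruct (coef_divdiff k y0 y1 y2 N01 N02 N12) as (D0 & D1 & D2).
  set (F := coef_form k y0 y1 y2 x0 x1 x2).
  destruct (Req_dec (F (S a) b c) 0) as [E0|]; [|auto].
  destruct (Req_dec (F a (S b) c) 0) as [E1|]; [|auto].
  destruct (Req_dec (F a b (S c)) 0) as [E2|]; [|auto].
  exfalso.
  destruct (divdiff_kernel_descent (INR (S k) - / 2) y0 y1 y2 F) with (a := a) (b := b) (c := c)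
    as (E & _ & _); try assumption.
  - apply divdiff_lincomb; assumption.
  - apply coef_form_contiguous; assumption.
  - intros m Hm.
    (* [k + 1/2 = m] contradicts parity after doubling. *)
    assert (H : INR (2 * S k) = INR (2 * m + 1)) by (rewrite plus_INR, !mult_INR; simpl (INR 2); simpl (INR 1); lra).
    apply INR_eq in H. lia.
  - unfold F, coef_form, coef0, coef1, coef2 in E.
    change (residue_coef k 1 0 0 y0 y1 y2) with (taylor_half k y0 0) in E.
    simpl in E. unfold taylor_half in E. simpl in E.
    assert (H := pow_nonzero _ k P0).
    assert (x0 * (1 + y0) ^ k = 0) by lra.
    destruct (Rmult_integral _ _ H0); auto.
Qed.

(** * The sum of the residues as a series in the nodes *)

Lemma is_series_divided_step (g h h' h'' : nat -> R) (r : nat) (d V V' V'' : R) :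
  d <> 0 -> h O = h' O -> (forall i, d * h'' i = h (S i) - h' (S i)) -> d * V'' = V - V' ->
  is_series (fun i => g (r + i)%nat * h i) V -> is_series (fun i => g (r + i)%nat * h' i) V' ->
  is_series (fun i => g (S r + i)%nat * h'' i) V''.
Proof.
  intros Hd H0 HS HV A B.
  assert (C := is_series_minus _ _ _ _ A B).
  apply (is_series_ext _ (fun i => g (r + i)%nat * (h i - h' i))) in C.
  2:{ intros i. unfold plus, opp; simpl. ring. }
  assert (C' : is_series (fun i => g (r + S i)%nat * (h (S i) - h' (S i))) (V - V')).
  { apply (is_series_incr_1 (fun i => g (r + i)%nat * (h i - h' i))).
    match goal with |- is_series _ ?l => replace l with (plus V (opp V')); [exact C|] end.
    change (V + - V' = V - V' + g (r + 0)%nat * (h O - h' O)). rewrite H0. ring. }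
  apply (is_series_scal (/ d)) in C'.
  replace V'' with (scal (/ d) (V - V')).
  2:{ change (/ d * (V - V') = V''). rewrite <- HV. field; exact Hd. }
  revert C'. apply is_series_ext. intros i.
  change (/ d * (g (r + S i)%nat * (h (S i) - h' (S i))) = g (S r + i)%nat * h'' i).
  rewrite <- HS. replace (r + S i)%nat with (S r + i)%nat by lia. field; exact Hd.
Qed.

Lemma taylor_half_series (k r : nat) (y : R) : Rabs y < 1 -> (r <= k)%nat ->
  is_series (fun i => gbin (INR (S k) - / 2) (r + i) * divlin_pow (S r) 1 (- y) delta0 i)
    (taylor_half k y r * sqrt (1 + y)).
Proof.
  intros Hy Hr.
  assert (Hx1 : 0 < 1 + y) by (apply Rabs_def2 in Hy; lra).
  assert (Hs := sqrt_lt_R0 _ Hx1).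
  assert (H := is_series_gbin_half (S k - r) y Hy).
  apply (is_series_scal (gbin (INR (S k) - / 2) r)) in H.
  match type of H with is_series _ ?l => replace l with (taylor_half k y r * sqrt (1 + y)) in H end.
  - revert H. apply is_series_ext. intros i. rewrite hsym_single.
    change (gbin (INR (S k) - / 2) r * (gbin (INR (S k - r) - / 2) i * y ^ i)
            = gbin (INR (S k) - / 2) (r + i) * (multichoose r i * y ^ i)).
    rewrite <- !Rmult_assoc, gbin_split, minus_INR by lia.
    replace (INR (S k) - / 2 - INR r) with (INR (S k) - INR r - / 2) by ring. reflexivity.
  - unfold taylor_half. change (gbin (INR (S k) - / 2) r * ((1 + y) ^ k / (1 + y) ^ r) * sqrt (1 + y)
      = gbin (INR (S k) - / 2) r * ((1 + y) ^ (S k - r) / sqrt (1 + y))).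
    replace ((1 + y) ^ k) with ((1 + y) ^ r * (1 + y) ^ (k - r))
      by (rewrite <- pow_add; f_equal; lia).
    replace (S k - r)%nat with (S (k - r)) by lia. simpl pow.
    assert (H2 := pow_lt _ r Hx1).
    replace ((1 + y) * (1 + y) ^ (k - r) / sqrt (1 + y))
      with (sqrt (1 + y) * sqrt (1 + y) * (1 + y) ^ (k - r) / sqrt (1 + y))
      by (rewrite sqrt_sqrt by lra; reflexivity).
    field. lra.
Qed.

(** At the true square roots the form is the divided difference of [(1 + z)^(k + 1/2)], computed
    here term by term from the expansion at 0. Powers below [z^(a + b + c - 1)] are annihilated, so
    the series starts there. Multiplicities up to [k + 1] keep the base case within the range of
    [is_series_gbin_half]. *)
Lemma coef_form_series (k : nat) (y0 y1 y2 : R) : y0 <> y1 -> y0 <> y2 -> y1 <> y2 ->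
  Rabs y0 < 1 -> Rabs y1 < 1 -> Rabs y2 < 1 ->
  forall a b c, (0 < a + b + c)%nat -> (a <= S k)%nat -> (b <= S k)%nat -> (c <= S k)%nat ->
  is_series (fun i => gbin (INR (S k) - / 2) (a + b + c - 1 + i) * hsym y0 y1 y2 a b c i)
    (coef_form k y0 y1 y2 (sqrt (1 + y0)) (sqrt (1 + y1)) (sqrt (1 + y2)) a b c).
Proof.
  intros N01 N02 N12 H0 H1 H2.
  destruct (coef_divdiff k y0 y1 y2 N01 N02 N12) as (D0 & D1 & D2).
  destruct (divdiff_lincomb _ _ _ (sqrt (1 + y0)) (sqrt (1 + y1)) (sqrt (1 + y2)) _ _ _ D0 D1 D2)
    as (E01 & E02 & E12).
  apply (multi_index_ind (fun a b c => (a <= S k)%nat -> (b <= S k)%nat -> (c <= S k)%nat ->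
    is_series (fun i => gbin (INR (S k) - / 2) (a + b + c - 1 + i) * hsym y0 y1 y2 a b c i)
    (coef_form k y0 y1 y2 (sqrt (1 + y0)) (sqrt (1 + y1)) (sqrt (1 + y2)) a b c))).
  - intros r Hr _ _. replace (S r + 0 + 0 - 1)%nat with r by lia.
    replace (coef_form k y0 y1 y2 (sqrt (1 + y0)) (sqrt (1 + y1)) (sqrt (1 + y2)) (S r) 0 0)
      with (taylor_half k y0 r * sqrt (1 + y0)) by (unfold coef_form, coef0, coef1, coef2; simpl; ring).
    apply taylor_half_series; [exact H0 | lia].
  - intros r _ Hr _. replace (0 + S r + 0 - 1)%nat with r by lia.
    replace (coef_form k y0 y1 y2 (sqrt (1 + y0)) (sqrt (1 + y1)) (sqrt (1 + y2)) 0 (S r) 0)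
      with (taylor_half k y1 r * sqrt (1 + y1)) by (unfold coef_form, coef0, coef1, coef2; simpl; ring).
    apply taylor_half_series; [exact H1 | lia].
  - intros r _ _ Hr. replace (0 + 0 + S r - 1)%nat with r by lia.
    replace (coef_form k y0 y1 y2 (sqrt (1 + y0)) (sqrt (1 + y1)) (sqrt (1 + y2)) 0 0 (S r))
      with (taylor_half k y2 r * sqrt (1 + y2)) by (unfold coef_form, coef0, coef1, coef2; simpl; ring).
    apply taylor_half_series; [exact H2 | lia].
  - intros a b c A B Ha Hb Hc.
    specialize (A ltac:(lia) ltac:(lia) ltac:(lia)). specialize (B ltac:(lia) ltac:(lia) ltac:(lia)).
    replace (S a + S b + c - 1)%nat with (S (a + b + c)) by lia.
    replace (S a + b + c - 1)%nat with (a + b + c)%nat in A by lia.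
    replace (a + S b + c - 1)%nat with (a + b + c)%nat in B by lia.

    eapply (is_series_divided_step _ _ _ _ _ (y0 - y1)); [lra | | | | exact A | exact B].
    + now rewrite !hsym_0.
    + intros i. apply hsym_divdiff.
    + apply E01.
  - intros a b c A B Ha Hb Hc.
    specialize (A ltac:(lia) ltac:(lia) ltac:(lia)). specialize (B ltac:(lia) ltac:(lia) ltac:(lia)).
    replace (S a + b + S c - 1)%nat with (S (a + b + c)) by lia.
    replace (S a + b + c - 1)%nat with (a + b + c)%nat in A by lia.
    replace (a + b + S c - 1)%nat with (a + b + c)%nat in B by lia.
    eapply (is_series_divided_step _ _ _ _ _ (y0 - y2)); [lra | | | | exact A | exact B].
    + now rewrite !hsym_0.
    + intros i. apply hsym_divdiff.
    + apply E02.
  - intros a b c A B Ha Hb Hc.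
    specialize (A ltac:(lia) ltac:(lia) ltac:(lia)). specialize (B ltac:(lia) ltac:(lia) ltac:(lia)).
    replace (a + S b + S c - 1)%nat with (S (a + b + c)) by lia.
    replace (a + S b + c - 1)%nat with (a + b + c)%nat in A by lia.
    replace (a + b + S c - 1)%nat with (a + b + c)%nat in B by lia.
    eapply (is_series_divided_step _ _ _ _ _ (y1 - y2)); [lra | | | | exact A | exact B].
    + now rewrite !hsym_0.
    + intros i. apply hsym_divdiff.
    + apply E12.
Qed.

(** * Simultaneous approximation to two square roots *)

Lemma is_series_geom_bound (a : nat -> R) (l K : R) :
  is_series a l -> (forall i, Rabs (a i) <= K * (/ 2) ^ i) -> Rabs l <= 2 * K.
Proof.
  intros Ha HK.
  assert (Hg : is_series (fun i => K * (/ 2) ^ i) (K * / (1 - / 2))).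
  { apply (is_series_scal K (fun i => (/ 2) ^ i) (/ (1 - / 2))), is_series_geom.
    rewrite Rabs_right; lra. }
  replace (2 * K) with (K * / (1 - / 2)) by field.
  rewrite <- (is_series_unique _ _ Ha), <- (is_series_unique _ _ Hg).
  assert (Hex : ex_series (fun i => Rabs (a i))).
  { apply (@ex_series_le R_AbsRing R_CompleteNormedModule _ (fun i => K * (/ 2) ^ i)).
    - intros n. change (Rabs (Rabs (a n)) <= K * (/ 2) ^ n). rewrite Rabs_Rabsolu. apply HK.
    - now exists (K * / (1 - / 2)). }
  eapply Rle_trans; [apply Series_Rabs, Hex|].
  apply Series_le.
  - intros n. split; [apply Rabs_pos | apply HK].
  - now exists (K * / (1 - / 2)).
Qed.

(** Only exponential in [k], independently of the distances of the nodes: the differences of nodes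
    in the denominators of the single residues cancel in the sum. *)
Lemma coef_form_sqrt_bound (k : nat) (y0 y1 y2 : R) : y0 <> y1 -> y0 <> y2 -> y1 <> y2 ->
  Rabs y0 <= / 4 -> Rabs y1 <= / 4 -> Rabs y2 <= / 4 ->
  forall a b c, (0 < a + b + c)%nat -> (a <= S k)%nat -> (b <= S k)%nat -> (c <= S k)%nat ->
  Rabs (coef_form k y0 y1 y2 (sqrt (1 + y0)) (sqrt (1 + y1)) (sqrt (1 + y2)) a b c)
  <= 2 * (2 ^ S k * 2 ^ (a + b + c)).
Proof.
  intros N01 N02 N12 H0 H1 H2 a b c Habc Ha Hb Hc.
  refine (is_series_geom_bound _ _ _ (coef_form_series k y0 y1 y2 N01 N02 N12 _ _ _ a b c Habc Ha Hb Hc) _);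
    try lra.
  intros i. rewrite Rabs_mult, Rmult_assoc.
  apply Rmult_le_compat; try apply Rabs_pos.
  - apply gbin_half_bound.
  - apply hsym_bound; assumption.
Qed.

(** For nodes [al_i / N], dividing by a difference of nodes is multiplying by [N e_ij / D]. Each
    order of the divided difference therefore costs a factor [D / N] for integrality and a factor
    [2 g] in size; the order is [a + b + c - 1]. *)
Definition scaled_integral (k : nat) (N D g : Z) (K : R) (F : nat -> nat -> nat -> R) (a b c : nat) : Prop :=
  exists z : Z,
    4 ^ k * IZR D ^ (a + b + c - 1) * IZR N ^ k * F a b c = IZR z * IZR N ^ (a + b + c - 1) /\
    Rabs (IZR z) <= K * (2 * IZR g) ^ (a + b + c - 1).

Lemma scaled_integral_step (N D d e g : Z) (K V V' V'' C : R) (r : nat) (z z' : Z) :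
  (0 < N)%Z -> d <> 0%Z -> D = (e * d)%Z -> (Z.abs e <= g)%Z ->
  IZR d / IZR N * V'' = V - V' ->
  C * IZR D ^ r * V = IZR z * IZR N ^ r -> Rabs (IZR z) <= K * (2 * IZR g) ^ r ->
  C * IZR D ^ r * V' = IZR z' * IZR N ^ r -> Rabs (IZR z') <= K * (2 * IZR g) ^ r ->
  C * IZR D ^ S r * V'' = IZR (e * (z - z')) * IZR N ^ S r /\
  Rabs (IZR (e * (z - z'))) <= K * (2 * IZR g) ^ S r.
Proof.
  intros HN Hd HD He HV A A' B B'.
  assert (HN' : 0 < IZR N) by (apply IZR_lt; exact HN).
  assert (Hd' : IZR d <> 0) by (apply not_0_IZR; exact Hd).
  split.
  - rewrite mult_IZR, minus_IZR.
    assert (E : V'' = (V - V') * IZR N / IZR d) by (rewrite <- HV; field; lra).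
    replace (IZR D ^ S r) with (IZR e * IZR d * IZR D ^ r) by (rewrite <- mult_IZR, <- HD; reflexivity).
    rewrite E.
    replace (C * (IZR e * IZR d * IZR D ^ r) * ((V - V') * IZR N / IZR d))
      with (IZR e * IZR N * (C * IZR D ^ r * V - C * IZR D ^ r * V')) by (field; exact Hd').
    rewrite A, B. simpl. ring.
  - rewrite mult_IZR, minus_IZR, Rabs_mult. simpl pow.
    replace (K * (2 * IZR g * (2 * IZR g) ^ r)) with (IZR g * (2 * (K * (2 * IZR g) ^ r))) by ring.
    apply Rmult_le_compat; try apply Rabs_pos.
    + rewrite <- abs_IZR. apply IZR_le; exact He.
    + unfold Rminus. eapply Rle_trans; [apply Rabs_triang|]. rewrite Rabs_Ropp. lra.
Qed.

Lemma divdiff_scaled_integral (k : nat) (N D g al0 al1 al2 e01 e02 e12 : Z) (K : R)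
    (F : nat -> nat -> nat -> R) :
  (0 < N)%Z -> al0 <> al1 -> al0 <> al2 -> al1 <> al2 ->
  D = (e01 * (al0 - al1))%Z -> D = (e02 * (al0 - al2))%Z -> D = (e12 * (al1 - al2))%Z ->
  (Z.abs e01 <= g)%Z -> (Z.abs e02 <= g)%Z -> (Z.abs e12 <= g)%Z ->
  divdiff (IZR al0 / IZR N) (IZR al1 / IZR N) (IZR al2 / IZR N) F ->
  (forall r, (r <= k)%nat -> scaled_integral k N D g K F (S r) O O) ->
  (forall r, (r <= k)%nat -> scaled_integral k N D g K F O (S r) O) ->
  (forall r, (r <= k)%nat -> scaled_integral k N D g K F O O (S r)) ->
  forall a b c, (0 < a + b + c)%nat -> (a <= S k)%nat -> (b <= S k)%nat -> (c <= S k)%nat ->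
  scaled_integral k N D g K F a b c.
Proof.
  intros HN N01 N02 N12 D01 D02 D12 G01 G02 G12 (F01 & F02 & F12) B0 B1 B2.
  assert (HN' : 0 < IZR N) by (apply IZR_lt; exact HN).
  apply (multi_index_ind (fun a b c => (a <= S k)%nat -> (b <= S k)%nat -> (c <= S k)%nat ->
    scaled_integral k N D g K F a b c)).
  - intros r Hr _ _. apply B0; lia.
  - intros r _ Hr _. apply B1; lia.
  - intros r _ _ Hr. apply B2; lia.
  - intros a b c A B Ha Hb Hc.
    destruct (A ltac:(lia) ltac:(lia) ltac:(lia)) as (z & A1 & A2).
    destruct (B ltac:(lia) ltac:(lia) ltac:(lia)) as (z' & A3 & A4).
    exists (e01 * (z - z'))%Z.
    replace (S a + S b + c - 1)%nat with (S (a + b + c)) by lia.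
    replace (S a + b + c - 1)%nat with (a + b + c)%nat in A1, A2 by lia.
    replace (a + S b + c - 1)%nat with (a + b + c)%nat in A3, A4 by lia.
    specialize (F01 a b c).
    assert (Q := scaled_integral_step N D (al0 - al1) e01 g K (F (S a) b c) (F a (S b) c)
      (F (S a) (S b) c) (4 ^ k * IZR N ^ k) (a + b + c) z z').
    rewrite minus_IZR in Q.
    destruct Q as [Q1 Q2]; try assumption; try lia.
    + rewrite <- F01. field; lra.
    + rewrite <- A1; ring.
    + rewrite <- A3; ring.
    + split; [rewrite <- Q1; ring | exact Q2].
  - intros a b c A B Ha Hb Hc.
    destruct (A ltac:(lia) ltac:(lia) ltac:(lia)) as (z & A1 & A2).
    destruct (B ltac:(lia) ltac:(lia) ltac:(lia)) as (z' & A3 & A4).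
    exists (e02 * (z - z'))%Z.
    replace (S a + b + S c - 1)%nat with (S (a + b + c)) by lia.
    replace (S a + b + c - 1)%nat with (a + b + c)%nat in A1, A2 by lia.
    replace (a + b + S c - 1)%nat with (a + b + c)%nat in A3, A4 by lia.
    specialize (F02 a b c).
    assert (Q := scaled_integral_step N D (al0 - al2) e02 g K (F (S a) b c) (F a b (S c))
      (F (S a) b (S c)) (4 ^ k * IZR N ^ k) (a + b + c) z z').
    rewrite minus_IZR in Q.
    destruct Q as [Q1 Q2]; try assumption; try lia.
    + rewrite <- F02. field; lra.
    + rewrite <- A1; ring.
    + rewrite <- A3; ring.
    + split; [rewrite <- Q1; ring | exact Q2].
  - intros a b c A B Ha Hb Hc.
    destruct (A ltac:(lia) ltac:(lia) ltac:(lia)) as (z & A1 & A2).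
    destruct (B ltac:(lia) ltac:(lia) ltac:(lia)) as (z' & A3 & A4).
    exists (e12 * (z - z'))%Z.
    replace (a + S b + S c - 1)%nat with (S (a + b + c)) by lia.
    replace (a + S b + c - 1)%nat with (a + b + c)%nat in A1, A2 by lia.
    replace (a + b + S c - 1)%nat with (a + b + c)%nat in A3, A4 by lia.
    specialize (F12 a b c).
    assert (Q := scaled_integral_step N D (al1 - al2) e12 g K (F a (S b) c) (F a b (S c))
      (F a (S b) (S c)) (4 ^ k * IZR N ^ k) (a + b + c) z z').
    rewrite minus_IZR in Q.
    destruct Q as [Q1 Q2]; try assumption; try lia.
    + rewrite <- F12. field; lra.
    + rewrite <- A1; ring.
    + rewrite <- A3; ring.
    + split; [rewrite <- Q1; ring | exact Q2].
Qed.

(** [4^r] clears the binomial coefficient and [N^k] the power of [(N + al) / N]. The 10 is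
    [4 * 2 * 5/4], from [4^k], the bound [2^(k + 1)] for the binomial coefficient, and
    [N + al <= 5/4 N]. *)
Lemma taylor_half_scaled_integral (k r : nat) (N D al : Z) :
  (0 < N)%Z -> (0 <= D <= N)%Z -> (4 * Z.abs al <= N)%Z -> (r <= k)%nat ->
  exists z : Z,
    4 ^ k * IZR D ^ r * IZR N ^ k * taylor_half k (IZR al / IZR N) r = IZR z * IZR N ^ r /\
    Rabs (IZR z) <= 2 * (10 * IZR N) ^ k.
Proof.
  intros HN HD Hal Hr.
  assert (HN' : 0 < IZR N) by (apply IZR_lt; exact HN).
  assert (HD0 : 0 <= IZR D) by (apply IZR_le; lia).
  assert (HD1 : IZR D <= IZR N) by (apply IZR_le; lia).
  assert (Hu0 : 0 < IZR (N + al)) by (apply IZR_lt; lia).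
  assert (Hu1 : IZR (N + al) <= 5 / 4 * IZR N).
  { rewrite plus_IZR. assert (4 * IZR (Z.abs al) <= IZR N) by (rewrite <- mult_IZR; apply IZR_le; lia).
    assert (IZR al <= IZR (Z.abs al)) by (apply IZR_le; lia). lra. }
  destruct (gbin_half_int (S k) r) as [w Hw].
  assert (Hb := gbin_half_bound (S k) r).
  exists (4 ^ Z.of_nat (k - r) * D ^ Z.of_nat r * w * (N + al) ^ Z.of_nat (k - r))%Z.
  rewrite !mult_IZR, <- !pow_IZR, <- Hw.
  set (G := gbin (INR (S k) - / 2) r) in *.
  assert (E1 : taylor_half k (IZR al / IZR N) r = G * (IZR (N + al) ^ (k - r) / IZR N ^ (k - r))).
  { unfold taylor_half. fold G. f_equal.
    replace (1 + IZR al / IZR N) with (IZR (N + al) / IZR N) by (rewrite plus_IZR; field; lra).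
    replace ((IZR (N + al) / IZR N) ^ k) with ((IZR (N + al) / IZR N) ^ r * (IZR (N + al) / IZR N) ^ (k - r))
      by (rewrite <- pow_add; f_equal; lia).
    unfold Rdiv. rewrite (Rpow_mult_distr _ _ (k - r)), pow_inv.
    assert (H := pow_lt (IZR (N + al) * / IZR N) r ltac:(apply Rmult_lt_0_compat; [lra|apply Rinv_0_lt_compat; lra])).
    assert (H2 := pow_lt (IZR N) (k - r) HN').
    field. split; [lra|]. apply Rgt_not_eq, H. }
  assert (E4 : 4 ^ k = 4 ^ r * 4 ^ (k - r)) by (rewrite <- pow_add; f_equal; lia).
  assert (EN : IZR N ^ k = IZR N ^ r * IZR N ^ (k - r)) by (rewrite <- pow_add; f_equal; lia).
  split.
  - rewrite E1, E4, EN. assert (H2 := pow_lt (IZR N) (k - r) HN'). field. lra.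
  - replace (4 ^ (k - r) * IZR D ^ r * (4 ^ r * G) * IZR (N + al) ^ (k - r))
      with (4 ^ k * G * (IZR D ^ r * IZR (N + al) ^ (k - r))) by (rewrite E4; ring).
    rewrite Rabs_mult, (Rabs_mult (4 ^ k) G).
    assert (H4 : 0 < 4 ^ k) by (apply pow_lt; lra).
    rewrite (Rabs_right (4 ^ k)) by lra.
    assert (HP : 0 <= IZR D ^ r * IZR (N + al) ^ (k - r)).
    { apply Rmult_le_pos; apply pow_le; lra. }
    rewrite (Rabs_right (IZR D ^ r * IZR (N + al) ^ (k - r))) by lra.
    replace (2 * (10 * IZR N) ^ k) with (4 ^ k * 2 ^ S k * (5 / 4 * IZR N) ^ k).
    2:{ rewrite !Rpow_mult_distr. simpl (2 ^ S k). replace 10 with (4 * (2 * (5 / 4))) by field.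
        rewrite !Rpow_mult_distr. ring. }
    apply Rmult_le_compat; [|exact HP| |].
    + apply Rmult_le_pos; [lra|apply Rabs_pos].
    + apply Rmult_le_compat_l; [lra|exact Hb].
    + replace ((5 / 4 * IZR N) ^ k) with ((5 / 4 * IZR N) ^ r * (5 / 4 * IZR N) ^ (k - r))
        by (rewrite <- pow_add; f_equal; lia).
      apply Rmult_le_compat; try (apply pow_le; lra); apply pow_incr; lra.
Qed.

Lemma coef_scaled_integral (k : nat) (N D g al0 al1 al2 e01 e02 e12 : Z) :
  (0 < N)%Z -> (0 <= D <= N)%Z -> (1 <= g)%Z ->
  al0 <> al1 -> al0 <> al2 -> al1 <> al2 ->
  (4 * Z.abs al0 <= N)%Z -> (4 * Z.abs al1 <= N)%Z -> (4 * Z.abs al2 <= N)%Z ->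
  D = (e01 * (al0 - al1))%Z -> D = (e02 * (al0 - al2))%Z -> D = (e12 * (al1 - al2))%Z ->
  (Z.abs e01 <= g)%Z -> (Z.abs e02 <= g)%Z -> (Z.abs e12 <= g)%Z ->
  let y0 := IZR al0 / IZR N in let y1 := IZR al1 / IZR N in let y2 := IZR al2 / IZR N in
  forall F, F = coef0 k y0 y1 y2 \/ F = coef1 k y0 y1 y2 \/ F = coef2 k y0 y1 y2 ->
  forall a b c, (0 < a + b + c)%nat -> (a <= S k)%nat -> (b <= S k)%nat -> (c <= S k)%nat ->
  scaled_integral k N D g (2 * (10 * IZR N) ^ k) F a b c.
Proof.
  intros HN HD Hg N01 N02 N12 A0 A1 A2 D01 D02 D12 G01 G02 G12 y0 y1 y2 F HF.
  assert (HN' : 0 < IZR N) by (apply IZR_lt; exact HN).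
  assert (Hdiv : forall u v : Z, u <> v -> IZR u / IZR N <> IZR v / IZR N).
  { intros u v Huv E. apply Huv, eq_IZR.
    apply (f_equal (fun x => x * IZR N)) in E. field_simplify in E; lra. }
  destruct (coef_divdiff k y0 y1 y2) as (C0 & C1 & C2); [now apply Hdiv..|].
  set (K := 2 * (10 * IZR N) ^ k).
  assert (HK : 0 <= K) by (apply Rmult_le_pos; [lra | apply pow_le; lra]).
  assert (Hg' : 1 <= 2 * IZR g) by (apply IZR_le in Hg; lra).
  assert (Hzero : forall (F : nat -> nat -> nat -> R) a b c,
    F a b c = 0 -> scaled_integral k N D g K F a b c).
  { intros F' a b c E. exists 0%Z. rewrite E, Rabs_R0. split; [ring|].
    apply Rmult_le_pos; [exact HK | apply pow_le; lra]. }
  assert (Hbase : forall (F : nat -> nat -> nat -> R) al a b c r, (4 * Z.abs al <= N)%Z -> (r <= k)%nat ->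
    (a + b + c = S r)%nat -> F a b c = taylor_half k (IZR al / IZR N) r -> scaled_integral k N D g K F a b c).
  { intros F' al a b c r Hal Hr Habc E.
    destruct (taylor_half_scaled_integral k r N D al HN HD Hal Hr) as (z & Z1 & Z2).
    exists z. rewrite E, Habc. replace (S r - 1)%nat with r by lia. split; [exact Z1|].
    eapply Rle_trans; [exact Z2|]. fold K. rewrite <- (Rmult_1_r K) at 1.
    apply Rmult_le_compat_l; [exact HK | now apply pow_R1_Rle]. }
  destruct HF as [-> | [-> | ->]];
    apply (divdiff_scaled_integral k N D g al0 al1 al2 e01 e02 e12 K); try assumption;
    intros r Hr;
    first [ apply Hzero; reflexivity
          | apply (Hbase _ al0 _ _ _ r); [assumption | assumption | lia | reflexivity]
          | apply (Hbase _ al1 _ _ _ r); [assumption | assumption | lia | reflexivity]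
          | apply (Hbase _ al2 _ _ _ r); [assumption | assumption | lia | reflexivity] ].
Qed.

(* The linear form with integer coefficients [z_j] is nonzero at [(p0, p1, p2)], hence at least [1]
   in absolute value, while it is small at [(1, sqrt (1 + al1 / N), sqrt (1 + al2 / N))]. *)
Theorem simultaneous_sqrt_approximation (k : nat) (N D g al1 al2 e01 e02 e12 p0 p1 p2 : Z) :
  (0 < N)%Z -> (0 < D <= N)%Z -> (1 <= g)%Z -> (0 < p0)%Z ->
  al1 <> 0%Z -> al2 <> 0%Z -> al1 <> al2 ->
  (4 * Z.abs al1 <= N)%Z -> (4 * Z.abs al2 <= N)%Z ->
  D = (e01 * al1)%Z -> D = (e02 * al2)%Z -> D = (e12 * (al1 - al2))%Z ->
  (Z.abs e01 <= g)%Z -> (Z.abs e02 <= g)%Z -> (Z.abs e12 <= g)%Z ->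
  1 <= 2 * (80 * IZR N * IZR g ^ 3) ^ k
         * (Rabs (IZR p1 - sqrt (1 + IZR al1 / IZR N) * IZR p0)
            + Rabs (IZR p2 - sqrt (1 + IZR al2 / IZR N) * IZR p0))
       + IZR p0 * (8 * (64 * IZR D ^ 3 / IZR N ^ 2) ^ k).
Proof.
  intros HN HD Hg Hp N01 N02 N12 A1 A2 D01 D02 D12 G01 G02 G12.
  assert (HN' : 0 < IZR N) by (apply IZR_lt; exact HN).
  assert (HD' : 0 < IZR D) by (apply IZR_lt; lia).
  assert (Hp' : 0 < IZR p0) by (apply IZR_lt; exact Hp).
  assert (Hg' : 1 <= IZR g) by (apply IZR_le; exact Hg).
  set (y0 := IZR 0 / IZR N). set (y1 := IZR al1 / IZR N). set (y2 := IZR al2 / IZR N).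
  assert (Hdiv : forall u v : Z, u <> v -> IZR u / IZR N <> IZR v / IZR N).
  { intros u v Huv E. apply Huv, eq_IZR.
    apply (f_equal (fun x => x * IZR N)) in E. field_simplify in E; lra. }
  assert (Habs : forall u : Z, (4 * Z.abs u <= N)%Z -> Rabs (IZR u / IZR N) <= / 4).
  { intros u Hu. rewrite Rabs_div by lra. rewrite (Rabs_right (IZR N)) by lra.
    rewrite <- abs_IZR. apply (Rmult_le_reg_r (4 * IZR N)); [lra|].
    field_simplify; [|lra]. rewrite <- mult_IZR. apply IZR_le; exact Hu. }
  assert (M01 : y0 <> y1) by (apply Hdiv; auto). assert (M02 : y0 <> y2) by (apply Hdiv; auto).
  assert (M12 : y1 <> y2) by (apply Hdiv; auto).
  assert (B0 : Rabs y0 <= / 4) by (apply Habs; lia).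
  assert (B1 : Rabs y1 <= / 4) by (apply Habs; lia).
  assert (B2 : Rabs y2 <= / 4) by (apply Habs; lia).
  assert (P : forall y, Rabs y <= / 4 -> 1 + y <> 0).
  { intros y Hy. assert (H := Rabs_def2 y (/ 2) ltac:(lra)). lra. }
  (* One of the three neighbours of [(k, k, k)] works; which one depends on the point. *)
  assert (Hall : exists a b c, (a + b + c = S (3 * k))%nat /\ (a <= S k)%nat /\ (b <= S k)%nat /\ (c <= S k)%nat /\
    coef_form k y0 y1 y2 (IZR p0) (IZR p1) (IZR p2) a b c <> 0).
  { destruct (coef_form_nonzero k y0 y1 y2 (IZR p0) (IZR p1) (IZR p2) M01 M02 M12
      (P _ B0) (P _ B1) (P _ B2) ltac:(lra) k k k) as [H|[H|H]].
    - exists (S k), k, k. repeat split; try lia; exact H.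
    - exists k, (S k), k. repeat split; try lia; exact H.
    - exists k, k, (S k). repeat split; try lia; exact H. }
  destruct Hall as (a & b & c & Habc & Ha & Hb & Hc & Hne).
  assert (Q := coef_scaled_integral k N D g 0 al1 al2 (- e01) (- e02) e12 HN ltac:(lia) Hg
    ltac:(auto) ltac:(auto) N12 ltac:(lia) A1 A2 ltac:(lia) ltac:(lia) D12 ltac:(lia) ltac:(lia) G12).
  cbv zeta in Q. fold y0 y1 y2 in Q.
  destruct (Q (coef0 k y0 y1 y2) ltac:(auto) a b c ltac:(lia) Ha Hb Hc) as (z0 & E0 & S0).
  destruct (Q (coef1 k y0 y1 y2) ltac:(auto) a b c ltac:(lia) Ha Hb Hc) as (z1 & E1 & S1).
  destruct (Q (coef2 k y0 y1 y2) ltac:(auto) a b c ltac:(lia) Ha Hb Hc) as (z2 & E2 & S2).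
  clear Q.
  replace (a + b + c - 1)%nat with (3 * k)%nat in * by lia.
  assert (HT := coef_form_sqrt_bound k y0 y1 y2 M01 M02 M12 B0 B1 B2 a b c ltac:(lia) Ha Hb Hc).
  rewrite Habc in HT.
  set (v0 := coef0 k y0 y1 y2 a b c) in *. set (v1 := coef1 k y0 y1 y2 a b c) in *.
  set (v2 := coef2 k y0 y1 y2 a b c) in *.
  unfold coef_form in Hne, HT. fold v0 v1 v2 in Hne, HT.
  replace (sqrt (1 + y0)) with 1 in HT
    by (replace (1 + y0) with 1 by (unfold y0; field; lra); symmetry; apply sqrt_1).
  set (t1 := sqrt (1 + y1)) in *. set (t2 := sqrt (1 + y2)) in *.
  assert (HN3 : 0 < IZR N ^ (3 * k)) by (apply pow_lt; exact HN').
  set (C := 4 ^ k * IZR D ^ (3 * k) * IZR N ^ k) in *.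
  assert (F0 : IZR z0 = C * v0 / IZR N ^ (3 * k)) by (rewrite E0; field; lra).
  assert (F1 : IZR z1 = C * v1 / IZR N ^ (3 * k)) by (rewrite E1; field; lra).
  assert (F2 : IZR z2 = C * v2 / IZR N ^ (3 * k)) by (rewrite E2; field; lra).
  assert (HC : C <> 0).
  { unfold C. apply Rgt_not_eq. repeat apply Rmult_lt_0_compat; apply pow_lt; lra. }
  set (L := (z0 * p0 + z1 * p1 + z2 * p2)%Z).
  assert (HL : IZR L = C / IZR N ^ (3 * k) * (IZR p0 * v0 + IZR p1 * v1 + IZR p2 * v2)).
  { unfold L. rewrite !plus_IZR, !mult_IZR, F0, F1, F2. field. lra. }
  assert (HL1 : 1 <= Rabs (IZR L)).
  { rewrite <- abs_IZR. apply IZR_le. assert (L <> 0)%Z; [|lia].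
    intros E. apply Hne. rewrite E in HL.
    symmetry in HL. destruct (Rmult_integral _ _ HL) as [H|H]; [|exact H].
    exfalso. apply (Rmult_integral_contrapositive_currified C (/ IZR N ^ (3 * k)) HC);
      [apply Rinv_neq_0_compat; lra | exact H]. }
  (* [64 = 4 * 2 * 2^3] collects [4^k], [2^(k + 1)] and [2^(3 k + 1)]; the left-over factors of 2
     make 8. *)
  assert (HW : Rabs (IZR z0 + IZR z1 * t1 + IZR z2 * t2) <= 8 * (64 * IZR D ^ 3 / IZR N ^ 2) ^ k).
  { replace (IZR z0 + IZR z1 * t1 + IZR z2 * t2)
      with (C / IZR N ^ (3 * k) * (1 * v0 + t1 * v1 + t2 * v2)) by (rewrite F0, F1, F2; field; lra).
    rewrite Rabs_mult.
    assert (HC0 : 0 <= C / IZR N ^ (3 * k)).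
    { apply Rmult_le_pos; [|apply Rlt_le, Rinv_0_lt_compat; exact HN3].
      unfold C. repeat apply Rmult_le_pos; apply pow_le; lra. }
    rewrite (Rabs_right (C / IZR N ^ (3 * k))) by lra.
    apply Rle_trans with (C / IZR N ^ (3 * k) * (2 * (2 ^ S k * 2 ^ S (3 * k))));
      [apply Rmult_le_compat_l; assumption|]. right.
    replace (2 ^ S (3 * k)) with (2 * (2 ^ 3) ^ k) by (rewrite <- pow_mult; reflexivity).
    unfold C. rewrite !pow_mult. simpl (2 ^ S k).
    replace (64 * IZR D ^ 3 / IZR N ^ 2) with (4 * IZR D ^ 3 * IZR N * / IZR N ^ 3 * 2 * 2 ^ 3)
      by (field; lra).
    rewrite !(Rpow_mult_distr _ _ k), pow_inv. unfold Rdiv. ring. }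
  assert (HK : 2 * (10 * IZR N) ^ k * (2 * IZR g) ^ (3 * k) = 2 * (80 * IZR N * IZR g ^ 3) ^ k).
  { rewrite (pow_mult _ 3 k), Rmult_assoc, <- Rpow_mult_distr. do 2 f_equal. ring. }
  rewrite HK in S1, S2.
  set (E := 2 * (80 * IZR N * IZR g ^ 3) ^ k) in *.
  eapply Rle_trans; [exact HL1|].
  replace (IZR L) with (IZR z1 * (IZR p1 - t1 * IZR p0) + IZR z2 * (IZR p2 - t2 * IZR p0)
    + IZR p0 * (IZR z0 + IZR z1 * t1 + IZR z2 * t2)) by (unfold L; rewrite !plus_IZR, !mult_IZR; ring).
  eapply Rle_trans; [apply Rabs_triang|]. apply Rplus_le_compat.
  - eapply Rle_trans; [apply Rabs_triang|]. rewrite !Rabs_mult, Rmult_plus_distr_l.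
    apply Rplus_le_compat; apply Rmult_le_compat_r; try apply Rabs_pos; assumption.
  - rewrite Rabs_mult, (Rabs_right (IZR p0)) by lra. apply Rmult_le_compat_l; [lra|exact HW].
Qed.

(** * Large elements *)

(** From [1 + x <= exp x], raised to the powers 30 and 12. *)
Lemma ln_2_bounds : 0.66 <= ln 2 <= 0.72.
Proof.
  split.
  - rewrite <- (ln_exp 0.66). apply Rcomplements.ln_le; [apply exp_pos|].
    replace 0.66 with (- (INR 30 * - 0.022)) by (simpl; lra).
    rewrite exp_Ropp.
    assert (E : exp (INR 30 * - 0.022) = exp (- 0.022) ^ 30)
      by (rewrite <- Rpower_pow by apply exp_pos; unfold Rpower; now rewrite ln_exp).
    rewrite E. clear E.
    assert (H := exp_ineq1_le (- 0.022)).
    assert (H1 : 0.978 ^ 30 <= exp (- 0.022) ^ 30) by (apply pow_incr; lra).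
    apply Rle_trans with (/ (0.978 ^ 30)).
    + apply Rinv_le_contravar; [apply pow_lt; lra | exact H1].
    + apply (Rmult_le_reg_l (0.978 ^ 30)); [apply pow_lt; lra|].
      rewrite Rinv_r by (apply pow_nonzero; lra). lra.
  - rewrite <- (ln_exp 0.72). apply Rcomplements.ln_le; [lra|].
    replace 0.72 with (INR 12 * 0.06) by (simpl; lra).
    assert (E : exp (INR 12 * 0.06) = exp 0.06 ^ 12)
      by (rewrite <- Rpower_pow by apply exp_pos; unfold Rpower; now rewrite ln_exp).
    rewrite E. assert (H := exp_ineq1_le 0.06).
    apply Rle_trans with (1.06 ^ 12); [lra | apply pow_incr; lra].
Qed.

(* [s w x / (u w z)] approximates [sqrt (1 + n / (u c))], as both squares are close to
   [(u c + n) / (u c)]. *)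
Lemma sqrt_ratio_approx (n u w c d s x z : R) :
  Rabs n < u -> 1 <= u -> 0 < w -> u < c -> c < d -> 2 <= d ->
  0 <= s -> 0 <= x -> 0 <= z ->
  u * c + n = s * s -> u * d + n = x * x -> c * d + n = z * z ->
  Rabs (s * w * x - sqrt (1 + w * n / (u * w * c)) * (u * w * z)) <= 2 * w * Rabs n * sqrt (c / d).
Proof.
  intros Hn Hu Hw Huc Hcd Hd Hs0 Hx0 Hz0 Hs Hx Hz.
  assert (Hn2 : - u < n < u) by (apply Rabs_def2 in Hn; lra).
  assert (Huc0 : u * 1 <= u * c) by (apply Rmult_le_compat_l; lra).
  assert (Hud : u * 2 <= u * d) by (apply Rmult_le_compat_l; lra).
  assert (Huc1 : u * u < u * c) by (apply Rmult_lt_compat_l; lra).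
  assert (Huu : u * 1 <= u * u) by (apply Rmult_le_compat_l; lra).
  assert (Hx1 : 0 < x) by nra.
  assert (Hs1 : 0 < s) by nra.
  set (th := 1 + w * n / (u * w * c)).
  assert (Eth : th = s * s / (u * c)) by (unfold th; rewrite <- Hs; field; nra).
  assert (Hth : 0 <= th).
  { rewrite Eth. apply Rmult_le_pos; [nra|]. apply Rlt_le, Rinv_0_lt_compat; nra. }
  set (X := s * w * x). set (Y := sqrt th * (u * w * z)).
  assert (HX : 0 < X) by (unfold X; repeat apply Rmult_lt_0_compat; assumption).
  assert (HY : 0 <= Y).
  { unfold Y. apply Rmult_le_pos; [apply sqrt_pos|]. repeat apply Rmult_le_pos; lra. }
  assert (HXY : (X - Y) * (X + Y) = w * w * (s * s) * (n * (c - u) / c)).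
  { replace ((X - Y) * (X + Y)) with (X * X - (sqrt th * sqrt th) * (u * w * z) * (u * w * z))
      by (unfold Y; ring).
    rewrite sqrt_sqrt by exact Hth. rewrite Eth. unfold X.
    replace (s * w * x * (s * w * x)) with (s * s * w * w * (x * x)) by ring.
    replace (s * s / (u * c) * (u * w * z) * (u * w * z))
      with (s * s / (u * c) * u * u * w * w * (z * z)) by ring.
    rewrite <- Hx, <- Hz. field. lra. }
  assert (Hq : 0 <= (c - u) / c <= 1).
  { split; [apply Rmult_le_pos; [lra|apply Rlt_le, Rinv_0_lt_compat; lra]|].
    apply (Rmult_le_reg_r c); [lra|]. unfold Rdiv. rewrite Rmult_assoc, Rinv_l; lra. }
  assert (HA : Rabs (X - Y) * X <= w * w * (s * s) * Rabs n).
  { apply Rle_trans with (Rabs (X - Y) * (X + Y)).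
    - apply Rmult_le_compat_l; [apply Rabs_pos | lra].
    - rewrite <- (Rabs_right (X + Y)) by lra. rewrite <- Rabs_mult, HXY.
      replace (w * w * (s * s) * (n * (c - u) / c)) with (w * w * (s * s) * ((c - u) / c) * n)
        by (field; lra).
      assert (0 <= w * w * (s * s)) by nra.
      rewrite Rabs_mult. apply Rmult_le_compat_r; [apply Rabs_pos|].
      rewrite Rabs_right by (apply Rle_ge, Rmult_le_pos; lra).
      rewrite <- (Rmult_1_r (w * w * (s * s))) at 2. apply Rmult_le_compat_l; lra. }
  assert (HB : Rabs (X - Y) * x <= w * s * Rabs n).
  { apply (Rmult_le_reg_r (s * w)); [apply Rmult_lt_0_compat; lra|].
    unfold X in HA at 2. nra. }
  (* From [s^2 <= 2 u c] and [u d <= 2 x^2]. *)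
  assert (HC : s <= 2 * sqrt (c / d) * x).
  { apply Rsqr_incr_0_var.
    - unfold Rsqr.
      replace (2 * sqrt (c / d) * x * (2 * sqrt (c / d) * x))
        with (4 * (sqrt (c / d) * sqrt (c / d)) * (x * x)) by ring.
      rewrite sqrt_sqrt by (apply Rmult_le_pos; [lra|apply Rlt_le, Rinv_0_lt_compat; lra]).
      rewrite <- Hs, <- Hx. apply (Rmult_le_reg_r d); [lra|].
      replace (4 * (c / d) * (u * d + n) * d) with (4 * c * (u * d + n)) by (field; lra).
      assert (u * c + n <= 2 * (u * c)) by lra.
      assert (u * d <= 2 * (u * d + n)) by lra.
      apply Rle_trans with (2 * (u * c) * d); [apply Rmult_le_compat_r; lra|].
      apply Rle_trans with (2 * c * (u * d)); [lra|].
      apply Rle_trans with (2 * c * (2 * (u * d + n))); [apply Rmult_le_compat_l; lra | lra].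
    - repeat apply Rmult_le_pos; try lra. apply sqrt_pos. }
  apply (Rmult_le_reg_r x); [exact Hx1|].
  apply Rle_trans with (w * s * Rabs n); [exact HB|].
  assert (0 <= w * Rabs n) by (apply Rmult_le_pos; [lra|apply Rabs_pos]).
  replace (w * s * Rabs n) with (w * Rabs n * s) by ring.
  replace (2 * w * Rabs n * sqrt (c / d) * x) with (w * Rabs n * (2 * sqrt (c / d) * x)) by ring.
  apply Rmult_le_compat_l; assumption.
Qed.

(** Over the common denominator [N = a b c], the numbers [n / (a c)] and [n / (b c)] become
    [b n / N] and [a n / N]. Both numerators and their difference divide [D = |n| a b (b - a)] with
    cofactors of size at most [g = b^2], and [|n| b <= c] ensures [D <= N]. *)
Lemma quadruple_inequality (n : Z) (S : Z -> Prop) (a b c d : Z) (k : nat) :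
  has_property_D n S -> n <> 0%Z -> S a -> S b -> S c -> S d ->
  (n * n < a)%Z -> (a < b)%Z -> (b < c)%Z -> (c < d)%Z -> (Z.abs n * b <= c)%Z ->
  exists z : R, 0 < z /\ z * z <= 2 * (IZR c * IZR d) /\
  1 <= 2 * (80 * (IZR a * IZR b * IZR c) * IZR b ^ 6) ^ k
         * (4 * IZR b * IZR (Z.abs n) * sqrt (IZR c / IZR d))
       + IZR a * IZR b * z
         * (8 * (IZR (Z.abs n) ^ 3 * IZR b ^ 9 / (IZR a * IZR b * IZR c) ^ 2) ^ k).
Proof.
  intros HS Hn Sa Sb Sc Sd Ha Hab Hbc Hcd Hnb.
  destruct (has_property_D_root n S a c HS Sa Sc ltac:(lia)) as (s & Hs0 & Hs).
  destruct (has_property_D_root n S b c HS Sb Sc ltac:(lia)) as (t & Ht0 & Ht).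
  destruct (has_property_D_root n S a d HS Sa Sd ltac:(lia)) as (x & Hx0 & Hx).
  destruct (has_property_D_root n S b d HS Sb Sd ltac:(lia)) as (y & Hy0 & Hy).
  destruct (has_property_D_root n S c d HS Sc Sd ltac:(lia)) as (z & Hz0 & Hz).
  assert (Hn1 := abs_le_square n).
  assert (Hcd1 : (c * 1 <= c * d)%Z) by (apply Z.mul_le_mono_nonneg_l; lia).
  assert (Hz1 : (0 < z)%Z) by (destruct (Z.eq_dec z 0) as [->|]; lia).
  assert (Hba : (0 < b - a)%Z) by lia.
  assert (Hab0 : (0 < a * b)%Z) by (apply Z.mul_pos_pos; lia).
  assert (Hsg : (Z.abs n = Z.sgn n * n)%Z) by lia.
  assert (Hsg1 : (Z.abs (Z.sgn n) = 1)%Z) by lia.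
  assert (HD0 : (0 < Z.abs n * a * b * (b - a))%Z) by (repeat apply Z.mul_pos_pos; lia).
  assert (HDN : (Z.abs n * (b - a) <= c)%Z).
  { apply Z.le_trans with (Z.abs n * b)%Z; [|exact Hnb]. apply Z.mul_le_mono_nonneg_l; lia. }
  assert (Q := simultaneous_sqrt_approximation k (a * b * c) (Z.abs n * a * b * (b - a)) (b * b)
    (b * n) (a * n) (Z.sgn n * (a * (b - a))) (Z.sgn n * (b * (b - a))) (Z.sgn n * (a * b))
    (a * b * z) (s * b * x) (t * a * y)).
  assert (Hbn : (Z.abs n * 4 <= a * c)%Z).
  { apply Z.mul_le_mono_nonneg; lia. }
  assert (Han : (Z.abs n * 4 <= b * c)%Z).
  { apply Z.mul_le_mono_nonneg; lia. }
  assert (Q' := Q ltac:(repeat apply Z.mul_pos_pos; lia)). clear Q.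
  assert (H1 : (0 < Z.abs n * a * b * (b - a) <= a * b * c)%Z).
  { split; [exact HD0|].
    replace (Z.abs n * a * b * (b - a))%Z with (a * b * (Z.abs n * (b - a)))%Z by ring.
    apply Z.mul_le_mono_nonneg_l; lia. }
  specialize (Q' H1). clear H1.
  assert (H1 : (1 <= b * b)%Z) by (apply (Z.mul_le_mono_nonneg 1 b 1 b); lia). specialize (Q' H1). clear H1.
  assert (H1 : (0 < a * b * z)%Z) by (apply Z.mul_pos_pos; lia). specialize (Q' H1). clear H1.
  assert (H1 : (b * n <> 0)%Z) by (apply Z.neq_mul_0; lia). specialize (Q' H1). clear H1.
  assert (H1 : (a * n <> 0)%Z) by (apply Z.neq_mul_0; lia). specialize (Q' H1). clear H1.
  assert (H1 : (b * n <> a * n)%Z) by (intros E; apply Z.mul_cancel_r in E; lia).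
  specialize (Q' H1). clear H1.
  assert (H1 : (4 * Z.abs (b * n) <= a * b * c)%Z).
  { rewrite Z.abs_mul, (Z.abs_eq b) by lia.
    replace (4 * (b * Z.abs n))%Z with (b * (Z.abs n * 4))%Z by ring.
    replace (a * b * c)%Z with (b * (a * c))%Z by ring. apply Z.mul_le_mono_nonneg_l; lia. }
  specialize (Q' H1). clear H1.
  assert (H1 : (4 * Z.abs (a * n) <= a * b * c)%Z).
  { rewrite Z.abs_mul, (Z.abs_eq a) by lia.
    replace (4 * (a * Z.abs n))%Z with (a * (Z.abs n * 4))%Z by ring.
    replace (a * b * c)%Z with (a * (b * c))%Z by ring. apply Z.mul_le_mono_nonneg_l; lia. }
  specialize (Q' H1). clear H1.
  specialize (Q' ltac:(rewrite Hsg; ring) ltac:(rewrite Hsg; ring) ltac:(rewrite Hsg; ring)).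
  assert (Hg : forall e : Z, (0 <= e <= b * b)%Z -> (Z.abs (Z.sgn n * e) <= b * b)%Z).
  { intros e He. rewrite Z.abs_mul, Hsg1. lia. }
  assert (B1 : (0 <= a * (b - a) <= b * b)%Z).
  { split; [apply Z.mul_nonneg_nonneg; lia | apply Z.mul_le_mono_nonneg; lia]. }
  assert (B2 : (0 <= b * (b - a) <= b * b)%Z).
  { split; [apply Z.mul_nonneg_nonneg; lia | apply Z.mul_le_mono_nonneg; lia]. }
  assert (B3 : (0 <= a * b <= b * b)%Z).
  { split; [lia | apply Z.mul_le_mono_nonneg; lia]. }
  specialize (Q' (Hg _ B1) (Hg _ B2) (Hg _ B3)).
  clear Hg B1 B2 B3.
  assert (Ra : 1 < IZR a) by (apply IZR_lt; lia).
  assert (Rab : IZR a < IZR b) by (apply IZR_lt; lia).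
  assert (Rbc : IZR b < IZR c) by (apply IZR_lt; lia).
  assert (Rcd : IZR c < IZR d) by (apply IZR_lt; lia).
  assert (R2 : 2 <= IZR d) by (apply IZR_le; lia).
  assert (Rn : Rabs (IZR n) < IZR a) by (rewrite <- abs_IZR; apply IZR_lt; lia).
  assert (Rs : 0 <= IZR s) by (apply IZR_le; lia). assert (Rt : 0 <= IZR t) by (apply IZR_le; lia).
  assert (Rx : 0 <= IZR x) by (apply IZR_le; lia). assert (Ry : 0 <= IZR y) by (apply IZR_le; lia).
  assert (Rz : 0 < IZR z) by (apply IZR_lt; lia).
  assert (HsR : IZR a * IZR c + IZR n = IZR s * IZR s) by (rewrite <- !mult_IZR, <- plus_IZR; now f_equal).
  assert (HtR : IZR b * IZR c + IZR n = IZR t * IZR t) by (rewrite <- !mult_IZR, <- plus_IZR; now f_equal).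
  assert (HxR : IZR a * IZR d + IZR n = IZR x * IZR x) by (rewrite <- !mult_IZR, <- plus_IZR; now f_equal).
  assert (HyR : IZR b * IZR d + IZR n = IZR y * IZR y) by (rewrite <- !mult_IZR, <- plus_IZR; now f_equal).
  assert (HzR : IZR c * IZR d + IZR n = IZR z * IZR z) by (rewrite <- !mult_IZR, <- plus_IZR; now f_equal).
  assert (E1 := sqrt_ratio_approx (IZR n) (IZR a) (IZR b) (IZR c) (IZR d) (IZR s) (IZR x) (IZR z)
    Rn ltac:(lra) ltac:(lra) ltac:(lra) Rcd R2 Rs Rx ltac:(lra) HsR HxR HzR).
  assert (E2 := sqrt_ratio_approx (IZR n) (IZR b) (IZR a) (IZR c) (IZR d) (IZR t) (IZR y) (IZR z)
    ltac:(lra) ltac:(lra) ltac:(lra) ltac:(lra) Rcd R2 Rt Ry ltac:(lra) HtR HyR HzR).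
  exists (IZR z). split; [exact Rz|]. split.
  { rewrite <- HzR. assert (IZR n <= Rabs (IZR n)) by apply Rle_abs.
    assert (IZR c * 1 <= IZR c * IZR d) by (apply Rmult_le_compat_l; lra). lra. }
  rewrite !mult_IZR, !minus_IZR in Q'. rewrite <- abs_IZR in E1, E2.
  replace (IZR b * IZR a * IZR c) with (IZR a * IZR b * IZR c) in E2 by ring.
  replace (IZR b * IZR a * IZR z) with (IZR a * IZR b * IZR z) in E2 by ring.
  set (N := IZR a * IZR b * IZR c) in *.
  assert (HN : 0 < N) by (unfold N; repeat apply Rmult_lt_0_compat; lra).
  assert (Hnn : 0 < IZR (Z.abs n)) by (apply IZR_lt; lia).
  assert (Hsq : 0 <= sqrt (IZR c / IZR d)) by apply sqrt_pos.
  replace (80 * N * IZR b ^ 6) with (80 * N * (IZR b * IZR b) ^ 3) by ring.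
  eapply Rle_trans; [exact Q'|]. apply Rplus_le_compat.
  - apply Rmult_le_compat_l.
    + apply Rmult_le_pos; [lra|]. apply pow_le. apply Rmult_le_pos; [lra|]. apply pow_le. nra.
    + eapply Rle_trans; [apply Rplus_le_compat; [exact E1|exact E2]|].
      assert (0 <= IZR (Z.abs n) * sqrt (IZR c / IZR d)) by (apply Rmult_le_pos; lra). nra.
  - apply Rmult_le_compat_l; [repeat apply Rmult_le_pos; lra|].
    apply Rmult_le_compat_l; [lra|]. apply pow_incr.
    assert (HN2 : 0 < / N ^ 2) by (apply Rinv_0_lt_compat, pow_lt; exact HN).
    (* The bound [a (b - a) <= b^2 / 4], cubed, absorbs the factor 64. *)
    assert (Hq : 0 <= IZR a * (IZR b - IZR a) <= IZR b * IZR b / 4).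
    { split; [apply Rmult_le_pos; lra|]. assert (0 <= (IZR b - 2 * IZR a) ^ 2) by apply pow2_ge_0. lra. }
    split.
    + apply Rmult_le_pos; [|lra]. apply Rmult_le_pos; [lra|]. apply pow_le.
      repeat apply Rmult_le_pos; lra.
    + apply Rmult_le_compat_r; [lra|].
      replace (64 * (IZR (Z.abs n) * IZR a * IZR b * (IZR b - IZR a)) ^ 3)
        with (IZR (Z.abs n) ^ 3 * IZR b ^ 3 * (64 * (IZR a * (IZR b - IZR a)) ^ 3)) by ring.
      replace (IZR (Z.abs n) ^ 3 * IZR b ^ 9)
        with (IZR (Z.abs n) ^ 3 * IZR b ^ 3 * (64 * (IZR b * IZR b / 4) ^ 3)) by field.
      apply Rmult_le_compat_l.
      * apply Rmult_le_pos; apply pow_le; lra.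
      * apply Rmult_le_compat_l; [lra|]. apply pow_incr; lra.
Qed.

Lemma ln_sqrt (x : R) : 0 < x -> ln (sqrt x) = ln x / 2.
Proof.
  intros Hx. assert (Hs := sqrt_lt_R0 _ Hx).
  rewrite <- (sqrt_sqrt x) at 2 by lra. rewrite ln_mult by assumption. field.
Qed.

(** Once [rho^k >= 16 q] the second term is at most 1/2, so [G^k E >= 1/4]. The chosen [k] exceeds
    [ln (16 q) / ln rho] by at most 1; taking logarithms and multiplying by [ln rho] eliminates
    it. *)
Lemma exponent_choice (G rho q E : R) :
  1 < G -> 1 < rho -> 1 <= q -> 0 < E ->
  (forall k : nat, 1 <= 2 * G ^ k * E + q * (8 * (/ rho) ^ k)) ->
  0 <= (2 * ln 2 + ln E + ln G) * ln rho + ln G * (4 * ln 2 + ln q).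
Proof.
  intros HG Hrho Hq HE H.
  assert (HlG : 0 < ln G) by (rewrite <- ln_1; apply ln_increasing; lra).
  assert (Hlr : 0 < ln rho) by (rewrite <- ln_1; apply ln_increasing; lra).
  assert (HL : 0 <= ln (16 * q)).
  { rewrite <- ln_1. apply Rcomplements.ln_le; lra. }
  set (L := ln (16 * q)) in *.
  destruct (archimed (L / ln rho)) as [K1 K2].
  assert (HLr : 0 <= L / ln rho) by (apply Rmult_le_pos; [exact HL|apply Rlt_le, Rinv_0_lt_compat, Hlr]).
  assert (HK0 : (0 <= up (L / ln rho))%Z) by (apply le_IZR; lra).
  set (k := Z.to_nat (up (L / ln rho))).
  assert (Ek : INR k = IZR (up (L / ln rho))) by (unfold k; rewrite INR_IZR_INZ, Z2Nat.id by exact HK0; reflexivity).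
  rewrite <- Ek in K1, K2.
  assert (Hk1 : L <= INR k * ln rho).
  { apply Rle_trans with (L / ln rho * ln rho); [right; field; lra | apply Rmult_le_compat_r; lra]. }
  assert (Hk2 : INR k * ln rho <= L + ln rho).
  { apply Rle_trans with ((L / ln rho + 1) * ln rho); [apply Rmult_le_compat_r; lra | right; field; lra]. }
  assert (Hrk : 16 * q <= rho ^ k).
  { rewrite <- (exp_ln (16 * q)) by lra. fold L. rewrite <- (exp_ln (rho ^ k)) by (apply pow_lt; lra).
    rewrite ln_pow by lra. destruct (Rle_lt_or_eq_dec _ _ Hk1) as [H1|H1]; [left; now apply exp_increasing|now rewrite <- H1; right]. }
  specialize (H k).
  assert (Hsmall : q * (8 * (/ rho) ^ k) <= / 2).
  { rewrite pow_inv. assert (0 < rho ^ k) by (apply pow_lt; lra).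
    apply (Rmult_le_reg_r (rho ^ k)); [assumption|].
    replace (q * (8 * / rho ^ k) * rho ^ k) with (8 * q) by (field; lra). lra. }
  assert (Hbig : / 4 <= G ^ k * E) by lra.
  assert (HGk : 0 < G ^ k) by (apply pow_lt; lra).
  apply Rcomplements.ln_le in Hbig; [|lra].
  rewrite ln_mult, ln_pow in Hbig by lra.
  replace (/ 4) with (/ (2 * 2)) in Hbig by field.
  rewrite ln_Rinv, ln_mult in Hbig by lra.
  assert (EL : L = 4 * ln 2 + ln q).
  { unfold L. replace (16 * q) with (2 ^ 4 * q) by ring.
    rewrite ln_mult, ln_pow by lra. simpl INR. ring. }
  rewrite <- EL.
  assert (HX : 0 <= (2 * ln 2 + ln E + INR k * ln G) * ln rho) by (apply Rmult_le_pos; lra).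
  assert (HY : INR k * ln rho * ln G <= (L + ln rho) * ln G) by (apply Rmult_le_compat_r; lra).
  lra.
Qed.

Lemma quadruple_log_inequality (n : Z) (S : Z -> Prop) (a b c d : Z) :
  has_property_D n S -> n <> 0%Z -> S a -> S b -> S c -> S d ->
  (n * n < a)%Z -> (a < b)%Z -> (b < c)%Z -> (c < d)%Z -> (Z.abs n * b <= c)%Z ->
  let A := ln (IZR a) in let B := ln (IZR b) in let C := ln (IZR c) in let D := ln (IZR d) in
  let nu := ln (IZR (Z.abs n)) in
  let R := 2 * (A + B + C) - 3 * nu - 9 * B in
  0 < R ->
  0 <= (4 * ln 2 + B + nu + (C - D) / 2 + (7 * ln 2 + A + 7 * B + C)) * R
       + (7 * ln 2 + A + 7 * B + C) * (5 * ln 2 + A + B + (C + D) / 2).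
Proof.
  intros HS Hn Sa Sb Sc Sd Ha Hab Hbc Hcd Hnb A B C D nu R HR.
  assert (Hn1 := abs_le_square n).
  assert (Ra : 1 < IZR a) by (apply IZR_lt; lia).
  assert (Rab : IZR a < IZR b) by (apply IZR_lt; lia).
  assert (Rbc : IZR b < IZR c) by (apply IZR_lt; lia).
  assert (Rcd : IZR c < IZR d) by (apply IZR_lt; lia).
  assert (Hnn : 1 <= IZR (Z.abs n)) by (apply IZR_le; lia).
  set (N := IZR a * IZR b * IZR c).
  assert (HN : 0 < N) by (unfold N; repeat apply Rmult_lt_0_compat; lra).
  assert (HlN : ln N = A + B + C).
  { unfold N. rewrite !ln_mult by (repeat apply Rmult_lt_0_compat; lra). reflexivity. }
  assert (HA : 0 < A) by (unfold A; rewrite <- ln_1; apply ln_increasing; lra).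
  assert (HB : 0 < B) by (unfold B; rewrite <- ln_1; apply ln_increasing; lra).
  assert (HC : 0 < C) by (unfold C; rewrite <- ln_1; apply ln_increasing; lra).
  assert (H2 := ln_2_bounds).
  (* Replacing 80 by a power of 2 makes the logarithm an explicit multiple of [ln 2]. *)
  set (G := 128 * N * IZR b ^ 6).
  set (rho := N ^ 2 / (IZR (Z.abs n) ^ 3 * IZR b ^ 9)).
  set (E := 4 * IZR b * IZR (Z.abs n) * sqrt (IZR c / IZR d)).
  assert (Hcd0 : 0 < IZR c / IZR d) by (apply Rdiv_lt_0_compat; lra).
  assert (Hsq := sqrt_lt_R0 _ Hcd0).
  assert (HlG : ln G = 7 * ln 2 + A + 7 * B + C).
  { unfold G. replace 128 with (2 ^ 7) by ring.
    assert (0 < IZR b ^ 6) by (apply pow_lt; lra).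
    rewrite !ln_mult, !ln_pow, HlN; try (repeat apply Rmult_lt_0_compat; lra); try lra.
    fold B. simpl INR. ring. }
  assert (Hlr : ln rho = R).
  { unfold rho, Rdiv.
    assert (0 < N ^ 2) by (apply pow_lt; lra).
    assert (0 < IZR (Z.abs n) ^ 3) by (apply pow_lt; lra).
    assert (0 < IZR b ^ 9) by (apply pow_lt; lra).
    assert (0 < IZR (Z.abs n) ^ 3 * IZR b ^ 9) by (apply Rmult_lt_0_compat; lra).
    rewrite ln_mult, ln_Rinv, ln_mult, !ln_pow, HlN; try lra; try (apply Rinv_0_lt_compat; lra).
    fold B nu. simpl INR. unfold R. ring. }
  assert (HlE : ln E = 2 * ln 2 + B + nu + (C - D) / 2).
  { unfold E. replace 4 with (2 * 2) by ring.
    rewrite !ln_mult by (repeat apply Rmult_lt_0_compat; lra).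
    rewrite ln_sqrt by exact Hcd0. rewrite Rcomplements.ln_div by lra.
    fold B C D nu. field. }
  assert (HG1 : 1 < G).
  { apply ln_lt_inv; [lra| |]; unfold G; [repeat apply Rmult_lt_0_compat; try lra; apply pow_lt; lra|].
    fold G. rewrite ln_1, HlG. lra. }
  assert (Hr0 : 0 < rho).
  { unfold rho. apply Rdiv_lt_0_compat; [apply pow_lt; lra|].
    apply Rmult_lt_0_compat; apply pow_lt; lra. }
  assert (Hr1 : 1 < rho) by (apply ln_lt_inv; [lra | exact Hr0 | rewrite ln_1, Hlr; exact HR]).
  set (q := IZR a * IZR b * sqrt (2 * (IZR c * IZR d))).
  assert (Hcd1 : 0 < 2 * (IZR c * IZR d)) by (apply Rmult_lt_0_compat; [lra|apply Rmult_lt_0_compat; lra]).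
  assert (Hlq : ln q = A + B + (ln 2 + C + D) / 2).
  { unfold q. assert (Hs := sqrt_lt_R0 _ Hcd1).
    rewrite !ln_mult by (repeat apply Rmult_lt_0_compat; lra).
    rewrite ln_sqrt by exact Hcd1.
    rewrite !ln_mult by (try lra; apply Rmult_lt_0_compat; lra).
    fold A B C D. field. }
  assert (Hq0 : 0 < q).
  { unfold q. assert (Hs := sqrt_lt_R0 _ Hcd1). repeat apply Rmult_lt_0_compat; lra. }
  assert (HD : C < D) by (apply ln_increasing; lra).
  assert (Hq1 : 1 <= q).
  { apply Rlt_le, ln_lt_inv; [lra | exact Hq0 | rewrite ln_1, Hlq; lra]. }
  assert (HE : 0 < E) by (unfold E; repeat apply Rmult_lt_0_compat; lra).
  assert (Q := exponent_choice G rho q E HG1 Hr1 Hq1 HE).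
  rewrite HlG, Hlr, HlE, Hlq in Q.
  assert (Q' : 0 <= (2 * ln 2 + (2 * ln 2 + B + nu + (C - D) / 2) + (7 * ln 2 + A + 7 * B + C)) * R +
      (7 * ln 2 + A + 7 * B + C) * (4 * ln 2 + (A + B + (ln 2 + C + D) / 2))).
  { apply Q. intros k.
    destruct (quadruple_inequality n S a b c d k HS Hn Sa Sb Sc Sd Ha Hab Hbc Hcd Hnb)
      as (z & Hz0 & Hz & H).
    eapply Rle_trans; [exact H|]. fold N E. apply Rplus_le_compat.
    - apply Rmult_le_compat_r; [lra|]. apply Rmult_le_compat_l; [lra|]. apply pow_incr.
      assert (0 < N * IZR b ^ 6) by (apply Rmult_lt_0_compat; [lra|apply pow_lt; lra]).
      unfold G. lra.
    - replace (IZR (Z.abs n) ^ 3 * IZR b ^ 9 / N ^ 2) with (/ rho).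
      2:{ unfold rho. field. repeat split; lra. }
      apply Rmult_le_compat_r.
      + apply Rmult_le_pos; [lra|]. apply pow_le, Rlt_le, Rinv_0_lt_compat; lra.
      + unfold q. apply Rmult_le_compat_l; [apply Rmult_le_pos; lra|].
        apply Rsqr_incr_0_var; [|apply sqrt_pos]. unfold Rsqr.
        rewrite sqrt_sqrt by lra. exact Hz. }
  assert (HG2 : 0 <= 7 * ln 2 + A + 7 * B + C) by lra.
  (* [sqrt (2 c d)] contributes [ln 2 / 2], rounded up to [ln 2]. *)
  assert (0 <= (7 * ln 2 + A + 7 * B + C) * (ln 2 / 2)) by (apply Rmult_le_pos; lra).
  lra.
Qed.

(** [D] has the coefficient [(P - R) / 2], so [R > P] makes the left side negative for large [D].
    With all quantities at their extreme values, [-7 C^2 + 88.4 B C + 1423.35 B^2] remains, which is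
    negative for [C >= 25.6 B]. *)
Lemma quadruple_log_contradiction (l nu A B C D : R) :
  0 < l -> 10 * l <= B -> 0 <= nu -> 2 * nu <= A -> A <= B -> 25.6 * B <= C ->
  21 * C + 188 * B <= D ->
  let R := 2 * (A + B + C) - 3 * nu - 9 * B in
  (4 * l + B + nu + (C - D) / 2 + (7 * l + A + 7 * B + C)) * R
  + (7 * l + A + 7 * B + C) * (5 * l + A + B + (C + D) / 2) < 0.
Proof.
  intros Hl Hl10 Hnu HA HAB HC HD R.
  assert (HB : 0 < B) by lra.
  set (P := 7 * l + A + 7 * B + C).
  assert (HP0 : 0 <= P) by (unfold P; lra).
  assert (HP : P <= C + 8.7 * B) by (unfold P; lra).
  assert (HR : 2 * C - 7 * B <= R) by (unfold R; lra).
  assert (HPR : P <= R) by (unfold R, P; lra).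
  set (T := 4 * l + B + nu + P).
  assert (HT : T <= C + 10.6 * B) by (unfold T; lra).
  set (W := 5 * l + A + B). assert (HW : W <= 2.5 * B) by (unfold W; lra).
  assert (E1 : 0 <= (D - (21 * C + 188 * B)) * (R - P)) by (apply Rmult_le_pos; lra).
  assert (E2 : 0 <= (9 * C + 83.4 * B) * (R - (2 * C - 7 * B))) by (apply Rmult_le_pos; lra).
  assert (E3 : 0 <= (C + 10.6 * B - T) * R) by (apply Rmult_le_pos; lra).
  assert (E4 : 0 <= (2.5 * B - W) * P) by (apply Rmult_le_pos; lra).
  assert (E5 : 0 <= (C + 8.7 * B - P) * (2.5 * B + 11 * C + 94 * B)) by (apply Rmult_le_pos; lra).
  assert (E6 : 0 <= (C - 25.6 * B) * (C - 25.6 * B)) by (apply Rmult_le_pos; lra).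
  assert (E7 : 0 <= (C - 25.6 * B) * B) by (apply Rmult_le_pos; lra).
  assert (E8 : 0 < B * B) by (apply Rmult_lt_0_compat; lra).
  replace (4 * l + B + nu + (C - D) / 2 + P) with (T + (C - D) / 2) by (unfold T; field).
  change (5 * l + A + B) with W.
  clearbody T W P R. nra.
Qed.

(** The quadruple is [e 0], [e 1], [e 12], [e 19]: [e 12] has to be far above [e 1] for the
    approximants to be good, and [e 19] far above [e 12] for the contradiction. *)
Lemma large_elements_lt20 (n X : Z) (S : Z -> Prop) (e : nat -> Z) :
  has_property_D n S -> n <> 0%Z -> (n * n <= X)%Z -> (1024 <= X)%Z ->
  (Z.abs n <= 400 \/ Z.abs n ^ 3 <= X)%Z ->
  (forall i, (i < 20)%nat -> S (e i) /\ (X < e i)%Z) ->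
  (forall i, (i < 19)%nat -> (e i < e (Datatypes.S i))%Z) -> False.
Proof.
  intros HS Hn HX1 HX2 HX3 He Hinc.
  assert (Hn1 := abs_le_square n).
  assert (Hnn : 1 <= IZR (Z.abs n)) by (apply IZR_le; lia).
  assert (H2 := ln_2_bounds). set (l := ln 2) in *.
  set (nu := ln (IZR (Z.abs n))).
  assert (Hnu : 0 <= nu) by (unfold nu; rewrite <- ln_1; apply Rcomplements.ln_le; lra).
  assert (Hn2 : ln (IZR (n * n)) = 2 * nu).
  { rewrite <- Z.abs_square, mult_IZR, ln_mult by lra. fold nu. ring. }
  assert (Hnsq : 0 < IZR (n * n)) by (apply IZR_lt; lia).
  assert (Hpos : forall i, (i < 20)%nat -> 0 < IZR (e i)).
  { intros i Hi. destruct (He i Hi). apply IZR_lt; lia. }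
  (* [m i] is [ln (4 e_i / n^2)], for which the gap principle reads as the Fibonacci inequality. It
     starts at [m 1] because it requires one more element below the triple. *)
  set (m := fun i => 2 * l + ln (IZR (e i)) - 2 * nu).
  assert (Hln4 : ln 4 = 2 * l).
  { replace 4 with (2 * 2) by ring. rewrite ln_mult by lra. fold l. ring. }
  assert (Hgap : forall i, (i < 17)%nat -> m (i + 1)%nat + m (i + 2)%nat <= m (i + 3)%nat).
  { intros i Hi.
    replace (i + 1)%nat with (Datatypes.S i) by lia.
    replace (i + 2)%nat with (Datatypes.S (Datatypes.S i)) by lia.
    replace (i + 3)%nat with (Datatypes.S (Datatypes.S (Datatypes.S i))) by lia.
    destruct (He i ltac:(lia)) as [Sw Xw].
    destruct (He (Datatypes.S i) ltac:(lia)) as [Sa _].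
    destruct (He (Datatypes.S (Datatypes.S i)) ltac:(lia)) as [Sb _].
    destruct (He (Datatypes.S (Datatypes.S (Datatypes.S i))) ltac:(lia)) as [Sc _].
    assert (Q := fourth_element_gap n S _ _ _ _ HS Hn Sw Sa Sb Sc ltac:(lia)
      (Hinc i ltac:(lia)) (Hinc (Datatypes.S i) ltac:(lia)) (Hinc (Datatypes.S (Datatypes.S i)) ltac:(lia))).
    apply IZR_le in Q. rewrite !mult_IZR in Q.
    assert (P1 := Hpos (Datatypes.S i) ltac:(lia)). assert (P2 := Hpos (Datatypes.S (Datatypes.S i)) ltac:(lia)).
    assert (P3 := Hpos (Datatypes.S (Datatypes.S (Datatypes.S i))) ltac:(lia)).
    rewrite mult_IZR in Hnsq, Hn2.
    apply Rcomplements.ln_le in Q; [|repeat apply Rmult_lt_0_compat; lra].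
    rewrite !(ln_mult _ (_ * _)) in Q by (try lra; apply Rmult_lt_0_compat; lra).
    rewrite (ln_mult (IZR (e (Datatypes.S i)))), Hln4, Hn2 in Q by lra.
    unfold m. lra. }
  assert (G0 := Hgap 0%nat ltac:(lia)). assert (G1 := Hgap 1%nat ltac:(lia)).
  assert (G2 := Hgap 2%nat ltac:(lia)). assert (G3 := Hgap 3%nat ltac:(lia)).
  assert (G4 := Hgap 4%nat ltac:(lia)). assert (G5 := Hgap 5%nat ltac:(lia)).
  assert (G6 := Hgap 6%nat ltac:(lia)). assert (G7 := Hgap 7%nat ltac:(lia)).
  assert (G8 := Hgap 8%nat ltac:(lia)). assert (G9 := Hgap 9%nat ltac:(lia)).
  assert (G10 := Hgap 10%nat ltac:(lia)). assert (G11 := Hgap 11%nat ltac:(lia)).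
  assert (G12 := Hgap 12%nat ltac:(lia)). assert (G13 := Hgap 13%nat ltac:(lia)).
  assert (G14 := Hgap 14%nat ltac:(lia)). assert (G15 := Hgap 15%nat ltac:(lia)).
  assert (G16 := Hgap 16%nat ltac:(lia)). clear Hgap.
  cbn [Nat.add] in *.
  set (A := ln (IZR (e 0%nat))). set (B := ln (IZR (e 1%nat))).
  destruct (He 0%nat ltac:(lia)) as [S0 X0]. destruct (He 1%nat ltac:(lia)) as [S1 _].
  destruct (He 2%nat ltac:(lia)) as [S2 _].
  assert (I0 := Hinc 0%nat ltac:(lia)). assert (I1 := Hinc 1%nat ltac:(lia)).
  assert (P0 := Hpos 0%nat ltac:(lia)). assert (P1 := Hpos 1%nat ltac:(lia)).
  assert (P2 := Hpos 2%nat ltac:(lia)).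
  assert (HAn : 2 * nu <= A).
  { rewrite <- Hn2. apply Rcomplements.ln_le; [exact Hnsq | apply IZR_le; lia]. }
  assert (HAB : A <= B) by (apply Rcomplements.ln_le; [exact P0 | apply IZR_le; lia]).
  assert (HBl : 10 * l <= B).
  { replace (10 * l) with (ln (2 ^ 10)) by (rewrite ln_pow by lra; simpl INR; fold l; ring).
    apply Rcomplements.ln_le; [apply pow_lt; lra|].
    replace (2 ^ 10) with 1024 by ring. apply IZR_le; lia. }
  (* If [nu <= 9 ln 2], then [2 nu - 2 ln 2 <= 16 nu / 9 <= 8 B / 9], hence the ninth. In the other
     case [3 nu <= B] even gives a third. *)
  assert (Hm1 : B / 9 <= m 1%nat /\ 2 * B / 9 <= m 2%nat).
  { unfold m. fold B. destruct HX3 as [Hs | Hl].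
    - assert (Hnu9 : nu <= 9 * l).
      { replace (9 * l) with (ln (2 ^ 9)) by (rewrite ln_pow by lra; simpl INR; fold l; ring).
        apply Rcomplements.ln_le; [lra|]. replace (2 ^ 9) with 512 by ring. apply IZR_le; lia. }
      split; [lra|].
      assert (Q := third_element_gap n S _ _ _ HS Hn S0 S1 S2 ltac:(lia) I0 I1).
      apply IZR_le in Q. rewrite plus_IZR, mult_IZR in Q.
      (* AM-GM: [4 (a^3 b)^(1/4) <= 3 a + b] *)
      assert (HQ : 2 ^ 8 * (IZR (e 0%nat) ^ 3 * IZR (e 1%nat)) <= IZR (e 2%nat) ^ 4).
      { apply Rle_trans with ((3 * IZR (e 0%nat) + IZR (e 1%nat)) ^ 4).
        - set (a := IZR (e 0%nat)) in *. set (b := IZR (e 1%nat)) in *.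
          assert (0 <= (b - a) ^ 2 * (b ^ 2 + 14 * a * b + 81 * a ^ 2)).
          { apply Rmult_le_pos; [apply pow2_ge_0|]. nra. }
          lra.
        - apply pow_incr; lra. }
      assert (HP3 := pow_lt _ 3 P0).
      apply Rcomplements.ln_le in HQ.
      + rewrite !ln_mult, !ln_pow in HQ; try lra; try (apply Rmult_lt_0_compat; lra).
        fold A B l in HQ. simpl INR in HQ. lra.
      + apply Rmult_lt_0_compat; [lra|apply Rmult_lt_0_compat; lra].
    - assert (H3 : 3 * nu <= B).
      { replace (3 * nu) with (ln (IZR (Z.abs n) ^ 3)) by (rewrite ln_pow by lra; simpl INR; fold nu; ring).
        apply Rcomplements.ln_le; [apply pow_lt; lra|].
        rewrite pow_IZR. apply IZR_le. simpl Z.of_nat. lia. }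
      assert (B <= ln (IZR (e 2%nat))) by (apply Rcomplements.ln_le; [exact P1 | apply IZR_le; lia]).
      lra. }
  destruct Hm1 as [Hm1 Hm2].
  set (C := ln (IZR (e 12%nat))). set (D := ln (IZR (e 19%nat))).
  assert (HmC : m 12%nat = 2 * l + C - 2 * nu) by reflexivity.
  assert (HmD : m 19%nat = 2 * l + D - 2 * nu) by reflexivity.
  (* The coefficients are Fibonacci numbers. [(55 + 178) / 9] exceeds 25.6 by enough to absorb
     [2 ln 2 <= B / 5], and [13 * 16 B] less [40 nu <= 20 B] leaves [188 B]. *)
  assert (K11 : 34 * m 1%nat + 55 * m 2%nat <= m 11%nat) by lra.
  assert (K12 : 55 * m 1%nat + 89 * m 2%nat <= m 12%nat) by lra.
  assert (K19 : 21 * m 12%nat + 13 * m 11%nat <= m 19%nat) by lra.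
  assert (HC : 25.6 * B <= C) by lra.
  assert (HD : 21 * C + 188 * B <= D) by lra.
  clear G0 G1 G2 G3 G4 G5 G6 G7 G8 G9 G10 G11 G12 G13 G14 G15 G16.
  assert (Hlt : forall i j, (i < j)%nat -> (j < 20)%nat -> (e i < e j)%Z).
  { intros i j Hij Hj. induction j as [|j IH]; [lia|].
    assert (Hj' := Hinc j ltac:(lia)).
    destruct (Nat.eq_dec i j) as [->|]; [exact Hj'|]. specialize (IH ltac:(lia) ltac:(lia)). lia. }
  destruct (He 12%nat ltac:(lia)) as [S12 _]. destruct (He 19%nat ltac:(lia)) as [S19 _].
  assert (P12 := Hpos 12%nat ltac:(lia)).
  assert (Hnb : (Z.abs n * e 1%nat <= e 12%nat)%Z).
  { apply le_IZR. rewrite mult_IZR.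
    rewrite <- (exp_ln (IZR (e 12%nat))) by exact P12.
    rewrite <- (exp_ln (IZR (Z.abs n) * IZR (e 1%nat))) by (apply Rmult_lt_0_compat; lra).
    rewrite ln_mult by lra. fold nu B C. left. apply exp_increasing. lra. }
  assert (Q := quadruple_log_inequality n S (e 0%nat) (e 1%nat) (e 12%nat) (e 19%nat) HS Hn S0 S1 S12 S19
    ltac:(lia) I0 (Hlt 1%nat 12%nat ltac:(lia) ltac:(lia)) (Hlt 12%nat 19%nat ltac:(lia) ltac:(lia)) Hnb).
  cbv zeta in Q. fold l A B C D nu in Q.
  specialize (Q ltac:(lra)).
  assert (Q2 := quadruple_log_contradiction l nu A B C D ltac:(lra) HBl Hnu HAn HAB HC HD).
  cbv zeta in Q2. lra.
Qed.

(** * Larger sieve *)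

Open Scope Z_scope.

Fixpoint equal_pairs (l : list Z) : nat :=
  match l with
  | [] => 0%nat
  | x :: t => (count_occ Z.eq_dec t x + equal_pairs t)%nat
  end.

Definition residues (p : Z) (l : list Z) : list Z := map (fun x => x mod p) l.

Definition sumZ {A} (f : A -> Z) (l : list A) : Z := fold_right (fun x s => f x + s) 0 l.

Lemma sumZ_update (K : list Z) (f g : Z -> Z) (x : Z) (e : Z) :
  NoDup K -> In x K -> (forall c, c <> x -> f c = g c) -> f x = g x + e ->
  sumZ f K = sumZ g K + e.
Proof.
  intros HK Hx Hne Heq. induction HK as [|c K Hc HK IH]; [destruct Hx|]. simpl.
  destruct Hx as [->|Hx].
  - assert (E : sumZ f K = sumZ g K).
    { clear IH HK. induction K as [|d K IH]; [reflexivity|]. simpl.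
      rewrite IH by (intros H; apply Hc; now right).
      rewrite Hne; [reflexivity|]. intros ->. apply Hc; now left. }
    lia.
  - rewrite IH by exact Hx. rewrite Hne; [lia|]. intros ->. contradiction.
Qed.

Lemma sumZ_count (K l : list Z) : NoDup K -> incl l K ->
  sumZ (fun c => Z.of_nat (count_occ Z.eq_dec l c)) K = Z.of_nat (length l) /\
  sumZ (fun c => Z.of_nat (count_occ Z.eq_dec l c) * Z.of_nat (count_occ Z.eq_dec l c)) K
  = 2 * Z.of_nat (equal_pairs l) + Z.of_nat (length l).
Proof.
  intros HK. induction l as [|x t IH]; intros Hl.
  - clear HK Hl. simpl. split; induction K as [|c K IH]; simpl; auto.
  - destruct IH as [I1 I2]; [intros y Hy; apply Hl; now right|].
    assert (Hx : In x K) by (apply Hl; now left).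
    split.
    + rewrite (sumZ_update K _ (fun c => Z.of_nat (count_occ Z.eq_dec t c)) x 1); try assumption.
      * rewrite I1. simpl length. lia.
      * intros c Hc. simpl. destruct (Z.eq_dec x c); [congruence|reflexivity].
      * simpl. destruct (Z.eq_dec x x); [lia|congruence].
    + rewrite (sumZ_update K _ (fun c => Z.of_nat (count_occ Z.eq_dec t c) * Z.of_nat (count_occ Z.eq_dec t c))
        x (2 * Z.of_nat (count_occ Z.eq_dec t x) + 1)); try assumption.
      * rewrite I2. cbn [length equal_pairs]. lia.
      * intros c Hc. simpl. destruct (Z.eq_dec x c); [congruence|reflexivity].
      * cbn [count_occ]. destruct (Z.eq_dec x x); [|congruence].
        rewrite Nat2Z.inj_succ. unfold Z.succ. ring.
Qed.

(* Sum [(m_c - k) (m_c - k - 1) >= 0] over the classes [c], where [m_c] is the size of [c]. *)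
Lemma equal_pairs_lower_bound (l : list Z) (nu k : Z) :
  0 <= k -> Z.of_nat (length (nodup Z.eq_dec l)) <= nu ->
  2 * k * Z.of_nat (length l) - nu * (k * (k + 1)) <= 2 * Z.of_nat (equal_pairs l).
Proof.
  intros Hk Hnu.
  set (K := nodup Z.eq_dec l) in *.
  assert (HK : NoDup K) by apply NoDup_nodup.
  destruct (sumZ_count K l HK) as [C1 C2]; [intros x Hx; now apply nodup_In|].
  set (cnt := fun c => Z.of_nat (count_occ Z.eq_dec l c)) in *.
  change (sumZ (fun c => cnt c * cnt c) K = 2 * Z.of_nat (equal_pairs l) + Z.of_nat (length l)) in C2.
  assert (H : forall K', (2 * k + 1) * sumZ cnt K' - Z.of_nat (length K') * (k * (k + 1))
     <= sumZ (fun c => cnt c * cnt c) K').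
  { induction K' as [|c K' IH]; [simpl; lia|].
    change (sumZ cnt (c :: K')) with (cnt c + sumZ cnt K').
    change (sumZ (fun c => cnt c * cnt c) (c :: K')) with (cnt c * cnt c + sumZ (fun c => cnt c * cnt c) K').
    cbn [length]. rewrite Nat2Z.inj_succ. unfold Z.succ. assert (0 <= (cnt c - k) * (cnt c - k - 1)).
    { destruct (Z_le_gt_dec (cnt c) k); [apply Z.mul_nonpos_nonpos | apply Z.mul_nonneg_nonneg]; lia. }
    lia. }
  specialize (H K). rewrite C1, C2 in H.
  assert (Z.of_nat (length K) * (k * (k + 1)) <= nu * (k * (k + 1))) by (apply Z.mul_le_mono_nonneg_r; nia).
  lia.
Qed.

Open Scope R_scope.

Definition sumR {A} (f : A -> R) (l : list A) : R := fold_right (fun x s => f x + s) 0 l.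

Lemma sumR_ext {A} (f g : A -> R) (l : list A) :
  (forall x, In x l -> f x = g x) -> sumR f l = sumR g l.
Proof.
  induction l as [|x l IH]; simpl; intros H; [reflexivity|].
  rewrite H, IH by auto. reflexivity.
Qed.

Lemma sumR_le {A} (f g : A -> R) (l : list A) :
  (forall x, In x l -> f x <= g x) -> sumR f l <= sumR g l.
Proof.
  induction l as [|x l IH]; simpl; intros H; [lra|].
  apply Rplus_le_compat; [apply H; now left | apply IH; intros; apply H; now right].
Qed.

Lemma sumR_plus {A} (f g : A -> R) (l : list A) :
  sumR (fun x => f x + g x) l = sumR f l + sumR g l.
Proof. induction l as [|x l IH]; simpl; [ring|rewrite IH; ring]. Qed.

Lemma sumR_scal {A} (c : R) (f : A -> R) (l : list A) : sumR (fun x => c * f x) l = c * sumR f l.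
Proof. induction l as [|x l IH]; simpl; [ring|rewrite IH; ring]. Qed.

(** The product of the distinct primes dividing [d] divides [d]; each prime found is divided out. *)
Lemma prime_log_sum (P : list Z) (d : Z) :
  NoDup P -> (forall p, In p P -> prime p) -> (1 <= d)%Z ->
  sumR (fun p => if (d mod p =? 0)%Z then ln (IZR p) else 0) P <= ln (IZR d).
Proof.
  intros HP. revert d. induction HP as [|p P Hp HP IH]; intros d Hprime Hd.
  - simpl. rewrite <- ln_1. apply Rcomplements.ln_le; [lra | apply IZR_le; exact Hd].
  - simpl. assert (Pp : prime p) by (apply Hprime; now left).
    assert (Hp1 := prime_ge_2 p Pp).
    destruct (Z.eqb_spec (d mod p) 0) as [E|E].
    + apply Z.mod_divide in E; [|lia]. destruct E as [d' ->].
      assert (Hd' : (1 <= d')%Z) by nia.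
      rewrite mult_IZR, ln_mult by (apply IZR_lt; lia).
      assert (E : sumR (fun q => if (d' * p mod q =? 0)%Z then ln (IZR q) else 0) P
                  = sumR (fun q => if (d' mod q =? 0)%Z then ln (IZR q) else 0) P).
      { apply sumR_ext. intros q Hq.
        assert (Pq : prime q) by (apply Hprime; now right).
        assert (Hq1 := prime_ge_2 q Pq).
        replace (d' * p mod q =? 0)%Z with (d' mod q =? 0)%Z; [reflexivity|].
        apply Bool.eq_true_iff_eq. rewrite !Z.eqb_eq, !Z.mod_divide by lia.
        split; intros H; [now apply Z.divide_mul_l|].
        destruct (prime_mult q Pq _ _ H) as [H1|H1]; [exact H1|].
        apply prime_div_prime in H1; [subst; contradiction | assumption | assumption]. }
      rewrite E. assert (H := IH d' ltac:(intros; apply Hprime; now right) Hd'). lra.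
    + assert (H := IH d ltac:(intros; apply Hprime; now right) Hd). lra.
Qed.

Lemma count_occ_mod (p x : Z) (t : list Z) :
  (0 < p)%Z ->
  INR (count_occ Z.eq_dec (residues p t) (x mod p)%Z)
  = sumR (fun y => if ((x - y) mod p =? 0)%Z then 1 else 0) t.
Proof.
  intros Hp. induction t as [|y t IH]; [reflexivity|]. simpl.
  assert (Hm : (y mod p = x mod p)%Z <-> ((x - y) mod p = 0)%Z).
  { split; intros H.
    - rewrite Zminus_mod, <- H, Z.sub_diag. now apply Z.mod_0_l; lia.
    - apply Z.mod_divide in H; [|lia]. destruct H as [k Hk].
      replace x with (y + k * p)%Z by lia. now rewrite Z.mod_add by lia. }
  destruct (Z.eq_dec (y mod p) (x mod p)) as [E|E]; destruct (Z.eqb_spec ((x - y) mod p) 0) as [E'|E'];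
    try tauto; rewrite ?S_INR, IH; ring.
Qed.

(** For distinct elements, the logarithm of the absolute value of their Vandermonde determinant. *)
Fixpoint log_differences (l : list Z) : R :=
  match l with
  | [] => 0
  | x :: t => sumR (fun y => ln (IZR (Z.abs (x - y)))) t + log_differences t
  end.

(** Exchange the summations: a pair [x, y] collects [ln p] for the primes [p] dividing [x - y], in
    total at most [ln |x - y|]. *)
Lemma larger_sieve_log (P L : list Z) :
  NoDup P -> (forall p, In p P -> prime p) -> NoDup L ->
  sumR (fun p => ln (IZR p) * INR (equal_pairs (residues p L))) P <= log_differences L.
Proof.
  intros HP Hprime HL. induction HL as [|x t Hx HL IH]; [simpl; induction P; simpl; [lra|]|].
  - inversion HP; subst. specialize (IHP H2 ltac:(intros; apply Hprime; now right)). lra.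
  - simpl.
    apply Rle_trans with (sumR (fun p => sumR (fun y => if ((x - y) mod p =? 0)%Z then ln (IZR p) else 0) t
        + ln (IZR p) * INR (equal_pairs (residues p t))) P).
    { right. apply sumR_ext. intros p Hp.
      assert (Hp1 := prime_ge_2 p (Hprime p Hp)).
      rewrite plus_INR, Rmult_plus_distr_l. f_equal.
      fold (residues p t). rewrite count_occ_mod by lia. rewrite <- sumR_scal. apply sumR_ext.
      intros y _. destruct (_ =? _)%Z; ring. }
    rewrite sumR_plus. apply Rplus_le_compat; [|exact IH].
    clear IH HL. induction t as [|y t IH].
    + simpl. clear Hprime. induction P; simpl; [lra|]. inversion HP; subst. specialize (IHP H2). lra.
    + simpl. rewrite sumR_plus. apply Rplus_le_compat.
      * apply Rle_trans with (sumR (fun p => if (Z.abs (x - y) mod p =? 0)%Z then ln (IZR p) else 0) P).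
        -- right. apply sumR_ext. intros p Hp.
           assert (Hp1 := prime_ge_2 p (Hprime p Hp)).
           replace ((x - y) mod p =? 0)%Z with (Z.abs (x - y) mod p =? 0)%Z; [reflexivity|].
           apply Bool.eq_true_iff_eq. rewrite !Z.eqb_eq, !Z.mod_divide by lia. apply Z.divide_abs_r.
        -- apply prime_log_sum; [assumption | assumption|].
           assert (x <> y) by (intros ->; apply Hx; now left). lia.
      * apply IH. intros H; apply Hx; now right.
Qed.

Lemma ln_le_tangent (d D : R) : 0 < d -> 0 < D -> ln d <= ln D + (d / D - 1).
Proof.
  intros Hd HD. assert (Hq : 0 < d / D) by (apply Rdiv_lt_0_compat; lra).
  replace (ln d) with (ln D + ln (d / D)) by (rewrite Rcomplements.ln_div by lra; ring).
  assert (H := exp_ineq1_le (ln (d / D))). rewrite exp_ln in H by exact Hq. lra.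
Qed.

(* Concavity of [ln] at the bound [m X / (2 (m - 1))] for the mean difference, which follows from
   [X |x - y| <= x (X - y) + y (X - x)] on [[0, X]]. *)
Lemma log_differences_bound (L : list Z) (X : R) :
  NoDup L -> 0 < X -> (forall x, In x L -> 0 <= IZR x <= X) -> (2 <= length L)%nat ->
  log_differences L
  <= INR (length L) * (INR (length L) - 1) / 2 * ln (X * INR (length L) / (2 * (INR (length L) - 1))).
Proof.
  intros HL HX Hb Hm.
  set (m := INR (length L)).
  assert (Hm2 : 2 <= m) by (unfold m; apply (le_INR 2); exact Hm).
  set (D := X * m / (2 * (m - 1))).
  assert (HD : 0 < D) by (apply Rdiv_lt_0_compat; nra).
  (* The tangent bounds at [D], summed. With [s] the sum of the [k] elements, [s (k X - s)] is the
     sum of [x (X - y) + y (X - x)] over all pairs plus the nonnegative terms [x (X - x)]. *)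
  assert (H : forall L', NoDup L' -> (forall x, In x L' -> 0 <= IZR x <= X) ->
    log_differences L' <= INR (length L') * (INR (length L') - 1) / 2 * (ln D - 1)
      + (sumR IZR L' * (INR (length L') * X - sumR IZR L')) / (X * D)).
  { intros L' HL'. induction HL' as [|x t Hx HL' IH]; intros Hb'.
    - simpl. right. field. lra.
    - specialize (IH ltac:(intros; apply Hb'; now right)).
      assert (Hx' := Hb' x (or_introl eq_refl)).
      assert (S1 : sumR (fun y => ln (IZR (Z.abs (x - y)))) t
        <= INR (length t) * (ln D - 1) + (IZR x * (INR (length t) * X - sumR IZR t) + sumR IZR t * (X - IZR x)) / (X * D)).
      { clear IH HL'. induction t as [|y t IHt]; [simpl; right; field; lra|].
        assert (Hy := Hb' y (or_intror (or_introl eq_refl))).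
        specialize (IHt ltac:(intros H; apply Hx; now right)
          ltac:(intros z [->|Hz]; [exact Hx'|apply Hb'; right; now right])).
        simpl length. rewrite S_INR. simpl sumR.
        assert (Hne : x <> y) by (intros ->; apply Hx; now left).
        assert (Hd : 0 < IZR (Z.abs (x - y))) by (apply IZR_lt; lia).
        assert (T := ln_le_tangent _ D Hd HD).
        assert (Hxy : IZR (Z.abs (x - y)) * X <= IZR x * (X - IZR y) + IZR y * (X - IZR x)).
        { destruct (Z.abs_eq_or_opp (x - y)) as [-> | ->]; rewrite ?opp_IZR, minus_IZR; nra. }
        assert (Hxy2 : IZR (Z.abs (x - y)) / D <= (IZR x * (X - IZR y) + IZR y * (X - IZR x)) / (X * D)).
        { apply (Rmult_le_reg_r (X * D)); [nra|].
          replace (IZR (Z.abs (x - y)) / D * (X * D)) with (IZR (Z.abs (x - y)) * X) by (field; lra).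
          replace ((IZR x * (X - IZR y) + IZR y * (X - IZR x)) / (X * D) * (X * D))
            with (IZR x * (X - IZR y) + IZR y * (X - IZR x)) by (field; lra). exact Hxy. }
        replace ((IZR x * ((INR (length t) + 1) * X - (IZR y + sumR IZR t)) + (IZR y + sumR IZR t) * (X - IZR x)) / (X * D))
          with ((IZR x * (INR (length t) * X - sumR IZR t) + sumR IZR t * (X - IZR x)) / (X * D)
            + (IZR x * (X - IZR y) + IZR y * (X - IZR x)) / (X * D)) by (field; lra).
        lra. }
      simpl log_differences. simpl length. rewrite S_INR. simpl sumR.
      set (k := INR (length t)) in *. set (s := sumR IZR t) in *.
      replace ((IZR x + s) * ((k + 1) * X - (IZR x + s)) / (X * D))
        with ((IZR x * (k * X - s) + s * (X - IZR x)) / (X * D) + s * (k * X - s) / (X * D)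
              + IZR x * (X - IZR x) / (X * D)) by (field; lra).
      assert (0 <= IZR x * (X - IZR x) / (X * D)).
      { apply Rmult_le_pos; [nra|]. apply Rlt_le, Rinv_0_lt_compat; nra. }
      lra. }
  eapply Rle_trans; [exact (H L HL Hb)|]. fold m D.
  (* [s (m X - s) <= (m X / 2)^2], and [D] is chosen so that the corrections to [ln D] then
     cancel. *)
  assert (E : sumR IZR L * (m * X - sumR IZR L) / (X * D) <= m * (m - 1) / 2).
  { apply (Rmult_le_reg_r (X * D)); [nra|].
    replace (sumR IZR L * (m * X - sumR IZR L) / (X * D) * (X * D)) with (sumR IZR L * (m * X - sumR IZR L)) by (field; lra).
    replace (m * (m - 1) / 2 * (X * D)) with ((m * X / 2) ^ 2) by (unfold D; field; lra).
    assert (0 <= (m * X / 2 - sumR IZR L) ^ 2) by apply pow2_ge_0. lra. }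
  lra.
Qed.

(** * Cliques of residues modulo small primes *)

Open Scope nat_scope.

Fixpoint split_indep {V} (adj : V -> V -> bool) (I P : list V) : list V * list V :=
  match P with
  | [] => (I, [])
  | v :: P' =>
      if existsb (adj v) I
      then let (J, R) := split_indep adj I P' in (J, v :: R)
      else split_indep adj (v :: I) P'
  end.

Fixpoint split_colours {V} (adj : V -> V -> bool) (t : nat) (B P : list V) : list V * list V :=
  match t with
  | O => (B, P)
  | S t' => let (J, R) := split_indep adj [] P in split_colours adj t' (J ++ B) R
  end.

(* [clique_free adj t P] implies that cliques in [P] have at most [t] vertices: such a clique has at
   most [t] vertices in the first [t] greedy colour classes, so a larger one contains a vertex
   outside them. *)
Fixpoint clique_free {V} (adj : V -> V -> bool) (t : nat) (P : list V) : bool :=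
  let (B, R) := split_colours adj t [] P in
  (fix branch (R : list V) : bool :=
     match R with
     | [] => true
     | v :: R' =>
         match t with
         | O => false
         | S t' => clique_free adj t' (filter (adj v) (R' ++ B)) && branch R'
         end
     end) R.

Definition is_clique {V} (adj : V -> V -> bool) (K : list V) : Prop :=
  NoDup K /\ forall u v, In u K -> In v K -> u <> v -> adj u v = true.

Definition clique_bound {V} (adj : V -> V -> bool) (t : nat) (P : list V) : Prop :=
  forall K, is_clique adj K -> incl K P -> length K <= t.

(** Non-adjacency in one direction already keeps two vertices out of a common clique, so [adj] may
    be asymmetric. *)
Definition independent {V} (adj : V -> V -> bool) (I : list V) : Prop :=
  forall u v, In u I -> In v I -> u <> v -> adj u v && adj v u = false.

Lemma is_clique_remove {V} (dec : forall u v : V, {u = v} + {u <> v}) adj (K : list V) (v : V) :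
  is_clique adj K -> is_clique adj (remove dec v K).
Proof.
  intros [HK Ha]. split.
  - clear Ha. induction HK as [|x K Hx HK IH]; simpl; [constructor|].
    destruct (dec v x); [exact IH|]. constructor; [|exact IH].
    intros H. apply in_remove in H. tauto.
  - intros u w Hu Hw. apply in_remove in Hu. apply in_remove in Hw. apply Ha; tauto.
Qed.

Lemma length_remove_NoDup {V} (dec : forall u v : V, {u = v} + {u <> v}) (K : list V) (v : V) :
  NoDup K -> length K <= S (length (remove dec v K)).
Proof.
  induction 1 as [|x K Hx HK IH]; simpl; [lia|].
  destruct (dec v x) as [->|]; simpl; [|lia]. rewrite notin_remove by exact Hx. lia.
Qed.

Lemma split_indep_spec {V} (adj : V -> V -> bool) (P I : list V) :
  independent adj I ->
  let (J, R) := split_indep adj I P in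
  independent adj J /\ incl I J /\ incl P (J ++ R).
Proof.
  revert I; induction P as [|v P IH]; intros I HI; simpl.
  - split; [exact HI|]. split; [apply incl_refl | intros x []].
  - destruct (existsb (adj v) I) eqn:E.
    + specialize (IH I HI). destruct (split_indep adj I P) as [J R].
      destruct IH as (H1 & H2 & H3). split; [exact H1|]. split; [exact H2|].
      intros x [->|Hx]; apply in_or_app; [right; now left|].
      specialize (H3 x Hx). apply in_app_or in H3. destruct H3; [now left | right; now right].
    + assert (HI' : independent adj (v :: I)).
      { assert (Hv : forall u, In u I -> adj v u = false).
        { intros u Hu. destruct (adj v u) eqn:Ev; [|reflexivity].
          rewrite <- E. symmetry. apply existsb_exists. now exists u. }
        intros u w [->|Hu] [->|Hw] Huw.
        - congruence.
        - now rewrite (Hv _ Hw).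
        - rewrite (Hv _ Hu). apply andb_false_r.
        - now apply HI. }
      specialize (IH (v :: I) HI'). destruct (split_indep adj (v :: I) P) as [J R].
      destruct IH as (H1 & H2 & H3). split; [exact H1|]. split.
      * intros x Hx. apply H2. now right.
      * intros x [->|Hx]; [apply in_or_app; left; apply H2; now left | now apply H3].
Qed.

(** A clique meets an independent set in at most one vertex. *)
Lemma clique_bound_app_independent {V} (dec : forall u v : V, {u = v} + {u <> v}) adj s (J B : list V) :
  independent adj J -> clique_bound adj s B -> clique_bound adj (S s) (J ++ B).
Proof.
  intros HJ HB K HK HKJ.
  destruct (existsb (fun u => if in_dec dec u J then true else false) K) eqn:E.
  - apply existsb_exists in E. destruct E as (u & Hu & HuJ).
    destruct (in_dec dec u J) as [HuJ'|]; [|discriminate].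
    apply Nat.le_trans with (S (length (remove dec u K))); [apply length_remove_NoDup, HK|].
    apply le_n_S, HB; [now apply is_clique_remove|].
    intros x Hx. apply in_remove in Hx. destruct Hx as [HxK Hxu].
    specialize (HKJ x HxK). apply in_app_or in HKJ. destruct HKJ as [HxJ|]; [|assumption].
    specialize (HJ x u HxJ HuJ' Hxu). destruct HK as [_ Ha].
    rewrite (Ha x u), (Ha u x) in HJ by auto. discriminate.
  - apply Nat.le_trans with s; [|lia]. apply HB; [exact HK|].
    intros x Hx. specialize (HKJ x Hx). apply in_app_or in HKJ. destruct HKJ as [HxJ|]; [|assumption].
    exfalso. assert (H : existsb (fun u => if in_dec dec u J then true else false) K = true).
    { apply existsb_exists. exists x. split; [exact Hx|]. destruct (in_dec dec x J); [reflexivity|contradiction]. }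
    congruence.
Qed.

Lemma split_colours_spec {V} (dec : forall u v : V, {u = v} + {u <> v}) (adj : V -> V -> bool) (t s : nat) (B P : list V) :
  clique_bound adj s B ->
  let (B', R) := split_colours adj t B P in clique_bound adj (t + s) B' /\ incl (P ++ B) (R ++ B').
Proof.
  revert s B P; induction t as [|t IH]; intros s B P HB; simpl.
  - split; [exact HB | apply incl_refl].
  - assert (H := split_indep_spec adj P []).
    destruct (split_indep adj [] P) as [J R].
    destruct H as (H1 & _ & H3); [intros u v []|].
    specialize (IH (S s) (J ++ B) R (clique_bound_app_independent dec adj s J B H1 HB)).
    destruct (split_colours adj t (J ++ B) R) as [B' R'].
    destruct IH as [I1 I2]. split; [replace (S (t + s)) with (t + S s) by lia; exact I1|].
    intros x Hx. apply I2. apply in_app_or in Hx. destruct Hx as [Hx|Hx].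
    + specialize (H3 x Hx). apply in_app_or in H3. rewrite !in_app_iff. tauto.
    + rewrite !in_app_iff. tauto.
Qed.

Lemma clique_free_sound {V} (dec : forall u v : V, {u = v} + {u <> v}) (adj : V -> V -> bool) (t : nat) (P : list V) :
  clique_free adj t P = true -> clique_bound adj t P.
Proof.
  revert P; induction t as [|t IH]; intros P H.
  - simpl in H. destruct P; [|discriminate]. intros K _ HK.
    destruct K as [|x K]; [simpl; lia|]. destruct (HK x (or_introl eq_refl)).
  - cbn [clique_free] in H.
    assert (Hs := split_colours_spec dec adj (S t) 0 [] P).
    destruct (split_colours adj (S t) [] P) as [B R].
    destruct Hs as [H1 H2].
    { intros K _ HK. destruct K as [|x K]; [simpl; lia|]. destruct (HK x (or_introl eq_refl)). }
    rewrite Nat.add_0_r in H1. rewrite app_nil_r in H2.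
    assert (G : clique_bound adj (S t) (R ++ B)).
    { clear H2. induction R as [|v R IHR]; [exact H1|].
      apply andb_true_iff in H. destruct H as [Ha Hb]. specialize (IHR Hb).
      intros K HK HKR. destruct (in_dec dec v K) as [Hv|Hv].
      - apply Nat.le_trans with (S (length (remove dec v K))); [apply length_remove_NoDup, HK|].
        apply le_n_S, (IH _ Ha); [now apply is_clique_remove|].
        intros x Hx. apply in_remove in Hx. destruct Hx as [HxK Hxv].
        apply filter_In. split.
        + specialize (HKR x HxK). destruct HKR as [->|]; [congruence|assumption].
        + apply HK; auto.
      - apply IHR; [exact HK|]. intros x Hx. specialize (HKR x Hx).
        destruct HKR as [->|]; [contradiction|assumption]. }
    intros K HK HKP. apply G; [exact HK|]. intros x Hx. apply H2, HKP, Hx.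
Qed.

Fixpoint tabulate {A} (f : positive -> A) (l : list positive) : PositiveMap.t A :=
  match l with
  | [] => PositiveMap.empty A
  | k :: l' => PositiveMap.add k (f k) (tabulate f l')
  end.

Lemma find_tabulate {A} (f : positive -> A) (l : list positive) (k : positive) :
  In k l -> PositiveMap.find k (tabulate f l) = Some (f k).
Proof.
  induction l as [|x l IH]; intros Hk; [destruct Hk|]. simpl.
  destruct (Pos.eq_dec k x) as [->|Hne].
  - apply PositiveMap.gss.
  - rewrite PositiveMap.gso by exact Hne. apply IH. destruct Hk; [congruence|assumption].
Qed.

Open Scope Z_scope.

(* The positive number [p] stands for the residue [0]. *)
Definition vertices (p : positive) : list positive := map Pos.of_nat (seq 1 (Pos.to_nat p)).

Definition vertex (p : positive) (r : Z) : positive :=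
  match r with Zpos v => v | _ => p end.

Definition square_residues (p : positive) : list positive :=
  map (fun u => vertex p ((Zpos u * Zpos u) mod Zpos p)) (vertices p).

(** Squares and neighbourhoods are tabulated in tries, and the row of [u] is found once for all [v],
    to keep the clique search fast. *)
Definition residue_adjacency (p : positive) (n0 : Z) : positive -> positive -> bool :=
  let sq := tabulate (fun _ => tt) (square_residues p) in
  let M := tabulate (fun u => tabulate (fun _ => tt)
             (filter (fun v => PositiveMap.mem (vertex p ((Zpos u * Zpos v + n0) mod Zpos p)) sq)
                (vertices p))) (vertices p) in
  fun u => match PositiveMap.find u M with
           | Some N => fun v => PositiveMap.mem v N
           | None => fun _ => false
           end.

Definition residue_clique_free (p : positive) (n0 : Z) (t : nat) : bool :=
  let adj := residue_adjacency p n0 in clique_free adj t (vertices p).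

Lemma vertex_spec (p : positive) (r : Z) : 0 <= r < Zpos p ->
  In (vertex p r) (vertices p) /\ Zpos (vertex p r) mod Zpos p = r.
Proof.
  intros Hr. unfold vertices. rewrite in_map_iff.
  destruct r as [|v|v]; simpl vertex; [| |lia].
  - split; [|apply Z_mod_same_full].
    exists (Pos.to_nat p). split; [apply Pos2Nat.id|]. apply in_seq. lia.
  - split; [|apply Z.mod_small; exact Hr].
    exists (Pos.to_nat v). split; [apply Pos2Nat.id|]. apply in_seq. lia.
Qed.

Lemma residue_adjacency_square (p : positive) (n0 w : Z) (u v : positive) :
  In u (vertices p) -> In v (vertices p) ->
  (Zpos u * Zpos v + n0) mod Zpos p = (w * w) mod Zpos p ->
  residue_adjacency p n0 u v = true.
Proof.
  intros Hu Hv E. unfold residue_adjacency. rewrite find_tabulate by exact Hu.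
  rewrite PositiveMap.mem_find, find_tabulate; [reflexivity|].
  apply filter_In. split; [exact Hv|]. rewrite E.
  destruct (vertex_spec p (w mod Zpos p)) as [W1 W2]; [apply Z.mod_pos_bound; lia|].
  rewrite PositiveMap.mem_find, find_tabulate; [reflexivity|].
  unfold square_residues. apply in_map_iff. exists (vertex p (w mod Zpos p)).
  split; [|exact W1]. f_equal. rewrite Z.mul_mod, W2, <- Z.mul_mod by lia. reflexivity.
Qed.

(* Multiplying all elements by [mu] turns the condition [x y + n] square into [x y + n0] square. *)
Lemma residue_clique_bound (p : positive) (n n0 lam mu : Z) (t : nat) (L : list Z) :
  residue_clique_free p n0 t = true ->
  n mod Zpos p = (lam * lam * n0) mod Zpos p -> (lam * mu) mod Zpos p = 1 mod Zpos p ->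
  (forall x y, In x L -> In y L -> x <> y -> exists k, x * y + n = k * k) ->
  (length (nodup Z.eq_dec (residues (Zpos p) L)) <= t)%nat.
Proof.
  intros Hfree Hn Hmu HL.
  set (q := Zpos p) in *. assert (Hq : 0 < q) by reflexivity.
  set (R := nodup Z.eq_dec (residues q L)).
  set (f := fun r => vertex p ((mu * r) mod q)).
  assert (HR : forall r, In r R -> exists x, In x L /\ r = x mod q).
  { intros r Hr. apply nodup_In, in_map_iff in Hr. destruct Hr as (x & <- & Hx). eauto. }
  assert (Hf : forall r, In (f r) (vertices p) /\ Zpos (f r) mod q = (mu * r) mod q).
  { intros r. apply vertex_spec. apply Z.mod_pos_bound; exact Hq. }
  assert (Hcong : forall a b, a mod q = b mod q <-> (q | a - b)).
  { intros a b. split; intros H.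
    - apply Z.mod_divide; [lia|]. rewrite Zminus_mod, H, Z.sub_diag. apply Z.mod_0_l; lia.
    - destruct H as [k Hk]. replace a with (b + k * q) by lia. apply Z.mod_add; lia. }
  assert (Hinj : forall r r', In r R -> In r' R -> f r = f r' -> r = r').
  { intros r r' Hr Hr' E.
    destruct (HR r Hr) as (x & _ & ->). destruct (HR r' Hr') as (y & _ & ->).
    assert (E1 : (mu * (x mod q)) mod q = (mu * (y mod q)) mod q).
    { rewrite <- (proj2 (Hf (x mod q))), <- (proj2 (Hf (y mod q))), E. reflexivity. }
    rewrite !Z.mul_mod_idemp_r in E1 by lia.
    apply Hcong in E1. apply Hcong in Hmu. apply Hcong.
    destruct E1 as [k1 E1]. destruct Hmu as [k2 E2].
    exists (lam * k1 - k2 * (x - y)). 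
    replace ((lam * k1 - k2 * (x - y)) * q) with (lam * (k1 * q) - (k2 * q) * (x - y)) by ring.
    rewrite <- E1, <- E2. ring. }
  rewrite <- (length_map f R).
  apply (clique_free_sound Pos.eq_dec (residue_adjacency p n0) t (vertices p) Hfree).
  - assert (HRnd : NoDup R) by apply NoDup_nodup.
    split.
    + clearbody R. clear - HRnd Hinj. induction HRnd as [|r R Hr HRnd IH]; simpl; constructor.
      * intros H. apply in_map_iff in H. destruct H as (r' & E & Hr').
        apply Hr. rewrite (Hinj r r'); auto; [now left | now right].
      * apply IH. intros r1 r2 H1 H2. apply Hinj; now right.
    + intros u v Hu Hv Huv. apply in_map_iff in Hu, Hv.
      destruct Hu as (r & <- & Hr). destruct Hv as (r' & <- & Hr').
      destruct (HR r Hr) as (x & Hx & Ex). destruct (HR r' Hr') as (y & Hy & Ey).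
      assert (Hxy : x <> y) by (intros ->; apply Huv; now rewrite Ex, Ey).
      destruct (HL x y Hx Hy Hxy) as [k Hk].
      apply residue_adjacency_square with (w := mu * k); try apply Hf.
      fold q.
      assert (E1 := proj2 (Hf r)). assert (E2 := proj2 (Hf r')).
      rewrite Ex in E1 at 2. rewrite Ey in E2 at 2.
      rewrite Z.mul_mod_idemp_r in E1, E2 by lia.
      apply Hcong in E1, E2, Hn, Hmu. apply Hcong.
      replace (mu * k * (mu * k)) with (mu * mu * (x * y + n)) by (rewrite Hk; ring).
      destruct E1 as [k1 E1]. destruct E2 as [k2 E2]. destruct Hn as [k3 E3]. destruct Hmu as [k4 E4].
      assert (F1 : Zpos (f r) = mu * x + k1 * q) by lia.
      assert (F2 : Zpos (f r') = mu * y + k2 * q) by lia.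
      assert (F3 : n = lam * lam * n0 + k3 * q) by lia.
      assert (F4 : lam * mu = 1 + k4 * q) by lia.
      rewrite F1, F2, F3.
      exists (mu * x * k2 + mu * y * k1 + k1 * k2 * q - mu * mu * k3 - n0 * (2 * k4 + k4 * k4 * q)).
      replace (mu * mu * (x * y + (lam * lam * n0 + k3 * q)))
        with (mu * mu * (x * y) + (lam * mu) * (lam * mu) * n0 + mu * mu * k3 * q) by ring.
      rewrite F4. ring.
  - intros u Hu. apply in_map_iff in Hu. destruct Hu as (r & <- & _). apply Hf.
Qed.

(** For each prime, representatives of residues up to nonzero squares (0, 1 and, for odd primes, a
    non-residue) with clique bounds. A class that is not listed has weight 0; for the class 0 and
    [p >= 29] nothing is lost, since the squares form a clique of at least 15 residues. *)
Definition clique_table : list (positive * list (Z * nat)) := [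
  (2%positive, [(0, 2%nat); (1, 2%nat)]); (3%positive, [(0, 2%nat); (1, 3%nat); (2, 2%nat)]);
  (5%positive, [(0, 3%nat); (1, 3%nat); (2, 3%nat)]); (7%positive, [(0, 4%nat); (1, 4%nat); (3, 3%nat)]);
  (11%positive, [(0, 6%nat); (1, 5%nat); (2, 4%nat)]); (13%positive, [(0, 7%nat); (1, 5%nat); (2, 4%nat)]);
  (17%positive, [(0, 9%nat); (1, 5%nat); (3, 4%nat)]); (19%positive, [(0, 10%nat); (1, 5%nat); (2, 4%nat)]);
  (23%positive, [(0, 12%nat); (1, 6%nat); (5, 5%nat)]); (29%positive, [(1, 6%nat); (2, 5%nat)]);
  (31%positive, [(1, 6%nat); (3, 5%nat)]); (37%positive, [(1, 7%nat); (2, 5%nat)]);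
  (41%positive, [(1, 7%nat); (3, 5%nat)]); (43%positive, [(1, 7%nat); (2, 6%nat)]);
  (47%positive, [(1, 7%nat); (5, 6%nat)]); (53%positive, [(1, 7%nat); (2, 6%nat)]);
  (59%positive, [(1, 8%nat); (2, 6%nat)]); (61%positive, [(1, 8%nat); (2, 6%nat)]);
  (67%positive, [(1, 8%nat); (2, 6%nat)]); (71%positive, [(1, 8%nat); (7, 7%nat)]);
  (73%positive, [(1, 8%nat); (5, 6%nat)]); (79%positive, [(1, 8%nat); (3, 8%nat)]);
  (83%positive, [(1, 9%nat); (2, 7%nat)]); (89%positive, [(1, 9%nat); (3, 7%nat)]);
  (97%positive, [(1, 9%nat); (5, 8%nat)]); (101%positive, [(1, 9%nat); (2, 9%nat)]);
  (103%positive, [(1, 9%nat); (3, 10%nat)]); (107%positive, [(1, 9%nat); (2, 9%nat)]);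
  (109%positive, [(1, 9%nat); (2, 9%nat)]); (113%positive, [(1, 9%nat); (3, 9%nat)]);
  (127%positive, [(1, 9%nat); (3, 12%nat)]); (131%positive, [(1, 10%nat); (2, 12%nat)]);
  (137%positive, [(1, 10%nat); (3, 11%nat)]); (139%positive, [(1, 10%nat); (2, 11%nat)]);
  (149%positive, [(1, 10%nat); (2, 11%nat)]); (151%positive, [(1, 10%nat)]);
  (157%positive, [(1, 10%nat)]); (163%positive, [(1, 10%nat)]);
  (167%positive, [(1, 10%nat)]); (173%positive, [(1, 10%nat)])].

Definition prime_test (p : positive) : bool :=
  (1 <? Zpos p) && forallb (fun d => negb (Zpos p mod Z.of_nat d =? 0)) (seq 2 (Pos.to_nat p - 2)).

Lemma prime_test_sound (p : positive) : prime_test p = true -> prime (Zpos p).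
Proof.
  intros H. apply andb_true_iff in H. destruct H as [H1 H2].
  apply Z.ltb_lt in H1. apply prime_alt. split; [exact H1|].
  intros d Hd Hdiv. rewrite forallb_forall in H2.
  specialize (H2 (Z.to_nat d)). rewrite in_seq, Z2Nat.id in H2 by lia.
  assert (H3 := H2 ltac:(lia)). apply negb_true_iff, Z.eqb_neq in H3.
  apply H3. apply Z.mod_divide; [lia | exact Hdiv].
Qed.

Lemma clique_table_correct :
  forallb (fun e => prime_test (fst e) &&
     forallb (fun c => residue_clique_free (fst e) (fst c) (snd c)) (snd e)) clique_table = true.
Proof. vm_cast_no_check (eq_refl true). Qed.

(** [lam] and [- lam] have the same square, so half of the range is enough. *)
Definition square_class (p : positive) (n0 : Z) : list Z :=
  map (fun lam => (Z.of_nat lam * Z.of_nat lam * n0) mod Zpos p) (seq 1 (Nat.div2 (Pos.to_nat p))).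

(** The integral part of [m / t] is the best [k] in [equal_pairs_lower_bound]. *)
Definition pair_bound (m t : Z) : Z := let k := m / t in 2 * k * m - t * (k * (k + 1)).

(** Fixed-point logarithms: [Z.log2 (p^64)] is the integral part of [64 log2 p], so the test uses
    integers only. *)
Definition sieve_row (m : Z) (e : positive * list (Z * nat)) : Z * list (list Z * Z) :=
  (Zpos (fst e),
   map (fun c => (square_class (fst e) (fst c),
                  Z.log2 (Zpos (fst e) ^ 64) * pair_bound m (Z.of_nat (snd c)))) (snd e)).

Definition row_weight (n : Z) (r : Z * list (list Z * Z)) : Z :=
  match find (fun c => existsb (Z.eqb (n mod fst r)) (fst c)) (snd r) with
  | Some c => snd c
  | None => 0
  end.

Definition square_iter (k : nat) (x : Z) : Z := Nat.iter k (fun y => y * y) x.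

(* [sieve_bits n * ln 2 / 64] bounds [ln (7 / 13 * max (n^2, 1024))]; here [57 < 64 log2 (13 / 7)]. *)
Definition sieve_bits (n : Z) : Z :=
  (if n * n <=? 1024 then 640 else 4 * (Z.log2 (square_iter 5 (Z.abs n)) + 1)) - 57.

(** Both sides are sums of binary logarithms scaled by 128: [182 = 14 * 13] is twice the number of
    pairs of 14 elements, and [7 / 13 = 14 / 26] is the factor of [log_differences_bound] for 14
    elements. *)
Definition sieve_test (rows : list (Z * list (list Z * Z))) (n : Z) : bool :=
  182 * sieve_bits n <? sumZ (row_weight n) rows.

Lemma sieve_tests :
  (let rows := map (sieve_row 14) clique_table in
   forallb (fun k => sieve_test rows (Z.of_nat k) && sieve_test rows (- Z.of_nat k)) (seq 1 400)) = true.
Proof. vm_cast_no_check (eq_refl true). Qed.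

Lemma prime_inverse (p lam : Z) : prime p -> 0 < lam < p -> exists mu, (lam * mu) mod p = 1 mod p.
Proof.
  intros Hp Hl.
  assert (Hr : rel_prime lam p).
  { apply rel_prime_sym, prime_rel_prime; [exact Hp|].
    intros H. apply Z.divide_pos_le in H; lia. }
  apply rel_prime_bezout in Hr. destruct Hr as [u v E].
  exists u. replace (lam * u) with (1 + (- v) * p) by lia. apply Z.mod_add. lia.
Qed.

Lemma row_weight_bound (n : Z) (e : positive * list (Z * nat)) (L : list Z) :
  prime_test (fst e) = true ->
  forallb (fun c => residue_clique_free (fst e) (fst c) (snd c)) (snd e) = true ->
  (forall x y, In x L -> In y L -> x <> y -> exists k, x * y + n = k * k) ->
  row_weight n (sieve_row (Z.of_nat (length L)) e)
  <= Z.log2 (Zpos (fst e) ^ 64) * (2 * Z.of_nat (equal_pairs (residues (Zpos (fst e)) L))).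
Proof.
  intros Hp Hc HL. apply prime_test_sound in Hp.
  destruct e as [p certs]. simpl fst in *. simpl snd in *.
  assert (Hp2 := prime_ge_2 _ Hp).
  assert (Hlog : 0 <= Z.log2 (Zpos p ^ 64)) by apply Z.log2_nonneg.
  unfold row_weight. cbn [sieve_row fst snd].
  destruct (find _ _) as [c|] eqn:E; [|apply Z.mul_nonneg_nonneg; lia].
  apply find_some in E. destruct E as [E1 E2].
  apply in_map_iff in E1. destruct E1 as ((n0 & t) & <- & Hin). simpl fst in *. simpl snd in *.
  rewrite forallb_forall in Hc. specialize (Hc _ Hin). simpl in Hc.
  apply existsb_exists in E2. destruct E2 as (r & Hr & Er). apply Z.eqb_eq in Er.
  unfold square_class in Hr. apply in_map_iff in Hr. destruct Hr as (l & <- & Hl).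
  apply in_seq in Hl.
  assert (Hl2 : (Nat.div2 (Pos.to_nat p) < Pos.to_nat p)%nat) by (apply Nat.lt_div2; lia).
  destruct (prime_inverse (Zpos p) (Z.of_nat l) Hp ltac:(lia)) as [mu Hmu].
  apply Z.mul_le_mono_nonneg_l; [exact Hlog|].
  unfold pair_bound.
  assert (B := residue_clique_bound p n n0 (Z.of_nat l) mu t L Hc Er Hmu HL).
  assert (Q := equal_pairs_lower_bound (residues (Zpos p) L) (Z.of_nat t)
    (Z.of_nat (length L) / Z.of_nat t)).
  unfold residues in Q at 2. rewrite length_map in Q. fold (residues (Zpos p) L) in Q.
  apply Q; [|lia].
  destruct t; [rewrite Zdiv_0_r; lia | apply Z.div_pos; lia].
Qed.

Open Scope R_scope.

Lemma log2_ln_le (a : Z) : (0 < a)%Z -> IZR (Z.log2 a) * ln 2 <= ln (IZR a).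
Proof.
  intros Ha. destruct (Z.log2_spec a Ha) as [H _].
  assert (Hl := Z.log2_nonneg a).
  destruct (Z_of_nat_complete _ Hl) as [k Ek]. rewrite Ek in *. rewrite <- INR_IZR_INZ.
  rewrite <- ln_pow by lra. apply Rcomplements.ln_le; [apply pow_lt; lra|].
  rewrite pow_IZR. apply IZR_le. exact H.
Qed.

Lemma ln_lt_log2 (a : Z) : (0 < a)%Z -> ln (IZR a) <= IZR (Z.log2 a + 1) * ln 2.
Proof.
  intros Ha. destruct (Z.log2_spec a Ha) as [_ H].
  assert (Hl := Z.log2_nonneg a).
  rewrite <- (Z2Nat.id (Z.log2 a + 1)) by lia. rewrite <- INR_IZR_INZ, <- ln_pow by lra.
  apply Rcomplements.ln_le; [apply IZR_lt; exact Ha|].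
  rewrite pow_IZR. apply IZR_le. rewrite Z2Nat.id by lia. unfold Z.succ in H. lia.
Qed.

Lemma square_iter_pow (k : nat) (x : Z) : square_iter k x = (x ^ 2 ^ Z.of_nat k)%Z.
Proof.
  induction k as [|k IH]; [symmetry; apply Z.pow_1_r|].
  unfold square_iter in *. simpl Nat.iter. rewrite IH, Nat2Z.inj_succ, Z.pow_succ_r by lia.
  rewrite (Z.mul_comm 2), Z.pow_mul_r by lia. ring.
Qed.

Definition sieve_threshold (n : Z) : Z := Z.max (n * n) 1024.

Lemma sieve_bits_spec (n : Z) : n <> 0%Z ->
  64 * ln (IZR (sieve_threshold n) * 14 / (2 * (14 - 1))) <= IZR (sieve_bits n) * ln 2.
Proof.
  intros Hn.
  assert (Hn1 := abs_le_square n).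
  assert (H2 := ln_2_bounds).
  assert (HX : 0 < IZR (sieve_threshold n)) by (apply IZR_lt; unfold sieve_threshold; lia).
  replace (IZR (sieve_threshold n) * 14 / (2 * (14 - 1))) with (IZR (sieve_threshold n) * (7 / 13)) by field.
  rewrite ln_mult by lra.
  assert (H7 : 64 * ln (7 / 13) <= - 57 * ln 2).
  { assert (E : 57 * ln 2 + 64 * ln 7 <= 64 * ln 13); [|rewrite Rcomplements.ln_div by lra; lra].
    replace 57 with (INR 57) at 1 by (simpl; lra). replace 64 with (INR 64) by (simpl; lra).
    rewrite <- !ln_pow by lra. rewrite <- ln_mult by (apply pow_lt; lra).
    apply Rcomplements.ln_le; [apply Rmult_lt_0_compat; apply pow_lt; lra|].
    rewrite !pow_IZR, <- mult_IZR. apply IZR_le. apply Z.leb_le. vm_compute. reflexivity. }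
  unfold sieve_bits, sieve_threshold in *.
  destruct (Z.leb_spec (n * n) 1024).
  - rewrite Z.max_r in * by lia.
    replace (IZR (640 - 57)) with (640 - 57) by (simpl; lra).
    assert (E : ln 1024 = 10 * ln 2).
    { replace 1024 with (2 ^ 10) by ring. rewrite ln_pow by lra. simpl INR. ring. }
    rewrite E. lra.
  - rewrite Z.max_l in * by lia.
    rewrite <- Z.abs_square in *. rewrite mult_IZR in *.
    assert (Ha : 0 < IZR (Z.abs n)) by (apply IZR_lt; lia).
    rewrite ln_mult by lra.
    rewrite minus_IZR, mult_IZR.
    assert (Q := ln_lt_log2 (square_iter 5 (Z.abs n))).
    rewrite square_iter_pow in Q. change (2 ^ Z.of_nat 5)%Z with (Z.of_nat 32) in Q.
    assert (Hpos : (0 < Z.abs n ^ Z.of_nat 32)%Z) by (apply Z.pow_pos_nonneg; [lia | apply Nat2Z.is_nonneg]).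
    specialize (Q Hpos). rewrite <- pow_IZR, ln_pow in Q by exact Ha.
    rewrite square_iter_pow. change (2 ^ Z.of_nat 5)%Z with (Z.of_nat 32).
    replace (INR 32) with 32 in Q by (simpl; lra). lra.
Qed.

Lemma sieve_test_sound (n : Z) (L : list Z) :
  n <> 0%Z -> sieve_test (map (sieve_row 14) clique_table) n = true ->
  NoDup L -> length L = 14%nat ->
  (forall x, In x L -> (0 < x <= sieve_threshold n)%Z) ->
  (forall x y, In x L -> In y L -> x <> y -> exists k, (x * y + n = k * k)%Z) -> False.
Proof.
  intros Hn Ht HL Hlen HX Hsq.
  unfold sieve_test in Ht. apply Z.ltb_lt in Ht.
  assert (HT := clique_table_correct). rewrite forallb_forall in HT.
  assert (HX0 : (0 < sieve_threshold n)%Z) by (unfold sieve_threshold; lia).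
  assert (HP : NoDup (map (fun e : positive * list (Z * nat) => Zpos (fst e)) clique_table)).
  { rewrite <- (eq_refl : nodup Z.eq_dec (map (fun e : positive * list (Z * nat) => Zpos (fst e)) clique_table)
      = map (fun e : positive * list (Z * nat) => Zpos (fst e)) clique_table).
    apply NoDup_nodup. }
  assert (Hpr : forall p, In p (map (fun e : positive * list (Z * nat) => Zpos (fst e)) clique_table) -> prime p).
  { intros p Hp. apply in_map_iff in Hp. destruct Hp as (e & <- & He).
    specialize (HT e He). apply andb_true_iff in HT. apply prime_test_sound, HT. }
  assert (S1 := larger_sieve_log _ L HP Hpr HL).
  assert (S2 := log_differences_bound L (IZR (sieve_threshold n)) HL ltac:(apply IZR_lt; exact HX0)).
  rewrite Hlen in S2. replace (INR 14) with 14 in S2 by (simpl; lra).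
  specialize (S2 ltac:(intros x Hx; destruct (HX x Hx); split; apply IZR_le; lia) ltac:(lia)).
  assert (S3 := sieve_bits_spec n Hn).
  assert (S4 : (sumZ (row_weight n) (map (sieve_row 14) clique_table)
    <= sumZ (fun e => Z.log2 (Zpos (fst e) ^ 64) * (2 * Z.of_nat (equal_pairs (residues (Zpos (fst e)) L)))) clique_table)%Z).
  { clear - HT Hsq Hlen. replace 14%Z with (Z.of_nat (length L)) by (now rewrite Hlen).
    clear Hlen. revert HT. generalize clique_table. intros T HT.
    induction T as [|e T IH]; [simpl; lia|].
    cbn [map sumZ fold_right]. apply Z.add_le_mono.
    - specialize (HT e (or_introl eq_refl)). apply andb_true_iff in HT. destruct HT.
      now apply row_weight_bound.
    - apply IH. intros; apply HT; now right. }
  assert (S5 : IZR (sumZ (fun e => Z.log2 (Zpos (fst e) ^ 64) * (2 * Z.of_nat (equal_pairs (residues (Zpos (fst e)) L))))%Z clique_table) * ln 2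
    <= 128 * sumR (fun p => ln (IZR p) * INR (equal_pairs (residues p L)))
         (map (fun e : positive * list (Z * nat) => Zpos (fst e)) clique_table)).
  { clear. generalize clique_table. intros T. induction T as [|e T IH]; [simpl; lra|].
    cbn [map sumR sumZ fold_right] in *. rewrite plus_IZR, Rmult_plus_distr_r, Rmult_plus_distr_l.
    apply Rplus_le_compat; [|exact IH].
    rewrite !mult_IZR, <- INR_IZR_INZ.
    assert (Q := log2_ln_le (Zpos (fst e) ^ 64)%Z ltac:(apply Z.pow_pos_nonneg; lia)).
    change 64%Z with (Z.of_nat 64) in Q at 2. rewrite <- pow_IZR, ln_pow in Q by (apply IZR_lt; lia).
    replace (INR 64) with 64 in Q by (simpl; lra).
    assert (Hp := pos_INR (equal_pairs (residues (Zpos (fst e)) L))). nra. }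
  assert (S6 : (182 * sieve_bits n < sumZ (fun e => Z.log2 (Zpos (fst e) ^ 64) * (2 * Z.of_nat (equal_pairs (residues (Zpos (fst e)) L)))) clique_table)%Z) by lia.
  apply IZR_lt in S6. rewrite mult_IZR in S6.
  assert (H2 := ln_2_bounds).
  assert (S7 : 182 * IZR (sieve_bits n) * ln 2 < IZR (sumZ (fun e => Z.log2 (Zpos (fst e) ^ 64) * (2 * Z.of_nat (equal_pairs (residues (Zpos (fst e)) L))))%Z clique_table) * ln 2)
    by (apply Rmult_lt_compat_r; lra).
  lra.
Qed.

Lemma small_elements_le13 (n : Z) (S : Z -> Prop) (L : list Z) :
  has_property_D n S -> n <> 0%Z -> (Z.abs n <= 400)%Z -> NoDup L ->
  (forall x, In x L -> S x /\ (x <= Z.max (n * n) 1024)%Z) -> (length L <= 13)%nat.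
Proof.
  intros HS Hn Hn4 HL HSL.
  destruct (le_lt_dec (length L) 13) as [|Hlen]; [assumption|exfalso].
  apply (sieve_test_sound n (firstn 14 L) Hn).
  - assert (T := sieve_tests). cbv zeta in T. rewrite forallb_forall in T.
    specialize (T (Z.to_nat (Z.abs n))). rewrite in_seq, Z2Nat.id in T by lia.
    assert (T' := T ltac:(lia)). apply andb_true_iff in T'. destruct T' as [T1 T2].
    destruct (Z.abs_eq_or_opp n) as [E|E]; rewrite E in T1, T2; [exact T1|].
    now rewrite Z.opp_involutive in T2.
  - rewrite <- (firstn_skipn 14 L) in HL. now apply NoDup_app_remove_r in HL.
  - apply firstn_length_le. lia.
  - intros x Hx. destruct (HSL x) as [Sx Lx].
    { rewrite <- (firstn_skipn 14 L). apply in_or_app; now left. }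
    split; [now apply HS | exact Lx].
  - intros x y Hx Hy Hxy. apply HS; [| |exact Hxy];
      apply HSL; rewrite <- (firstn_skipn 14 L); apply in_or_app; now left.
Qed.

(** * Cliques of residues modulo arbitrary primes *)

Module ResidueCliques.

Import all_boot all_algebra ring zify GRing.Theory.
Set Implicit Arguments. Unset Strict Implicit. Unset Printing Implicit Defensive.
Local Open Scope nat_scope.
Local Open Scope ring_scope.

(* Project the conic from one of its points: a line through that point meets it at most once more. *)
Lemma card_conic (F : finFieldType) (a b c : F) :
  2%:R != 0 :> F -> a != 0 -> b != 0 -> c != 0 ->
  (#|[set yz : F * F | (a * yz.1 ^+ 2 - b * yz.2 ^+ 2 == c)%R]| <= #|F|.+2)%N.
Proof.
move=> h2 ha hb hc; set C := [set yz | _].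
have [-> | [[y0 z0] hP]] := set_0Vmem C; first by rewrite cards0.
(* The slope of the line to the base point, [None] for the vertical line. The [#|F| + 1] slopes and
   the base point itself make up the bound. *)
pose f (yz : F * F) : option F := if yz.1 == y0 then None else Some ((yz.2 - z0) / (yz.1 - y0)).
have hC0 : a * y0 ^+ 2 - b * z0 ^+ 2 = c by move: hP; rewrite inE /= => /eqP.
have finj : {in C :\ (y0, z0) &, injective f}.
  move=> [y z] [y' z']; rewrite !inE /= => /andP[hne /eqP h] /andP[hne' /eqP h'].
  rewrite /f /=; have [ey | ny] := eqVneq y y0; have [ey' | ny'] := eqVneq y' y0 => //.
    (* On the vertical line the only other point is the reflection [(y0, - z0)]. *)
    have aux w : (y0, w) != (y0, z0) -> a * y0 ^+ 2 - b * w ^+ 2 = c -> w = - z0.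
      move=> hw e; have : b * ((w - z0) * (w + z0)) = 0.
        by transitivity ((a * y0 ^+ 2 - b * z0 ^+ 2) - (a * y0 ^+ 2 - b * w ^+ 2)); [ring | rewrite hC0 e subrr].
      move/eqP; rewrite !mulf_eq0 (negPf hb) /= subr_eq0 addr_eq0 => /orP[/eqP ew | /eqP //].
      by rewrite ew eqxx in hw.
    move=> _; move: hne h hne' h'; rewrite ey ey' => hne h hne' h'.
    by rewrite (aux z) // (aux z').
  move=> [es]; set s := (z - z0) / (y - y0) in es.
  have ht : y - y0 != 0 by rewrite subr_eq0.
  have ht' : y' - y0 != 0 by rewrite subr_eq0.
  have ez : z = z0 + s * (y - y0) by rewrite /s divfK // addrC subrK.
  have ez' : z' = z0 + s * (y' - y0) by rewrite es divfK // addrC subrK.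
  clearbody s.
  (* The condition on the second intersection with the line of slope [s], after cancelling [t]. *)
  have line t : t != 0 -> a * (y0 + t) ^+ 2 - b * (z0 + s * t) ^+ 2 = c ->
      2%:R * (a * y0 - b * z0 * s) + t * (a - b * s ^+ 2) = 0.
    move=> nt e; apply: (mulfI nt); rewrite mulr0.
    transitivity ((a * (y0 + t) ^+ 2 - b * (z0 + s * t) ^+ 2) - (a * y0 ^+ 2 - b * z0 ^+ 2)); first by ring.
    by rewrite e hC0 subrr.
  have e1 : 2%:R * (a * y0 - b * z0 * s) + (y - y0) * (a - b * s ^+ 2) = 0.
    by apply: line => //; rewrite -ez [y0 + _]addrC subrK.
  have e2 : 2%:R * (a * y0 - b * z0 * s) + (y' - y0) * (a - b * s ^+ 2) = 0.
    by apply: line => //; rewrite -ez' [y0 + _]addrC subrK.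
  have : (y - y') * (a - b * s ^+ 2) = 0.
    transitivity ((2%:R * (a * y0 - b * z0 * s) + (y - y0) * (a - b * s ^+ 2))
      - (2%:R * (a * y0 - b * z0 * s) + (y' - y0) * (a - b * s ^+ 2))); first by ring.
    by rewrite e1 e2 subrr.
  move/eqP; rewrite mulf_eq0 subr_eq0 => /orP[/eqP eyy | /eqP ea].
    by rewrite ez ez' eyy.
  (* Remaining case [a = b s^2]: the line would be an asymptote, and then [c = 0]. *)
  move: e1; rewrite ea mulr0 addr0 => /eqP; rewrite mulf_eq0 (negPf h2) /= => /eqP e3.
  have ea' : a = b * s ^+ 2 by apply/eqP; rewrite -subr_eq0 ea.
  have : b * s * (s * y0 - z0) = 0 by rewrite -e3 ea'; ring.
  move/eqP; rewrite !mulf_eq0 (negPf hb) /= => /orP[/eqP s0 | /eqP e4].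
    by move: ha; rewrite ea' s0 expr0n mulr0 eqxx.
  move: hc; rewrite -hC0 ea'.
  have -> : b * s ^+ 2 * y0 ^+ 2 - b * z0 ^+ 2 = b * (s * y0 - z0) * (s * y0 + z0) by ring.
  by rewrite e4 mulr0 mul0r eqxx.
rewrite (cardsD1 (y0, z0)) hP add1n ltnS -(card_in_imset finj).
by rewrite (leq_trans (max_card _)) // card_option.
Qed.

Lemma card_sqr_eq_sqr (F : finFieldType) : (#|[set yz : F * F | (yz.1 ^+ 2 == yz.2 ^+ 2)%R]| <= 2 * #|F|)%N.
Proof.
have sub : [set yz : F * F | yz.1 ^+ 2 == yz.2 ^+ 2]
    \subset [set (y, y) | y in F] :|: [set (y, - y) | y in F].
  apply/subsetP=> -[y z]; rewrite !inE /= eqf_sqr => /orP[] /eqP ->.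
    by apply/orP; left; apply/imsetP; exists z.
  by apply/orP; right; apply/imsetP; exists (- z) => //; rewrite opprK.
rewrite (leq_trans (subset_leq_card sub)) // (leq_trans (leq_card_setU _ _)) //.
by rewrite mul2n -addnn leq_add // leq_imset_card.
Qed.

(** In odd characteristic this is [1 + chi (u v + m)] for the quadratic character [chi]; counting
    roots replaces character sums by point counts. *)
Definition root_count (F : finFieldType) (m u v : F) : nat := #|[set k : F | k ^+ 2 == u * v + m]|.

Lemma sum_root_count (F : finFieldType) (m v : F) : v != 0 ->
  (\sum_(u : F) root_count m u v = #|F|)%N.
Proof.
move=> hv.
under eq_bigr => u _ do rewrite /root_count -sum1dep_card.
rewrite (exchange_big_dep xpredT) //=.
rewrite -sum1_card; apply: eq_bigr => k _.
rewrite (eq_bigl (pred1 ((k ^+ 2 - m) / v))) ?big_pred1_eq // => u /=.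
by apply/eqP/eqP => [-> | ->]; [rewrite addrK mulfK | rewrite divfK // subrK].
Qed.

(** Eliminating [u] from [y^2 = u v + m] and [z^2 = u v' + m] leaves the conic
    [v' y^2 - v z^2 = m (v' - v)], which degenerates to [y^2 = z^2] for [v = v']. *)
Lemma sum_root_count_mul (F : finFieldType) (m v v' : F) :
  2%:R != 0 :> F -> m != 0 -> v != 0 -> v' != 0 ->
  (\sum_(u : F) root_count m u v * root_count m u v'
     <= if v == v' then 2 * #|F| else #|F|.+2)%N.
Proof.
move=> h2 hm hv hv'.
have -> : (\sum_(u : F) root_count m u v * root_count m u v'
    = #|[set yz : F * F | (v' * yz.1 ^+ 2 - v * yz.2 ^+ 2 == m * (v' - v))%R]|)%N.
  under eq_bigr => u _ do rewrite /root_count -cardsX -sum1dep_card.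
  rewrite (exchange_big_dep xpredT) //= -sum1dep_card [RHS]big_mkcond /=.
  apply: eq_bigr => -[y z] _ /=.
  case: ifP => [/eqP h | /eqP h].
    rewrite (eq_bigl (pred1 ((y ^+ 2 - m) / v))) ?big_pred1_eq // => u /=.
    rewrite !inE /=; apply/andP/eqP => [[/eqP -> _] | ->]; first by rewrite addrK mulfK.
    rewrite divfK // subrK eqxx; split=> //.
    apply/eqP; apply: (mulfI hv).
    have -> : v * ((y ^+ 2 - m) / v * v' + m) = (y ^+ 2 - m) / v * v * v' + v * m by ring.
    rewrite divfK //.
    transitivity (v' * y ^+ 2 - (v' * y ^+ 2 - v * z ^+ 2)); first by ring.
    by rewrite h; ring.
  rewrite big1 // => u; rewrite !inE /= => /andP[/eqP e1 /eqP e2].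
  by case: h; rewrite e1 e2; ring.
case: eqVneq => [<- | hne]; last first.
  by apply: card_conic => //; rewrite mulf_neq0 // subr_eq0 eq_sym.
rewrite (leq_trans _ (card_sqr_eq_sqr F)) // subset_leq_card //.
apply/subsetP => -[y z]; rewrite !inE /= subrr mulr0 -mulrBr mulf_eq0 (negPf hv) /=.
by rewrite subr_eq0.
Qed.

Lemma root_count_ge2 (F : finFieldType) (m u v k : F) :
  2%:R != 0 :> F -> u * v + m = k ^+ 2 -> u * v + m != 0 -> (2 <= root_count m u v)%N.
Proof.
move=> h2 e hn.
have hk : k != 0 by apply: contraNneq hn => k0; rewrite e k0 expr0n.
have kN : k != - k.
  rewrite -subr_eq0 opprK -mulr2n -mulr_natl mulf_neq0 //.
have <- : #|[set k; - k]| = 2%N by rewrite cards2 kN.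
rewrite /root_count subset_leq_card //.
by apply/subsetP => x; rewrite !inE e eqf_sqr.
Qed.

(* Compare the two sides of the variance of [u |-> \sum_(v in R) root_count m u v], whose mean is
   [#|R|] and which is at least [2 #|R| - 4] on [R]. *)
Lemma card_shifted_product_squares (F : finFieldType) (m : F) (R : {set F}) :
  2%:R != 0 :> F -> m != 0 -> 0 \notin R ->
  (forall u v, u \in R -> v \in R -> u != v -> exists k, u * v + m = k ^+ 2) ->
  (4 <= #|R|)%N -> ((#|R| - 4) ^ 2 <= 2 * #|F| + 2 * #|R|)%N.
Proof.
move=> h2 hm hR0 hR h4.
set r := #|R|; set q := #|F|.
have nz v : v \in R -> v != 0 by move=> hv; apply: contraNneq hR0 => <-.
pose f u := (\sum_(v in R) root_count m u v)%N.
have S1 : (\sum_(u : F) f u = r * q)%N.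
  rewrite /f exchange_big /= (eq_bigr (fun=> q)) ?sum_nat_const // => v /nz hv.
  exact: sum_root_count.
have S2 : (\sum_(u : F) f u * f u <= r * (r * q.+2) + r * (2 * q))%N.
  have -> : (\sum_(u : F) f u * f u
      = \sum_(v in R) \sum_(v' in R) \sum_(u : F) root_count m u v * root_count m u v')%N.
    rewrite exchange_big /= [RHS](eq_bigr (fun v => \sum_(u : F) \sum_(v' in R) root_count m u v' * root_count m u v))%N; last first.
      by move=> v _; rewrite exchange_big.
    rewrite [RHS]exchange_big /=; apply: eq_bigr => u _.
    rewrite /f big_distrr /=; apply: eq_bigr => v _.
    by rewrite big_distrl.
  have -> : (r * (r * q.+2) + r * (2 * q) = \sum_(v in R) (r * q.+2 + 2 * q))%N.
    by rewrite sum_nat_const -/r mulnDr.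
  apply: leq_sum => v hv.
  (* Crude on the diagonal, where [2 q] is replaced by [q + 2 + 2 q]. *)
  have -> : (r * q.+2 + 2 * q = \sum_(v' in R) (q.+2 + (v == v') * (2 * q)))%N.
    rewrite big_split /= sum_nat_const -/r; congr (_ + _)%N.
    by rewrite (bigD1 v) //= eqxx mul1n big1 ?addn0 // => i /andP[_ /negPf]; rewrite eq_sym => ->.
  apply: leq_sum => v' hv'.
  apply: leq_trans (sum_root_count_mul h2 hm (nz _ hv) (nz _ hv')) _.
  by case: eqP => _; rewrite -/q; lia.
have S3 u : u \in R -> (2 * r <= f u + 4)%N.
  move=> hu.
  (* Leaves out [v = u] and the single [v] with [u v + m = 0], for which there is only one root. *)
  pose B := [set v in R | (v != u) && (u * v + m != 0)].
  have hB : (r <= #|B| + 2)%N.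
    have sub : R \subset B :|: [set u; - m / u].
      apply/subsetP => v hv; rewrite !inE hv /=.
      have [-> | nvu] := eqVneq v u; first by rewrite orbT.
      have [e | //] := eqVneq (u * v + m) 0.
      rewrite /=; apply/eqP.
      have -> : - m = u * v by apply/eqP; rewrite eq_sym -addr_eq0 e.
      by rewrite mulrC mulKf // nz.
    rewrite /r (leq_trans (subset_leq_card sub)) // (leq_trans (leq_card_setU _ _)) //.
    by rewrite leq_add2l cards2; case: (_ == _).
  have : (2 * #|B| <= f u)%N.
    rewrite mulnC -sum_nat_const /f [X in (_ <= X)%N](bigID (mem B)) /=.
    apply: leq_trans (leq_addr _ _).
    rewrite [X in (_ <= X)%N](eq_bigl (mem B)); last first.
      by move=> v /=; rewrite inE; case: (v \in R).
    apply: leq_sum => v; rewrite inE => /and3P[hv nvu hn].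
    have [| k hk] := hR u v hu hv; first by rewrite eq_sym.
    exact: root_count_ge2 hk hn.
  by lia.
(* This is [(f u - r)^2 >= (r - 4)^2] on [R] and [>= 0] elsewhere, expanded so that the subtraction
   in [f u - r] is avoided. *)
have S4 : (\sum_(u : F) (2 * r * f u + (u \in R) * (r - 4) ^ 2) <= \sum_(u : F) (f u * f u + r * r))%N.
  apply: leq_sum => u _; case: (boolP (u \in R)) => hu /=.
    have := S3 u hu; set x := f u; move=> hx.
    have : exists d, x = (r + d)%N /\ (r - 4 <= d)%N by exists (x - r)%N; lia.
    by move=> [d [-> hd]]; nia.
  rewrite mul0n addn0.
  have [le | le] := leqP (f u) r; nia.
rewrite big_split /= -big_distrr /= S1 -big_distrl /= in S4.
have cR : (\sum_(u : F) (u \in R) = r)%N by rewrite -big_mkcond /= sum1_card.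
rewrite cR big_split /= sum_nat_const -/q in S4.
have : (r * (r - 4) ^ 2 <= r * (2 * q + 2 * r))%N.
  by move: S2 S4; set T := (\sum_(u : F) f u * f u)%N; set E := ((r - 4) ^ 2)%N; clearbody T E; nia.
by rewrite leq_pmul2l //; lia.
Qed.

(** * From integers modulo [p] to the field ['F_p] *)

Lemma of_nat_modn (m p : nat) : (0 < p)%N -> Z.of_nat (m %% p)%N = Z.modulo (Z.of_nat m) (Z.of_nat p).
Proof.
move=> hp; have h := ltn_pmod m hp; apply: (Z.mod_unique _ _ (Z.of_nat (m %/ p)%N)); first by lia.
by have := divn_eq m p; lia.
Qed.

Definition Zres (p : nat) (x : Z) : nat := Z.to_nat (Z.modulo x (Z.of_nat p)).

Lemma of_nat_Zres (p : nat) (x : Z) : (0 < p)%N -> Z.of_nat (Zres p x) = Z.modulo x (Z.of_nat p).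
Proof. move=> hp; rewrite /Zres Z2Nat.id //; have := Z.mod_pos_bound x (Z.of_nat p); lia. Qed.

Lemma Zres_Fp_square (p : nat) (n x y k : Z) : prime p -> Z.add (Z.mul x y) n = Z.mul k k ->
  ((Zres p x)%:R * (Zres p y)%:R + (Zres p n)%:R : 'F_p) = (Zres p k)%:R ^+ 2.
Proof.
move=> hp e; have p0 := prime_gt0 hp.
rewrite expr2 -!natrM -natrD; apply: val_inj; rewrite /= !val_Fp_nat //.
apply: Nat2Z.inj; rewrite !of_nat_modn //.
have -> : Z.of_nat (Zres p x * Zres p y + Zres p n)%N
   = Z.add (Z.mul (Z.of_nat (Zres p x)) (Z.of_nat (Zres p y))) (Z.of_nat (Zres p n)) by lia.
have -> : Z.of_nat (Zres p k * Zres p k)%N = Z.mul (Z.of_nat (Zres p k)) (Z.of_nat (Zres p k)) by lia.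
rewrite !of_nat_Zres //.
by rewrite -Z.mul_mod -?e; [rewrite Z.add_mod -?Z.mul_mod ?Z.mod_mod -?Z.add_mod //; lia | lia].
Qed.

Lemma Zres_inj (p : nat) (x y : Z) : prime p -> (Zres p x)%:R = (Zres p y)%:R :> 'F_p ->
  Z.modulo x (Z.of_nat p) = Z.modulo y (Z.of_nat p).
Proof.
move=> hp /(congr1 val) /=; have p0 := prime_gt0 hp; rewrite !val_Fp_nat //.
have hlt z : (Zres p z < p)%N by have := of_nat_Zres z p0; have := Z.mod_pos_bound z (Z.of_nat p); lia.
by rewrite !modn_small // -!of_nat_Zres // => ->.
Qed.

(** The residue 0 is set aside, which costs one. For a set of at least 21 nonzero residues,
    [(r - 4)^2 <= 2 p + 2 r] implies [r^2 <= 4 p]. *)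
Lemma residue_count_bound (p : nat) (n : Z) (L : list Z) :
  prime p -> (2 < p)%N -> Z.modulo n (Z.of_nat p) <> Z0 ->
  (forall x y, In x L -> In y L -> x <> y -> exists k, Z.add (Z.mul x y) n = Z.mul k k) ->
  let r := length (nodup Z.eq_dec (residues (Z.of_nat p) L)) in
  (r <= 21 \/ (r - 1) ^ 2 <= 4 * p)%N.
Proof.
move=> hp p2 hn hL r; have p0 := prime_gt0 hp.
pose K := nodup Z.eq_dec (residues (Z.of_nat p) L).
have hK z : In z K -> exists x, In x L /\ z = Z.modulo x (Z.of_nat p).
  by move=> /nodup_In /in_map_iff [x [<- hx]]; exists x.
pose phi (z : Z) : 'F_p := (Zres p z)%:R.
have phi_inj z z' : In z K -> In z' K -> phi z = phi z' -> z = z'.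
  move=> /hK [x [_ ->]] /hK [y [_ ->]] /(Zres_inj hp).
  by rewrite !Z.mod_mod //; lia.
have hu : uniq (List.map phi K).
  have : NoDup K by exact: NoDup_nodup.
  elim: K phi_inj {hK r} => [|z K IH] phi_inj //= h; inversion h; subst.
  rewrite IH //; last by move=> a b ha hb; apply: phi_inj; right.
  rewrite andbT; apply/negP => hz; apply: H1.
  have : exists2 z', In z' K & phi z = phi z'.
    elim: (K) hz => [|a l IHl] //=; rewrite in_cons => /orP[/eqP e | /IHl [z' h1 h2]].
      by exists a => //; left.
    by exists z' => //; right.
  move=> [z' hz' e]; have -> // : z = z' by apply: phi_inj => //; [left | right].
pose R := [set z in List.map phi K] :\ 0.
have hcard : (r <= #|R|.+1)%N.
  have -> : r = #|[set z in List.map phi K]|.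
    by rewrite cardsE (card_uniqP hu) /r -/K; elim: (K) => //= a l ->.
  by rewrite (cardsD1 0) /R; case: (0 \in _) => //=; lia.
have mem_ex z : z \in List.map phi K -> exists2 x, In x L & z = (Zres p x)%:R.
  move=> hz; have [w hw ->] : exists2 w, In w K & z = phi w.
    elim: (K) hz => [|a l IHl] //=; rewrite in_cons => /orP[/eqP e | /IHl [z' h1 h2]].
      by exists a => //; left.
    by exists z' => //; right.
  have [x [hx ->]] := hK _ hw; exists x => //.
  by rewrite /phi /Zres Z.mod_mod //; lia.
have hR0 : 0 \notin R by rewrite !inE eqxx.
have h2 : 2%:R != 0 :> 'F_p.
  by rewrite -(dvdn_pcharf (pchar_Fp hp)) gtnNdvd.
have hm : (Zres p n)%:R != 0 :> 'F_p.
  apply/eqP => e; apply: hn; have -> : (Z0 = Z.modulo Z0 (Z.of_nat p))%Z by rewrite Z.mod_0_l //; lia.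
  by apply: (Zres_inj hp); rewrite e /Zres Z.mod_0_l //; lia.
have hR u v : u \in R -> v \in R -> u != v -> exists k, u * v + (Zres p n)%:R = k ^+ 2.
  rewrite !inE => /andP[_ /mem_ex [x hx ->]] /andP[_ /mem_ex [y hy ->]] hxy.
  have [|k hk] := hL x y hx hy; first by move=> e; rewrite e eqxx in hxy.
  by exists (Zres p k)%:R; apply: Zres_Fp_square.
have [h4 | h4] := leqP 4 #|R|; last by left; lia.
have := card_shifted_product_squares h2 hm hR0 hR h4; rewrite card_Fp //.
have [h20 | h20] := leqP #|R| 20; first by move=> _; left; lia.
move=> h; right; apply: (@leq_trans (#|R| ^ 2)); first by rewrite leq_sqr; lia.
have [d e] : exists d, #|R| = (d + 21)%N by exists (#|R| - 21)%N; lia.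
move: h; rewrite e; have -> : (d + 21 - 4 = d + 17)%N by lia.
rewrite -!mulnn; nia.
Qed.

Local Open Scope nat_scope.

Lemma prime_of_nat (p : nat) : prime p -> Znumtheory.prime (Z.of_nat p).
Proof.
move=> hp; have p1 := prime_gt1 hp; apply/prime_alt; split; first by lia.
move=> d hd hdiv; have : (Z.to_nat d %| p)%N.
  case: hdiv => q e; apply/dvdnP; exists (Z.to_nat q).
  have q0 : Z.lt Z0 q by nia.
  by apply: Nat2Z.inj; rewrite e; nia.
by move/primeP: hp => [_ h] /h /orP[] /eqP; lia.
Qed.

(** * Chebyshev's lower bound for the product of the primes *)

Lemma central_bin_ge (N : nat) : 2 ^ N <= 'C(N.*2, N).
Proof.
elim: N => [|N IH]; first by rewrite bin0.
rewrite doubleS binS -(@bin_sub (N.*2).+1 N.+1) ?subSS; last by rewrite ltnS -addnn leq_addr.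
have -> : N.*2 - N = N by rewrite -addnn addnK.
rewrite addnn expnS mul2n leq_double (leq_trans IH) //.
case: N {IH} => [|N] //; by rewrite [X in _ <= X]binS leq_addr.
Qed.

(** Legendre's formula: the exponent is the sum over [k] of [floor (2 N / p^k) - 2 floor (N / p^k)];
    each term is at most 1, and it is 0 once [p^k > 2 N]. *)
Lemma pfactor_central_bin (p N : nat) : prime p -> 0 < N -> p ^ logn p 'C(N.*2, N) <= N.*2.
Proof.
move=> hp N0; have p1 := prime_gt1 hp; have p0 := prime_gt0 hp.
have NN : N <= N.*2 by rewrite -addnn leq_addr.
set t := trunc_log p N.*2.
suff ht : logn p 'C(N.*2, N) <= t.
  by rewrite (leq_trans (leq_pexp2l p0 ht)) // trunc_logP // double_gt0.
have e := bin_fact NN; have eN : N.*2 - N = N by rewrite -addnn addnK.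
rewrite eN in e; move/(congr1 (logn p)): e.
rewrite lognM ?muln_gt0 ?fact_gt0 ?bin_gt0 // lognM ?fact_gt0 // !logn_fact //.
have -> : \sum_(1 <= k < N.+1) N %/ p ^ k = \sum_(1 <= k < N.*2.+1) N %/ p ^ k.
  rewrite [RHS](@big_cat_nat _ _ _ N.+1) //=.
  have -> : \sum_(N.+1 <= k < N.*2.+1) N %/ p ^ k = 0; last by rewrite addn0.
  rewrite big_nat_cond big1 // => k; rewrite andbT => /andP[hk _]; apply: divn_small.
  exact: ltn_trans hk (ltn_expl k p1).
have : \sum_(1 <= k < N.*2.+1) N.*2 %/ p ^ k
   <= \sum_(1 <= k < N.*2.+1) (N %/ p ^ k + N %/ p ^ k + (k <= t)).
  apply: leq_sum => k _; set a := p ^ k.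
  have a0 : 0 < a by rewrite expn_gt0 p0.
  have [hk | hk] := leqP k t.
    have h1 := divn_eq N a; have h2 := ltn_pmod N a0.
    rewrite -ltnS ltn_divLR //; nia.
  rewrite divn_small //; apply: leq_trans (trunc_log_ltn N.*2 p1) _.
  by rewrite leq_pexp2l.
rewrite !big_split /=.
have : \sum_(1 <= k < N.*2.+1) (k <= t) <= t.
  rewrite -big_mkcond /= sum1_count.
  apply: leq_trans (_ : size (iota 1 t) <= _); last by rewrite size_iota.
  rewrite -size_filter; apply: uniq_leq_size; first by rewrite filter_uniq // iota_uniq.
  by move=> k; rewrite mem_filter !mem_iota; lia.
by lia.
Qed.

Lemma primorial_central_bin (w N : nat) : 0 < N -> N.*2 <= w * w ->
  'C(N.*2, N) <= N.*2 ^ w.+1 * \prod_(0 <= p < N.*2.+1 | prime p) p.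
Proof.
move=> N0 hw; set C := 'C(N.*2, N).
have C0 : 0 < C by rewrite bin_gt0 -addnn leq_addr.
have D0 : 0 < N.*2 by rewrite double_gt0.
(* The range up to [C + 2 N] contains the prime factors of [C] as well as all primes up to [2 N]. *)
rewrite -{1}(partnT C0) (@widen_partn (C + N.*2)) ?leq_addr //.
apply: (@leq_trans (\prod_(0 <= p < (C + N.*2).+1) ((if p <= w then N.*2 else 1) * (if prime p && (p <= N.*2) then p else 1)))).
  apply: leq_prod => p _.
  have [hp | hp] := boolP (prime p); last first.
    by rewrite lognE (negPf hp) /= expn0 muln1; case: ifP.
  have h := pfactor_central_bin hp N0; rewrite -/C in h.
  case: (leqP p w) => hpw /=.
    by apply: leq_trans h _; case: ifP => _; rewrite ?muln1 // leq_pmulr // prime_gt0.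
  rewrite mul1n; have p1 := prime_gt1 hp.
  have hl : logn p C <= 1.
    rewrite leqNgt; apply/negP => h2.
    have : p ^ 2 <= N.*2 by apply: leq_trans h; rewrite leq_pexp2l ?prime_gt0.
    by rewrite -mulnn; nia.
  case: ifP => hpN.
    by rewrite -[X in _ <= X]expn1 leq_pexp2l ?prime_gt0.
  case: (logn p C) hl h => [|[|//]] // _; rewrite expn1; lia.
rewrite big_split /= leq_mul //.
  rewrite (@big_cat_nat _ _ _ (minn w.+1 (C + N.*2).+1)) ?geq_minr //=.
  rewrite [X in _ * X]big_nat_cond [X in _ * X]big1 ?muln1; last first.
    by move=> p; rewrite andbT => /andP[h1 h2]; case: ifP => //; lia.
  apply: leq_trans (_ : \prod_(0 <= p < minn w.+1 (C + N.*2).+1) N.*2 <= _).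
    by apply: leq_prod => p _; case: ifP.
  by rewrite prod_nat_const_nat subn0 leq_pexp2l // geq_minl.
rewrite (@big_cat_nat _ _ _ N.*2.+1) //=; last by rewrite ltnS leq_addl.
rewrite [X in _ * X]big_nat_cond [X in _ * X]big1 ?muln1; last first.
  by move=> p; rewrite andbT => /andP[h1 h2]; case: ifP => //; lia.
rewrite [X in _ <= X]big_mkcond /= big_nat_cond [X in _ <= X]big_nat_cond.
apply: leq_prod => p; rewrite andbT ltnS => /andP[_ ->]; by rewrite andbT.
Qed.

Lemma expn_pow (m n : nat) : m ^ n = Nat.pow m n.
Proof. by elim: n => //= n IH; rewrite expnS IH. Qed.

Lemma In_seq_mem (T : eqType) (x : T) (s : list T) : In x s <-> x \in s.
Proof.
elim: s => [|y s IH] //=; rewrite in_cons; split.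
  by move=> [-> | /IH ->]; rewrite ?eqxx ?orbT.
by move=> /orP[/eqP -> | /IH]; [left | right].
Qed.

Lemma uniq_NoDup (T : eqType) (s : list T) : uniq s -> NoDup s.
Proof.
elim: s => [|x s IH] /=; first by constructor.
by move=> /andP[hx /IH hs]; constructor=> // /In_seq_mem; apply/negP.
Qed.

(* Elementary Chebyshev estimate: each prime power dividing [binomial (2N) N] is at most [2N], and
   primes above [w] divide it at most once. *)
Lemma primes_product_lower_bound (w N : nat) : 0 < N -> N.*2 <= w * w ->
  exists Ps : list nat, [/\ NoDup Ps,
    forall p, In p Ps -> prime p /\ (p <= N.*2)%N &
    Nat.pow 2 N <= Nat.mul (Nat.pow N.*2 w.+1) (List.fold_right Nat.mul 1 Ps)].
Proof.
move=> N0 hw; exists [seq p <- index_iota 0 N.*2.+1 | prime p]; split.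
- by apply: uniq_NoDup; rewrite filter_uniq // iota_uniq.
- by move=> p /In_seq_mem; rewrite mem_filter mem_index_iota => /and3P[? _ ?]; split.
rewrite -!expn_pow; apply: leq_trans (central_bin_ge N) _.
apply: leq_trans (primorial_central_bin N0 hw) _.
rewrite -big_filter leq_mul //.
have -> : forall s, List.fold_right Nat.mul 1 s = \prod_(p <- s) p.
  by elim=> [|x s IH] /=; rewrite ?big_nil ?big_cons ?IH.
exact: leqnn.
Qed.

(** Phrased in standard library arithmetic for use outside the module. The primes are at most
    [2 N = w^2], so [(r - 1)^2 <= 4 w^2]; [w >= 10] covers the case of at most 21 residues. *)
Lemma sieving_primes (w N : nat) (n : Z) :
  Peano.lt 0 N -> Nat.mul 2 N = Nat.mul w w -> Peano.le 10 w ->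
  exists Ps : list nat,
    List.NoDup Ps /\
    (forall p, List.In p Ps -> Znumtheory.prime (Z.of_nat p)) /\
    Peano.le (Nat.pow 2 N) (Nat.mul (Nat.pow (Nat.mul w w) (S w)) (List.fold_right Nat.mul 1 Ps)) /\
    (forall p, List.In p Ps -> p <> 2 -> Z.modulo n (Z.of_nat p) <> Z0 -> forall L : list Z,
      (forall x y, List.In x L -> List.In y L -> x <> y -> exists k, Z.add (Z.mul x y) n = Z.mul k k) ->
      Peano.le (length (nodup Z.eq_dec (residues (Z.of_nat p) L))) (Nat.add (Nat.mul 2 w) 1)).
Proof.
move=> hN hw w10; have N0 : 0 < N by lia.
have hNw : N.*2 <= w * w by lia.
have [Ps [h1 h2 h3]] := primes_product_lower_bound N0 hNw.
exists Ps; split=> //; split; first by move=> p /h2 [hp _]; apply: prime_of_nat.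
split; first by rewrite (_ : Nat.mul w w = N.*2); [apply/leP | lia].
move=> p /h2 [hp hpN] p2 hn L hL.
have p2' : 2 < p by rewrite ltn_neqAle prime_gt1 // andbT eq_sym; apply/eqP.
have := residue_count_bound hp p2' hn hL; set r := length _.
case=> h; first by lia.
suff : r - 1 <= 2 * w by lia.
rewrite -leq_sqr; apply: leq_trans h _; rewrite -mulnn.
by move: hpN hNw; rewrite -muln2 mulnACA => h4 h5; lia.
Qed.

End ResidueCliques.

(** * Conclusion *)

Open Scope R_scope.

Lemma ln_fold_mul (Ps : list nat) : (forall p, In p Ps -> (0 < p)%nat) ->
  (0 < fold_right Nat.mul 1 Ps)%nat /\
  ln (INR (fold_right Nat.mul 1%nat Ps)) = sumR (fun p => ln (IZR p)) (map Z.of_nat Ps).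
Proof.
  induction Ps as [|p Ps IH]; intros H.
  - simpl. split; [lia|apply ln_1].
  - destruct IH as [I1 I2]; [intros; apply H; now right|].
    assert (Hp := H p (or_introl eq_refl)).
    cbn [fold_right map sumR]. split; [now apply Nat.mul_pos_pos|].
    rewrite mult_INR, ln_mult by (apply lt_0_INR; assumption).
    rewrite I2, <- INR_IZR_INZ. reflexivity.
Qed.

Lemma sumR_filter {A} (b : A -> bool) (f : A -> R) (l : list A) :
  sumR f l = sumR f (filter b l) + sumR (fun x => if b x then 0 else f x) l.
Proof. induction l as [|x l IH]; simpl; [ring|]. destruct (b x); simpl; rewrite IH; ring. Qed.

(** Each sieving prime leaves at most [V = 2 w + 1] residues, so among [2 V] elements at least [V]
    pairs are congruent. The [V (2 V - 1)] differences are below [|n|^3], whence the sum of [ln p]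
    is at most [3 (2 V - 1) ln |n|], about [12 w ln |n|]. Chebyshev's bound is about
    [(ln 2 / 2) w^2], which is larger for [w >= 80 ln |n|]. *)
Lemma small_elements_log (n : Z) (S : Z -> Prop) (L : list Z) :
  has_property_D n S -> (400 <= Z.abs n)%Z -> NoDup L ->
  (forall x, In x L -> S x /\ (x <= Z.abs n ^ 3)%Z) ->
  INR (length L) <= 320 * ln (IZR (Z.abs n)) + 9.
Proof.
  intros HS Hn HL HSL.
  set (l := ln (IZR (Z.abs n))).
  assert (H2 := ln_2_bounds).
  assert (Hl : 8 * ln 2 <= l).
  { replace (8 * ln 2) with (ln (2 ^ 8)) by (rewrite ln_pow by lra; simpl INR; ring).
    apply Rcomplements.ln_le; [apply pow_lt; lra|].
    replace (2 ^ 8) with 256 by ring. apply IZR_le; lia. }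
  (* [w = 2 u] is even so that [w^2 / 2] is an integer, and [u <= 40 l + 1] makes
     [4 w + 1 <= 320 l + 9]. *)
  destruct (archimed (40 * l)) as [K1 K2].
  assert (HK0 : (0 <= up (40 * l))%Z) by (apply le_IZR; lra).
  destruct (Z_of_nat_complete _ HK0) as [u Eu]. rewrite Eu, <- INR_IZR_INZ in K1, K2.
  set (w := (2 * u)%nat). set (N := (2 * u * u)%nat).
  assert (Hw : INR w = 2 * INR u) by (unfold w; rewrite mult_INR; reflexivity).
  assert (Hu : (100 <= u)%nat) by (apply INR_le; simpl; lra).
  set (V := (2 * w + 1)%nat).
  assert (HV : INR V = 2 * INR w + 1) by (unfold V; rewrite plus_INR, mult_INR; reflexivity).
  destruct (le_lt_dec (2 * V) (length L)) as [Hlen|Hlen].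
  2:{ assert (H : (length L <= 4 * w + 1)%nat) by (unfold V in Hlen; lia).
      apply le_INR in H. rewrite plus_INR, mult_INR in H. simpl (INR 4) in H. simpl (INR 1) in H. lra. }
  exfalso.
  set (L' := firstn (2 * V) L).
  assert (HL' : NoDup L') by (unfold L'; rewrite <- (firstn_skipn (2 * V) L) in HL; now apply NoDup_app_remove_r in HL).
  assert (Hlen' : length L' = (2 * V)%nat) by (apply firstn_length_le; exact Hlen).
  assert (HSL' : forall x, In x L' -> S x /\ (x <= Z.abs n ^ 3)%Z).
  { intros x Hx. apply HSL. rewrite <- (firstn_skipn (2 * V) L). apply in_or_app; now left. }
  destruct (@ResidueCliques.sieving_primes w N n) as (Ps & P1 & P2 & P3 & P4).
  { unfold N. lia. } { unfold N, w. lia. } { unfold w. lia. }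
  set (Q := map Z.of_nat Ps).
  assert (HQ : NoDup Q).
  { unfold Q. apply FinFun.Injective_map_NoDup; [|exact P1]. intros a b. apply Nat2Z.inj. }
  assert (HQp : forall p, In p Q -> prime p).
  { intros p Hp. apply in_map_iff in Hp. destruct Hp as (p' & <- & Hp'). now apply P2. }
  (* The bound on residues requires odd primes not dividing [n]; the primes dividing [2 |n|] cost at
     most [ln (2 |n|)]. *)
  set (d := (2 * Z.abs n)%Z).
  set (P := filter (fun p => negb (d mod p =? 0)%Z) Q).
  assert (HP : NoDup P) by now apply NoDup_filter.
  assert (HPp : forall p, In p P -> prime p) by (intros p Hp; apply HQp; now apply filter_In in Hp).
  assert (Hpairs : forall p, In p P -> INR V <= INR (equal_pairs (residues p L'))).
  { intros p Hp. apply filter_In in Hp. destruct Hp as [HpQ Hpd].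
    apply negb_true_iff, Z.eqb_neq in Hpd.
    assert (Hpr := HQp p HpQ). assert (Hp2 := prime_ge_2 p Hpr).
    apply in_map_iff in HpQ. destruct HpQ as (p' & <- & Hp').
    assert (B : (length (nodup Z.eq_dec (residues (Z.of_nat p') L')) <= 2 * w + 1)%nat).
    { apply P4; [exact Hp'| | |].
      - intros ->. apply Hpd. unfold d. rewrite Z.mul_comm. apply Z_mod_mult.
      - intros E. apply Hpd. apply Z.mod_divide in E; [|lia]. apply Z.mod_divide; [lia|].
        unfold d. apply Z.divide_mul_r. now apply Z.divide_abs_r.
      - intros x y Hx Hy Hxy. apply HS; [| |exact Hxy]; now apply HSL'. }
    assert (E := equal_pairs_lower_bound (residues (Z.of_nat p') L') (Z.of_nat V) 1 ltac:(lia)).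
    specialize (E ltac:(unfold V; lia)).
    unfold residues in E at 1. rewrite length_map, Hlen' in E.
    apply le_INR. lia. }
  assert (S1 := larger_sieve_log P L' HP HPp HL').
  assert (HX : 0 < IZR (Z.abs n ^ 3)) by (apply IZR_lt, Z.pow_pos_nonneg; lia).
  assert (S2 := log_differences_bound L' (IZR (Z.abs n ^ 3)) HL' HX).
  specialize (S2 ltac:(intros x Hx; destruct (HSL' x Hx) as [Sx Lx]; split; apply IZR_le; [apply Z.lt_le_incl; now apply HS|exact Lx])).
  rewrite Hlen' in S2. specialize (S2 ltac:(unfold V; lia)).
  rewrite mult_INR in S2. simpl (INR 2) in S2.
  assert (HV1 : 1 <= INR V) by (assert (0 <= INR w) by apply pos_INR; lra).
  assert (Hln3 : ln (IZR (Z.abs n ^ 3)) = 3 * l).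
  { change 3%Z with (Z.of_nat 3). rewrite <- pow_IZR, ln_pow by (apply IZR_lt; lia).
    fold l. simpl INR. ring. }
  assert (S3 : log_differences L' <= INR V * (2 * INR V - 1) * (3 * l)).
  { eapply Rle_trans; [exact S2|].
    replace ((1 + 1) * INR V * ((1 + 1) * INR V - 1) / 2) with (INR V * (2 * INR V - 1)) by field.
    apply Rmult_le_compat_l; [apply Rmult_le_pos; lra|].
    rewrite <- Hln3. apply Rcomplements.ln_le.
    - apply Rdiv_lt_0_compat; [apply Rmult_lt_0_compat; lra | lra].
    - apply (Rmult_le_reg_r (2 * ((1 + 1) * INR V - 1))); [lra|].
      unfold Rdiv. rewrite Rmult_assoc, Rinv_l by lra. rewrite Rmult_1_r.
      apply Rmult_le_compat_l; lra. }
  assert (Hlnp : forall p, In p P -> 0 <= ln (IZR p)).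
  { intros p Hp. assert (Hp2 := prime_ge_2 p (HPp p Hp)). rewrite <- ln_1.
    apply Rcomplements.ln_le; [lra|apply IZR_le; lia]. }
  assert (S4 : INR V * sumR (fun p => ln (IZR p)) P <= INR V * ((2 * INR V - 1) * (3 * l))).
  { rewrite <- sumR_scal. rewrite <- Rmult_assoc. eapply Rle_trans; [|exact S3].
    eapply Rle_trans; [|exact S1]. apply sumR_le. intros p Hp.
    rewrite Rmult_comm. apply Rmult_le_compat_l; [now apply Hlnp | now apply Hpairs]. }
  assert (S5 : sumR (fun p => ln (IZR p)) P <= (2 * INR V - 1) * (3 * l))
    by (apply (Rmult_le_reg_l (INR V)); [lra|exact S4]).
  assert (Hd1 : ln (IZR d) = ln 2 + l).
  { unfold d. rewrite mult_IZR, ln_mult; [reflexivity|lra|apply IZR_lt; lia]. }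
  assert (S6 : sumR (fun p => ln (IZR p)) Q <= (2 * INR V - 1) * (3 * l) + (ln 2 + l)).
  { rewrite (sumR_filter (fun p => negb (d mod p =? 0)%Z)). fold P.
    apply Rplus_le_compat; [exact S5|]. rewrite <- Hd1.
    eapply Rle_trans; [|apply (prime_log_sum Q d HQ HQp); unfold d; lia].
    right. apply sumR_ext. intros p _. destruct (_ =? _)%Z; reflexivity. }
  destruct (ln_fold_mul Ps) as [F1 F2].
  { intros p Hp. assert (Hp2 := prime_ge_2 _ (P2 p Hp)). lia. }
  fold Q in F2.
  apply le_INR in P3. rewrite mult_INR, !pow_INR, mult_INR in P3. simpl (INR 2) in P3.
  assert (Hw0 : 200 <= INR w) by (apply le_INR in Hu; replace (INR 100) with 100 in Hu by (simpl; lra); lra).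
  assert (Hww : 0 < INR w * INR w) by (apply Rmult_lt_0_compat; lra).
  assert (F1' : 0 < INR (fold_right Nat.mul 1%nat Ps)) by (apply lt_0_INR; exact F1).
  apply Rcomplements.ln_le in P3; [|apply pow_lt; lra].
  rewrite ln_mult, !ln_pow, ln_mult, F2, S_INR in P3; try lra; try (apply pow_lt; lra).
  replace (1 + 1) with 2 in P3 by ring.
  assert (HN : INR N = INR w * INR w / 2).
  { unfold N. rewrite !mult_INR, Hw. simpl (INR 2). field. }
  rewrite HN in P3.
  (* Tangent of [ln] at 512, close to the smallest possible [w], which is above 420. *)
  assert (Hlnw : ln (INR w) <= 9 * ln 2 + (INR w / 512 - 1)).
  { replace (9 * ln 2) with (ln 512).
    - apply ln_le_tangent; lra.
    - replace 512 with (2 ^ 9) by ring. rewrite ln_pow by lra. simpl INR. ring. }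
  assert (Hwl : 80 * l <= INR w) by lra.
  assert (T1 : (INR w + 1) * (2 * ln (INR w)) <= (INR w + 1) * (2 * (5.48 + INR w / 512)))
    by (apply Rmult_le_compat_l; lra).
  assert (T2 : (2 * INR V - 1) * (3 * l) <= (4 * INR w + 1) * (3 * (INR w / 80))).
  { apply Rmult_le_compat; lra. }
  assert (T3 : 0 <= (ln 2 - 0.66) * (INR w * INR w)) by (apply Rmult_le_pos; lra).
  assert (T4 : 0 <= (INR w - 400) * INR w) by (apply Rmult_le_pos; lra).
  lra.
Qed.

Lemma insert_sorted (x : Z) (l : list Z) : StronglySorted Z.lt l -> ~ In x l ->
  exists l', StronglySorted Z.lt l' /\ Permutation (x :: l) l'.
Proof.
  induction 1 as [|y l Hl IH Hy]; intros Hx.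
  - exists [x]. split; [repeat constructor | reflexivity].
  - destruct (Z_lt_ge_dec x y) as [Hxy|Hxy].
    + exists (x :: y :: l). split; [|reflexivity]. constructor; [now constructor|].
      constructor; [exact Hxy|]. rewrite Forall_forall in *. intros z Hz. specialize (Hy z Hz). lia.
    + destruct IH as (l' & S1 & S2); [intros H; apply Hx; now right|].
      exists (y :: l'). split.
      * constructor; [exact S1|]. rewrite Forall_forall in *. intros z Hz.
        apply (Permutation_in z (Permutation_sym S2)) in Hz. destruct Hz as [<-|Hz]; [|now apply Hy].
        assert (x <> y) by (intros ->; apply Hx; now left). lia.
      * rewrite perm_swap. now constructor.
Qed.

Lemma NoDup_sorted_permutation (l : list Z) : NoDup l ->
  exists l', StronglySorted Z.lt l' /\ Permutation l l'.
Proof.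
  induction 1 as [|x l Hx Hl (l' & S1 & S2)].
  - exists []. split; constructor.
  - destruct (insert_sorted x l' S1) as (l'' & T1 & T2).
    + intros H. apply Hx. now apply (Permutation_in x (Permutation_sym S2)).
    + exists l''. split; [exact T1|]. rewrite <- T2. now constructor.
Qed.

Lemma StronglySorted_nth_lt (l : list Z) (i : nat) : StronglySorted Z.lt l ->
  (Datatypes.S i < length l)%nat -> (nth i l 0 < nth (Datatypes.S i) l 0)%Z.
Proof.
  intros H. revert i. induction H as [|y l Hl IH Hy]; intros i Hi; [simpl in Hi; lia|].
  destruct i as [|i].
  - rewrite Forall_forall in Hy. apply Hy. simpl. apply nth_In. simpl in Hi; lia.
  - apply IH. simpl in Hi; lia.
Qed.

Lemma large_elements_le19 (n X : Z) (S : Z -> Prop) (L : list Z) :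
  has_property_D n S -> n <> 0%Z -> (n * n <= X)%Z -> (1024 <= X)%Z ->
  (Z.abs n <= 400 \/ Z.abs n ^ 3 <= X)%Z -> NoDup L ->
  (forall x, In x L -> S x /\ (X < x)%Z) -> (length L <= 19)%nat.
Proof.
  intros HS Hn HX1 HX2 HX3 HL HSL.
  destruct (le_lt_dec (length L) 19) as [|Hlen]; [assumption|exfalso].
  destruct (NoDup_sorted_permutation L HL) as (l & Hl & Hp).
  assert (Hlen' : (20 <= length l)%nat) by (rewrite <- (Permutation_length Hp); exact Hlen).
  apply (large_elements_lt20 n X S (fun i => nth i l 0%Z)); try assumption.
  - intros i Hi. apply HSL. apply (Permutation_in _ (Permutation_sym Hp)), nth_In. lia.
  - intros i Hi. apply StronglySorted_nth_lt; [exact Hl|lia].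
Qed.

(** A duplicate-free list in [S] that cannot be extended enumerates [S]. Excluded middle decides
    whether an extension exists, and the length bound ends the process. *)
Lemma enumerates_of_bound (S : Z -> Prop) (B : nat) :
  (forall L, NoDup L -> (forall x, In x L -> S x) -> (length L <= B)%nat) ->
  exists l, enumerates S l /\ (length l <= B)%nat.
Proof.
  intros HB.
  assert (H : forall k L, NoDup L -> (forall x, In x L -> S x) -> (B - length L <= k)%nat ->
    exists l, enumerates S l).
  { induction k as [|k IH]; intros L HL HSL Hk;
      (destruct (classic (exists x, S x /\ ~ In x L)) as [(x & Sx & Hx)|Hnone];
       [|exists L; split; [exact HL|]; intros x; split; [|apply HSL]; intros Sx;
         apply NNPP; intros Hx; apply Hnone; now exists x]);
      assert (HL' : NoDup (x :: L)) by (now constructor);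
      assert (HSL' : forall y, In y (x :: L) -> S y) by (intros y [<-|Hy]; auto);
      assert (Hb := HB _ HL' HSL'); simpl in Hb; [lia|].
    apply (IH (x :: L) HL' HSL'). simpl. lia. }
  destruct (H B [] (NoDup_nil _) ltac:(intros x []) ltac:(lia)) as [l Hl].
  exists l. split; [exact Hl|]. apply HB; [apply Hl|]. intros x. apply Hl.
Qed.

Lemma length_split (X : Z) (L : list Z) :
  length L = (length (filter (fun x => x <=? X)%Z L) + length (filter (fun x => negb (x <=? X)%Z) L))%nat.
Proof. symmetry. apply filter_length. Qed.

(** Bounding every set with the property, which includes its finiteness, bounds the supremum. The
    strict bound passes to [M_n] because the supremum of a nonempty bounded set of integers is
    attained. *)
Theorem theorem4 (n : Z) (hn : n <> 0%Z) :
  ((Z.abs n <= 400)%Z ->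
    forall S : Z -> Prop, has_property_D n S ->
       exists l : list Z, enumerates S l /\ (length l <= 32)%nat)
  /\
  ((400 <= Z.abs n)%Z ->
    forall S : Z -> Prop, has_property_D n S ->
       exists l : list Z, enumerates S l /\
         (INR (length l) < 267.81 * ln (IZR (Z.abs n)) * (ln (ln (IZR (Z.abs n)))) ^ 2)%R).
Proof.
  assert (Hfilter : forall (S : Z -> Prop) (b : Z -> bool) (L : list Z), (forall x, In x L -> S x) ->
    forall x, In x (filter b L) -> S x /\ b x = true).
  { intros S b L HL x Hx. apply filter_In in Hx. destruct Hx. split; [now apply HL | assumption]. }
  split; intros Hn S HS.
  - apply enumerates_of_bound. intros L HL HSL.
    set (X := Z.max (n * n) 1024).
    rewrite (length_split X L).
    assert (A : (length (filter (fun x => x <=? X)%Z L) <= 13)%nat).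
    { apply (small_elements_le13 n S _ HS hn Hn); [now apply NoDup_filter|].
      intros x Hx. apply (Hfilter S _ L HSL) in Hx. destruct Hx as [Sx Hx].
      split; [exact Sx | now apply Z.leb_le]. }
    assert (B : (length (filter (fun x => negb (x <=? X)%Z) L) <= 19)%nat).
    { apply (large_elements_le19 n X S); try assumption; try (unfold X; lia); [now apply NoDup_filter|].
      intros x Hx. apply (Hfilter S _ L HSL) in Hx. destruct Hx as [Sx Hx].
      split; [exact Sx|]. apply negb_true_iff, Z.leb_gt in Hx. exact Hx. }
    lia.
  - set (X := (Z.abs n ^ 3)%Z). set (l := ln (IZR (Z.abs n))).
    assert (HX : (n * n <= X /\ 1024 <= X)%Z).
    { unfold X. rewrite <- Z.abs_square. simpl Z.pow. unfold Z.pow_pos. simpl.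
      set (a := Z.abs n) in *. clearbody a.
      assert (a * 1 <= a * a)%Z by (apply Z.mul_le_mono_nonneg_l; lia).
      assert (a * a * 1 <= a * a * a)%Z by (apply Z.mul_le_mono_nonneg_l; lia).
      assert (400 * 400 <= a * a)%Z by (apply Z.mul_le_mono_nonneg; lia). lia. }
    assert (H2 := ln_2_bounds).
    assert (Hl : 8 * ln 2 <= l).
    { replace (8 * ln 2) with (ln (2 ^ 8)) by (rewrite ln_pow by lra; simpl INR; ring).
      apply Rcomplements.ln_le; [apply pow_lt; lra|].
      replace (2 ^ 8) with 256 by ring. apply IZR_le; lia. }
    (* An integer bound is needed to obtain the enumeration; the sharper real bound is applied to it
       afterwards. *)
    destruct (archimed (320 * l + 28)) as [K1 K2].
    assert (HK0 : (0 <= up (320 * l + 28))%Z) by (apply le_IZR; lra).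
    destruct (Z_of_nat_complete _ HK0) as [B EB]. rewrite EB, <- INR_IZR_INZ in K1, K2.
    assert (Hall : forall L, NoDup L -> (forall x, In x L -> S x) -> INR (length L) <= 320 * l + 28).
    { intros L HL HSL. rewrite (length_split X L), plus_INR.
      assert (A : INR (length (filter (fun x => x <=? X)%Z L)) <= 320 * l + 9).
      { apply (small_elements_log n S _ HS Hn); [now apply NoDup_filter|].
        intros x Hx. apply (Hfilter S _ L HSL) in Hx. destruct Hx as [Sx Hx].
        split; [exact Sx | now apply Z.leb_le]. }
      assert (C : (length (filter (fun x => negb (x <=? X)%Z) L) <= 19)%nat).
      { apply (large_elements_le19 n X S); try assumption; try apply HX; try (right; unfold X; lia);
          [now apply NoDup_filter|].
        intros x Hx. apply (Hfilter S _ L HSL) in Hx. destruct Hx as [Sx Hx].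
        split; [exact Sx|]. apply negb_true_iff, Z.leb_gt in Hx. exact Hx. }
      apply le_INR in C. replace (INR 19) with 19 in C by (simpl; lra). lra. }
    destruct (enumerates_of_bound S B) as (L & HL & _).
    { intros L HL HSL. apply INR_le. specialize (Hall L HL HSL). lra. }
    exists L. split; [exact HL|].
    assert (HLb : INR (length L) <= 320 * l + 28).
    { apply Hall; [apply HL|]. intros x. apply HL. }
    assert (Hll : 2 * ln 2 <= ln l).
    { replace (2 * ln 2) with (ln (2 ^ 2)) by (rewrite ln_pow by lra; simpl INR; ring).
      apply Rcomplements.ln_le; lra. }
    eapply Rle_lt_trans; [exact HLb|].
    (* [267.81 * 1.74 > 465], and the surplus [145 l] over [320 l] exceeds 28 since
       [l >= 8 ln 2]. *)
    assert (Hsq : 1.74 <= ln l ^ 2).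
    { apply Rle_trans with (1.32 ^ 2); [lra|]. apply pow_incr. lra. }
    apply Rlt_le_trans with (267.81 * l * 1.74); [lra|].
    apply Rmult_le_compat_l; lra.
Qed.
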